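(* There exist absolute constants $K_1,K_2>0$ such that the following holds. Let $d\ge2$, $s\ge2$ be integers and fix $\epsilon>0$, $0<\alpha_1\le1$, $0<\alpha_2\le1$ such that $K_1(d^7s^2+d^2s^7)\epsilon^{1/4}/(\alpha_1\alpha_2)<1$. Let $n=n_0<n_1<\dots<n_d=\ell$ and $p=p_0<p_1<\dots<p_s=\ell$. Suppose that $W^{(1)}_i\in\mathbb{R}^{n_i\times n_{i-1}}$ for $i=1,\dots,d-1$ and $W^{(2)}_i\in\mathbb{R}^{p_i\times p_{i-1}}$ for $i=1,\dots,s-1$ satisfy the WDC with constants $\epsilon$ and $1$; that $W^{(1)}_d\in\mathbb{R}^{\ell\times n_{d-1}}$ satisfies the WDC with constants $\epsilon$ and $\alpha_1$; that $W^{(2)}_s\in\mathbb{R}^{\ell\times p_{s-1}}$ satisfies the WDC with constants $\epsilon$ and $\alpha_2$; and that $(W^{(1)}_d,W^{(2)}_s)$ satisfies the joint-WDC with constants $\epsilon$ and $\alpha=\alpha_1\alpha_2$. Let $(h_0,m_0)\in\mathbb{R}^n\times\mathbb{R}^p$ with $(h_0,m_0)\ne(0,0)$, let $\mathcal K=\{(h,0):h\in\mathbb{R}^n\}\cup\{(0,m):m\in\mathbb{R}^p\}\subset\mathbb{R}^n\times\mathbb{R}^p$, and $$\mathcal A=\mathcal A_{K_2d^3s^3\epsilon^{1/4}\alpha^{-1},(h_0,m_0)}\cup\mathcal A_{K_2d^8s^3\epsilon^{1/4}\alpha^{-1},(-\rho^{(1)}_dh_0,m_0)}\cup\mathcal A_{K_2d^3s^8\epsilon^{1/4}\alpha^{-1},(\rho^{(2)}_sh_0,-m_0)}\cup\mathcal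 A_{K_2d^8s^8\epsilon^{1/4}\alpha^{-1},(-\rho^{(1)}_d\rho^{(2)}_sh_0,-m_0)}.$$ Then for every $(h,m)\notin\mathcal A\cup\mathcal K$, at least one of the choices $g=g_{1,(h,m)}$ or $g=g_{2,(h,m)}$ satisfies $D_{-g}f(h,m)<0$. Additionally, for all $(h,m)\in\mathcal K$ and all $(x,y)\in\mathbb{R}^n\times\mathbb{R}^p$, $D_{(x,y)}f(h,m)\le0$. Here $\rho^{(1)}_d,\rho^{(2)}_s$ are positive numbers that converge to $1$ as $d\to\infty$ and $s\to\infty$, respectively.
   Context: Networks: $\mathrm{relu}(x)=\max(x,0)$ entrywise, $G^{(1)}(h)=\mathrm{relu}(W^{(1)}_d\cdots\mathrm{relu}(W^{(1)}_2\,\mathrm{relu}(W^{(1)}_1h))\cdots)$ maps $\mathbb{R}^n\to\mathbb{R}^\ell$, and $G^{(2)}(m)=\mathrm{relu}(W^{(2)}_s\cdots\mathrm{relu}(W^{(2)}_2\,\mathrm{relu}(W^{(2)}_1m))\cdots)$ maps $\mathbb{R}^p\to\mathbb{R}^\ell$. With $\odot$ the entrywise product, the objective is $$f(h,m)=\tfrac12\big\|G^{(1)}(h_0)\odot G^{(2)}(m_0)-G^{(1)}(h)\odot G^{(2)}(m)\big\|_2^2 .$$ One-sided directional derivative (unnormalized): $D_gf(h,m)=\lim_{t\to0^+}\frac{f((h,m)+tg)-f(h,m)}{t}$. Directions: $f$ is piecewise smooth; fix any $w\in\mathbb{R}^{n}\times\mathbb{R}^p$ such that $f$ is differentiable at $(h,m)+\delta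 w$ for all sufficiently small $\delta>0$, and set $$g_{1,(h,m)}=\begin{bmatrix}\lim_{\delta\to0^+}\nabla_hf((h,m)+\delta w)\\0\end{bmatrix},\qquad g_{2,(h,m)}=\begin{bmatrix}0\\\lim_{\delta\to0^+}\nabla_mf((h,m)+\delta w)\end{bmatrix}.$$ Hyperbolic neighborhoods: for $\eta>0$ and $(\tilde h,\tilde m)\in\mathbb{R}^n\times\mathbb{R}^p$, $$\mathcal A_{\eta,(\tilde h,\tilde m)}=\Big\{(h,m)\in\mathbb{R}^n\times\mathbb{R}^p:\ \exists\,c'>0\text{ s.t. }\big\|(h,m)-(c'\tilde h,\tfrac1{c'}\tilde m)\big\|_2\le\eta\,\big\|(c'\tilde h,\tfrac1{c'}\tilde m)\big\|_2\Big\}.$$ Constants $\rho$: let $g(\theta)=\cos^{-1}\!\big(\frac{(\pi-\theta)\cos\theta+\sin\theta}{\pi}\big)$, $\check\theta_0=\pi$, $\check\theta_i=g(\check\theta_{i-1})$, and $\rho_a=\sum_{i=1}^{a-1}\frac{\sin\check\theta_i}{\pi}\prod_{j=i+1}^{a-1}\frac{\pi-\check\theta_j}{\pi}$; then $\rho^{(1)}_d=\rho_a$ with $a=d$, and $\rho^{(2)}_s=\rho_a$ with $a=s$. Matrix $Q$: for nonzero $x,y\in\mathbb{R}^k$ with $\theta_0=\angle(x,y)$, $\hat x=x/\|x\|_2$, $\hat y=y/\|y\|_2$, let $Q_{x,y}=\frac{\pi-\theta_0}{2\pi}I_k+\frac{\sin\theta_0}{2\pi}M_{\hat x\leftrightarrow\hat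 y}$, where $M_{\hat x\leftrightarrow\hat y}$ is the matrix mapping $\hat x\mapsto\hat y$, $\hat y\mapsto\hat x$, and $z\mapsto0$ for all $z\in\mathrm{span}(\{x,y\})^\perp$. For a matrix $W$ and vector $x$, $\mathrm{diag}(Wx>0)$ is the diagonal matrix with $(i,i)$ entry $1$ if $(Wx)_i>0$ and $0$ otherwise, and $W_{+,x}=\mathrm{diag}(Wx>0)W$. $\|\cdot\|$ is the spectral norm. WDC: $W\in\mathbb{R}^{q\times k}$ with rows $w_i^\top$ satisfies the WDC with constants $\epsilon>0$ and $0<\alpha\le1$ if for all nonzero $x,y\in\mathbb{R}^k$, $\big\|\sum_{i=1}^q1_{w_i\cdot x>0}1_{w_i\cdot y>0}\,w_iw_i^\top-\alpha Q_{x,y}\big\|\le\epsilon$. Joint-WDC: $B\in\mathbb{R}^{\ell\times k}$ and $C\in\mathbb{R}^{\ell\times r}$ satisfy the joint-WDC with constants $\epsilon>0$ and $0<\alpha\le1$ if for all nonzero $h,x\in\mathbb{R}^k$ and nonzero $m,y\in\mathbb{R}^r$, $$\big\|B_{+,h}^\top\mathrm{diag}(C_{+,m}m\odot C_{+,y}y)B_{+,x}-\tfrac\alpha\ell\,m^\top Q_{m,y}y\cdot Q_{h,x}\big\|\le\tfrac\epsilon\ell\|m\|_2\|y\|_2,$$ $$\big\|C_{+,m}^\top\mathrm{diag}(B_{+,h}h\odot B_{+,x}x)C_{+,y}-\tfrac\alpha\ell\,h^\top Q_{h,x}x\cdot Q_{m,y}\big\|\le\tfrac\epsilon\ell\|h\|_2\|x\|_2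 .$$ *)

(* Defs.v *)
From mathcomp Require Import all_boot all_order all_algebra.
From mathcomp Require Import all_classical all_reals all_analysis.
From mathcomp Require Import ring lra.
Import Order.TTheory GRing.Theory Num.Theory.
Import numFieldNormedType.Exports.

Set Implicit Arguments.
Unset Strict Implicit.
Unset Printing Implicit Defensive.

Local Open Scope classical_set_scope.
Local Open Scope ring_scope.

Section Euclidean.
Context {R : realType}.

Definition dotv {k : nat} (x y : 'cV[R]_k) : R := \sum_i x i 0 * y i 0.

(* The library norm on matrices and on pairs is the sup norm, so the Euclidean
   norms are spelled out.  Both norms induce the same topology; limits and
   differentiability below therefore use the library structures directly. *)
Definition norm2 {k : nat} (x : 'cV[R]_k) : R := Num.sqrt (\sum_i x i 0 ^+ 2).

Definition norm2_pair {n p : nat} (u : 'cV[R]_n * 'cV[R]_p) : R :=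
  Num.sqrt (norm2 u.1 ^+ 2 + norm2 u.2 ^+ 2).

Definition spectral_norm {q k : nat} (A : 'M[R]_(q, k)) : R :=
  sup [set norm2 (A *m x) | x in [set x : 'cV[R]_k | norm2 x <= 1]].

Definition unitv {k : nat} (x : 'cV[R]_k) : 'cV[R]_k := (norm2 x)^-1 *: x.

Definition angle {k : nat} (x y : 'cV[R]_k) : R :=
  acos (dotv x y / (norm2 x * norm2 y)).

Definition hadamard {k : nat} (x y : 'cV[R]_k) : 'cV[R]_k :=
  \col_i (x i 0 * y i 0).

End Euclidean.

Section WeightConditions.
Context {R : realType}.

Definition is_swap_mx {k : nat} (x y : 'cV[R]_k) (M : 'M[R]_k) : Prop :=
  [/\ M *m unitv x = unitv y,
      M *m unitv y = unitv x &
      forall z : 'cV[R]_k, dotv x z = 0 -> dotv y z = 0 -> M *m z = 0].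

(* For nonzero x and y exactly one matrix satisfies is_swap_mx, see
   swap_mxP and is_swap_mx_inj. *)
Definition swap_mx {k : nat} (x y : 'cV[R]_k) : 'M[R]_k :=
  xget 0 [set M | is_swap_mx x y M].

Definition Qmx {k : nat} (x y : 'cV[R]_k) : 'M[R]_k :=
  ((pi - angle x y) / (2 * pi))%:M
  + (sin (angle x y) / (2 * pi)) *: swap_mx x y.

Definition Wplus {q k : nat} (W : 'M[R]_(q, k)) (x : 'cV[R]_k) : 'M[R]_(q, k) :=
  diag_mx (\row_i (0 < (W *m x) i 0)%R%:R) *m W.

Definition WDC {q k : nat} (W : 'M[R]_(q, k)) (eps alpha : R) : Prop :=
  forall x y : 'cV[R]_k, x != 0 -> y != 0 ->
    spectral_norm
      (\sum_(i < q) ((0 < (W *m x) i 0) && (0 < (W *m y) i 0))%R%:R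
                    *: ((row i W)^T *m row i W)
       - alpha *: Qmx x y) <= eps.

Definition joint_WDC {l k r : nat} (B : 'M[R]_(l, k)) (C : 'M[R]_(l, r))
    (eps alpha : R) : Prop :=
  forall (h x : 'cV[R]_k) (m y : 'cV[R]_r),
    h != 0 -> x != 0 -> m != 0 -> y != 0 ->
    spectral_norm
      ((Wplus B h)^T
         *m diag_mx (hadamard (Wplus C m *m m) (Wplus C y *m y))^T
         *m Wplus B x
       - (alpha / l%:R * dotv m (Qmx m y *m y)) *: Qmx h x)
      <= eps / l%:R * norm2 m * norm2 y
    /\
    spectral_norm
      ((Wplus C m)^T
         *m diag_mx (hadamard (Wplus B h *m h) (Wplus B x *m x))^T
         *m Wplus C y
       - (alpha / l%:R * dotv h (Qmx h x *m x)) *: Qmx m y)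
      <= eps / l%:R * norm2 h * norm2 x.

End WeightConditions.

Section Networks.
Context {R : realType}.

Definition relu {k : nat} (x : 'cV[R]_k) : 'cV[R]_k :=
  map_mx (fun a : R => Num.max a 0) x.

(* [W i] is the weight matrix of layer i + 1, from width [N i] to [N i.+1];
   only the first k matrices matter. *)
Fixpoint layers (N : nat -> nat) (W : forall i, 'M[R]_(N i.+1, N i)) (k : nat)
    (x : 'cV[R]_(N 0%N)) : 'cV[R]_(N k) :=
  match k with
  | 0%N => x
  | k'.+1 => relu (W k' *m layers W k' x)
  end.

(* A network with k hidden layers followed by the last layer [V]; the last
   matrix is separate so that two networks of different depths can share the
   output dimension l. *)
Definition network (N : nat -> nat) (W : forall i, 'M[R]_(N i.+1, N i))
    (k l : nat) (V : 'M[R]_(l, N k)) (x : 'cV[R]_(N 0%N)) : 'cV[R]_l :=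
  relu (V *m layers W k x).

Definition objective {n p l : nat} (G1 : 'cV[R]_n -> 'cV[R]_l)
    (G2 : 'cV[R]_p -> 'cV[R]_l) (h0 : 'cV[R]_n) (m0 : 'cV[R]_p)
    (u : 'cV[R]_n * 'cV[R]_p) : R :=
  2^-1 * norm2 (hadamard (G1 h0) (G2 m0) - hadamard (G1 u.1) (G2 u.2)) ^+ 2.

End Networks.

Section Directions.
Context {R : realType} {n p : nat}.
Implicit Types (f : 'cV[R]_n * 'cV[R]_p -> R) (u w g : 'cV[R]_n * 'cV[R]_p).

Definition dir_quotient f u g (t : R) : R := (f (u + t *: g) - f u) / t.

(* As for the library's ['D_v f], the value is only meaningful together with
   the corresponding convergence statement. *)
Definition dir_derivable f u g : Prop := cvg (dir_quotient f u g @ 0^'+).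

Definition dir_derive f u g : R := lim (dir_quotient f u g @ 0^'+).

Definition grad_h f u : 'cV[R]_n :=
  \col_i 'D_((delta_mx i 0 : 'cV[R]_n, 0 : 'cV[R]_p)) f u.

Definition grad_m f u : 'cV[R]_p :=
  \col_i 'D_((0 : 'cV[R]_n, delta_mx i 0 : 'cV[R]_p)) f u.

Definition admissible_shift f u w : Prop :=
  \forall delta \near 0^'+, differentiable f (u + delta *: w).

Definition g1_dir f u w : 'cV[R]_n * 'cV[R]_p :=
  (lim (grad_h f (u + delta *: w) @[delta --> 0^'+]), 0).

Definition g2_dir f u w : 'cV[R]_n * 'cV[R]_p :=
  (0, lim (grad_m f (u + delta *: w) @[delta --> 0^'+])).

Definition hyper_nbhd (eta : R) (ht : 'cV[R]_n) (mt : 'cV[R]_p) :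
    set ('cV[R]_n * 'cV[R]_p) :=
  [set u | exists c : R, 0 < c /\
     norm2_pair (u - (c *: ht, c^-1 *: mt))
       <= eta * norm2_pair (c *: ht, c^-1 *: mt)].

Definition axes : set ('cV[R]_n * 'cV[R]_p) :=
  [set (h, 0) | h in [set: 'cV[R]_n]] `|` [set (0, m) | m in [set: 'cV[R]_p]].

End Directions.

Section Rho.
Context {R : realType}.

Definition gtheta (t : R) : R := acos (((pi - t) * cos t + sin t) / pi).

Definition theta_check (i : nat) : R := iter i gtheta pi.

Definition rho (a : nat) : R :=
  \sum_(1 <= i < a) (sin (theta_check i) / pi
    * \prod_(i.+1 <= j < a) ((pi - theta_check j) / pi)).

End Rho.

Section SwapMatrix.
Context {R : realType} {k : nat}.
Implicit Types (x y z : 'cV[R]_k) (M : 'M[R]_k).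

Lemma dotvC x y : dotv x y = dotv y x.
Proof. by apply: eq_bigr => i _; rewrite mulrC. Qed.

Lemma dotvDr x y z : dotv x (y + z) = dotv x y + dotv x z.
Proof. by rewrite -big_split; apply: eq_bigr => i _; rewrite mxE mulrDr. Qed.

Lemma dotvDl x y z : dotv (x + y) z = dotv x z + dotv y z.
Proof. by rewrite dotvC dotvDr !(dotvC z). Qed.

Lemma dotvZr (a : R) x y : dotv x (a *: y) = a * dotv x y.
Proof. by rewrite /dotv mulr_sumr; apply: eq_bigr => i _; rewrite mxE mulrCA. Qed.

Lemma dotvZl (a : R) x y : dotv (a *: x) y = a * dotv x y.
Proof. by rewrite dotvC dotvZr dotvC. Qed.

Lemma dotv_ge0 x : 0 <= dotv x x.
Proof. by apply: sumr_ge0 => i _; rewrite -expr2 sqr_ge0. Qed.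

Lemma dotv_eq0 x : dotv x x = 0 -> x = 0.
Proof.
move=> x0; apply/colP => i; rewrite mxE; apply/eqP; rewrite -sqrf_eq0.
have := @psumr_eq0P R 'I_k predT (fun i => x i 0 * x i 0).
by move=> /(_ (fun i _ => sqr_ge0 (x i 0)) x0 i isT) /eqP.
Qed.

Lemma norm2_sqr x : norm2 x ^+ 2 = dotv x x.
Proof.
rewrite sqr_sqrtr; last by apply: sumr_ge0 => i _; rewrite sqr_ge0.
by apply: eq_bigr => i _; rewrite expr2.
Qed.

Lemma norm2_neq0 x : x != 0 -> norm2 x != 0.
Proof.
apply: contraNneq => x0; apply/eqP/dotv_eq0.
by rewrite -norm2_sqr x0 expr0n.
Qed.

Lemma dotv_unitv x : x != 0 -> dotv (unitv x) (unitv x) = 1.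
Proof.
move=> /norm2_neq0 x0; rewrite /unitv dotvZl dotvZr -norm2_sqr.
by field.
Qed.

Lemma outerE x y z : (x *m y^T) *m z = dotv y z *: x.
Proof.
rewrite -mulmxA; apply/colP => i; rewrite !mxE big_ord1 !mxE mulrC.
by congr (_ * _); apply: eq_bigr => j _; rewrite !mxE.
Qed.

Lemma is_swap_mx_ex x y : x != 0 -> y != 0 -> exists M, is_swap_mx x y M.
Proof.
move=> x0 y0; have xx := dotv_unitv x0; have yy := dotv_unitv y0.
set u := unitv x in xx; set v := unitv y in yy.
have ux z : dotv x z = 0 -> dotv u z = 0.
  by rewrite /u /unitv dotvZl => ->; rewrite mulr0.
have vy z : dotv y z = 0 -> dotv v z = 0.
  by rewrite /v /unitv dotvZl => ->; rewrite mulr0.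
rewrite /is_swap_mx -/u -/v; clearbody u v.
pose c := dotv u v; have vu : dotv v u = c by rewrite dotvC.
have vcu : dotv (v - c *: u) (v - c *: u) = 1 - c ^+ 2.
  rewrite -scaleNr !(dotvDr, dotvDl, dotvZr, dotvZl) xx yy vu -/c.
  by ring.
have [c1|c1] := eqVneq (1 - c ^+ 2) 0.
  have vE : v = c *: u.
    by apply/eqP; rewrite -subr_eq0; apply/eqP/dotv_eq0; rewrite vcu.
  have cc : c * c = 1 by rewrite -expr2; apply/esym/eqP; rewrite -subr_eq0 c1.
  exists (c *: (u *m u^T)); split.
  - by rewrite -scalemxAl outerE xx scale1r vE.
  - by rewrite -scalemxAl outerE -/c scalerA cc scale1r.
  - by move=> z /ux uz _; rewrite -scalemxAl outerE uz scale0r scaler0.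
exists ((1 - c ^+ 2)^-1 *: (v *m u^T + u *m v^T
          - c *: (u *m u^T) - c *: (v *m v^T))); split.
- rewrite -scalemxAl !mulmxBl mulmxDl -!scalemxAl !outerE xx vu.
  by apply/colP => i; rewrite !mxE; field.
- rewrite -scalemxAl !mulmxBl mulmxDl -!scalemxAl !outerE yy -/c.
  by apply/colP => i; rewrite !mxE; field.
- move=> z /ux uz /vy vz; rewrite -scalemxAl !mulmxBl mulmxDl -!scalemxAl.
  by rewrite !outerE uz vz !scale0r !scaler0 !subr0 addr0 scaler0.
Qed.

Lemma swap_mxP x y : x != 0 -> y != 0 -> is_swap_mx x y (swap_mx x y).
Proof.
move=> x0 y0; have [M HM] := is_swap_mx_ex x0 y0.
exact: (@xgetPex _ 0 [set M | is_swap_mx x y M] (ex_intro _ M HM)).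
Qed.

Lemma is_swap_mx_inj x y M M' : x != 0 -> y != 0 ->
  is_swap_mx x y M -> is_swap_mx x y M' -> M = M'.
Proof.
move=> x0 y0 [Mu Mv Mz] [Mu' Mv' Mz'].
have xx := dotv_unitv x0; have yy := dotv_unitv y0.
have xE : x = norm2 x *: unitv x.
  by rewrite scalerA mulfV ?scale1r ?norm2_neq0.
have yE : y = norm2 y *: unitv y.
  by rewrite scalerA mulfV ?scale1r ?norm2_neq0.
set D := M - M'.
have Du : D *m unitv x = 0 by rewrite mulmxBl Mu Mu' subrr.
have Dv : D *m unitv y = 0 by rewrite mulmxBl Mv Mv' subrr.
have Dz z : dotv (unitv x) z = 0 -> dotv (unitv y) z = 0 -> D *m z = 0.
  move=> uz vz; have xz : dotv x z = 0 by rewrite xE dotvZl uz mulr0.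
  have yz : dotv y z = 0 by rewrite yE dotvZl vz mulr0.
  by rewrite mulmxBl Mz ?Mz' ?subrr.
move: xx yy Du Dv Dz.
move: (unitv x) (unitv y) => u v uu vv Du Dv Dz {xE yE Mu Mv Mu' Mv'}.
pose c := dotv u v; have vu : dotv v u = c by rewrite dotvC.
suff D0 z : D *m z = 0.
  apply/eqP; rewrite -subr_eq0 -/D; apply/eqP/matrixP => i j.
  by have /colP/(_ i) := D0 (delta_mx j 0); rewrite -colE !mxE.
have sub a b : dotv u (z - a *: u - b *: v) = 0 ->
    dotv v (z - a *: u - b *: v) = 0 -> D *m z = 0.
  move=> uz vz; have := Dz _ uz vz.
  by rewrite !mulmxBr -!scalemxAr Du Dv !scaler0 !subr0.
have dotvS t a b : dotv t (z - a *: u - b *: v)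
    = dotv t z - a * dotv t u - b * dotv t v.
  by rewrite -(scaleNr a u) -(scaleNr b v) !(dotvDr, dotvZr) !mulNr.
have [c1|c1] := eqVneq (1 - c ^+ 2) 0.
  have vE : v = c *: u.
    apply/eqP; rewrite -subr_eq0; apply/eqP/dotv_eq0.
    rewrite -scaleNr !(dotvDr, dotvDl, dotvZr, dotvZl) uu vv vu -/c -c1.
    by ring.
  have uz : dotv u (z - dotv u z *: u - 0 *: v) = 0.
    by rewrite dotvS uu; ring.
  apply: (sub _ _ uz).
  by rewrite [X in dotv X]vE dotvZl uz mulr0.
apply: (sub ((dotv u z - c * dotv v z) / (1 - c ^+ 2))
            ((dotv v z - c * dotv u z) / (1 - c ^+ 2)));
  rewrite dotvS ?uu ?vv ?vu -/c.
- by field.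
- by field.
Qed.

End SwapMatrix.

(* Main.v *)
Require Import Defs.
From mathcomp Require Import all_boot all_order all_algebra.
From mathcomp Require Import all_classical all_reals all_analysis.
From mathcomp Require Import ring lra.
Import Order.TTheory GRing.Theory Num.Theory.
Import numFieldNormedType.Exports.
Local Open Scope classical_set_scope.
Local Open Scope ring_scope.

(** Why the theorem holds.

    Freezing the activation patterns of both networks turns the gradient of the
    objective in h into a difference of two cross terms, the back-projection
    through the first network of G2(m) G2(m') G1(h') (entrywise products) for
    (h', m') = (h, m) and for (h', m') = (h0, m0). The weight conditions make
    cross terms explicit. One layer replaces a Gram matrix by Q, which maps y to
    a combination of y and x with coefficients depending only on the angle of x
    and y; so the angle of two features evolves, up to the error epsilon, by one
    fixed map (relu_corr, on cosines), back-projections stay in the span of h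
    and h', and the joint condition at the last layer factors out a scalar that
    depends only on the angle of m and m' (cross_close). Up to scaling, the
    gradient in h is therefore close to the mean gradient
        |m|^2 h - |m| |m0| kappa2 (xi h0 + zeta (|h0| / |h|) h),
    where kappa2 is the cosine of m and m0 after all the layers, and likewise
    for m. Cosines are the right coordinate: relu_corr is monotone and
    nonexpansive in the cosine, so the errors of the layers merely add up. Only
    xi and zeta depend on the angles themselves, hence on epsilon^(1/2).

    Networks are piecewise linear and f need not be differentiable at u. Along
    u + delta w + t g, for delta and then t small, the patterns are constant and
    both networks are affine (network_germ). This gives the one-sided
    derivatives, the convergence of the gradients along u + delta w, and bounds
    on both as limits of the bounds at nearby points. Where f is differentiable
    the directional bounds combine, by linearity in the direction, into a bound
    on the gradient with no loss in the dimension (grad_close). If the mean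
    gradient exceeds three times the error then -g1 or -g2 is a descent
    direction (descent_h).

    It remains to see where both mean gradients are small. Put r = |h| |m| and
    r0 = |h0| |m0|. The component of the mean gradient along h says that r is
    about r0 kappa1 kappa2, and the component orthogonal to h that xi sin(theta)
    is small, theta being the angle of h and h0. As angles decay like 1 / i
    along the layers, xi is at least (1 - theta / pi) / d^3, so theta is near 0,
    or near pi up to a square root (direction_dichotomy). In the first case
    kappa1 is about 1. In the second it is about rho, because rho is precisely
    the cosine that d layers make of -1 (rho_corr); this identity also gives the
    positivity of rho and its limit. The four combinations for h and m are the
    four neighborhoods (critical_in_nbhds). If a target vanishes, the mean
    gradient is |m|^2 h, which is never small.

    A neighborhood of relative radius above 1 is the whole space
    (hyper_nbhd_full). So outside the largest of the four, epsilon^(1/4) is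
    below a tiny multiple of alpha / (d s)^8, which leaves powers of the depths
    to spare in every estimate (slack_constants).

    On the axes G1(h) G2(m) = 0, and the one-sided derivatives are minus inner
    products of vectors with nonnegative entries (axis_derivative_le0). *)

Set Implicit Arguments.
Unset Strict Implicit.
Unset Printing Implicit Defensive.

(** * Sines, cosines and angles *)

Section AngleCalculus.
Context {R : realType}.
Implicit Types x y k : R.

Lemma nondecreasing_of_deriv (f df : R -> R) (a b : R) :
    (forall x, is_derive x 1 f (df x)) ->
    (forall x, a < x < b -> 0 <= df x) ->
  forall x y, a <= x -> x <= y -> y <= b -> f x <= f y.
Proof.
move=> fdf df0 x y ax xy yb.
have dF z : derivable f z 1 by have [] := fdf z.
apply: (@ger0_derive1_le_cc R f a b) => //.
- move=> z; rewrite in_itv /= => /df0; rewrite derive1E.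
  by have [_ ->] := fdf z.
- apply: continuous_subspaceT => z.
  exact/differentiable_continuous/derivable1_diffP.
- by rewrite in_itv /= ax (le_trans xy).
- by rewrite in_itv /= yb (le_trans ax).
Qed.

Definition sin_sub x : R := sin x - x * cos x.

Lemma is_derive_sin_sub x : is_derive x 1 sin_sub (x * sin x).
Proof.
have -> : sin_sub = (@sin R) - id * (@cos R).
  by apply/funext => y; rewrite /sin_sub.
apply: is_derive_eq; rewrite /GRing.scale /=; ring.
Qed.

Lemma sin_sub_le x y : 0 <= x -> x <= y -> y <= pi -> sin_sub x <= sin_sub y.
Proof.
apply: (nondecreasing_of_deriv is_derive_sin_sub) => z /andP[z0 zpi].
by apply: mulr_ge0; [exact: ltW | apply: sin_ge0_pi; rewrite !ltW].
Qed.

Lemma sin_sub0 : sin_sub 0 = 0.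
Proof. by rewrite /sin_sub sin0 mul0r subrr. Qed.

Lemma sin_sub_ge0 x : 0 <= x -> x <= pi -> 0 <= sin_sub x.
Proof. by move=> x0 xp; rewrite -sin_sub0; apply: sin_sub_le. Qed.

Lemma pihalf_lepi : pi / 2 <= pi :> R.
Proof. by have := @pi_ge0 R; lra. Qed.

(** The difference of the two sides has derivative x / 3 times sin x - x cos x,
    which is nonnegative. The bound is cubic in x, and this is what makes
    angles decay like 1 / i along the layers. *)
Lemma sin_sub_cubic x : 0 <= x -> x <= pi / 2 ->
  x ^+ 2 * sin x / 3 <= sin_sub x.
Proof.
move=> x0 xp.
pose f y := sin_sub y - y ^+ 2 * sin y / 3.
suff : f 0 <= f x by rewrite /f sin_sub0 sin0; lra.
apply: (@nondecreasing_of_deriv f (fun y => y / 3 * sin_sub y) 0 (pi / 2)) => //.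
  move=> y; have -> : f = sin_sub - (id ^+ 2 * (@sin R)) * cst (3^-1).
    by apply/funext.
  have := is_derive_sin_sub y => ?.
  apply: is_derive_eq; rewrite /GRing.scale /= /sin_sub /cst /=.
  have -> : (id ^+ 2) y = y ^+ 2 by [].
  by rewrite mulr0; field.
move=> y /andP[y0 yp]; apply: mulr_ge0; first lra.
by apply: sin_sub_ge0; [exact: ltW | rewrite (le_trans (ltW yp)) ?pihalf_lepi].
Qed.

Lemma sin_le_id x : 0 <= x -> sin x <= x.
Proof.
move=> x0; pose f y := y - sin y.
suff : f 0 <= f x by rewrite /f sin0; lra.
apply: (@nondecreasing_of_deriv f (fun y => 1 - cos y) 0 x) => // y _.
Qed.

Lemma sin_ge_half x : 0 <= x -> x <= pi / 2 -> x / 2 <= sin x.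
Proof.
move=> x0 xp.
have h0 : 0 <= sin_sub (x / 2).
  by apply: sin_sub_ge0; [lra | have := @pi_ge0 R; lra].
have c0 : 0 <= cos (x / 2).
  by apply: cos_ge0_pihalf; have := @pi_ge0 R; lra.
have cx : 0 <= cos x.
  by apply: cos_ge0_pihalf; have := @pi_ge0 R; lra.
have xE : x = x / 2 + x / 2 by lra.
have sE : sin x = 2 * (sin (x / 2) * cos (x / 2)).
  by rewrite {1}xE sinD; ring.
have cE : cos x = 2 * cos (x / 2) ^+ 2 - 1.
  rewrite {1}xE cosD -expr2.
  by have := cos2Dsin2 (x / 2); rewrite [sin (x / 2) * _]mulrC -expr2; lra.
rewrite sE; move: h0; rewrite /sin_sub => h0.
have : x / 2 * cos (x / 2) * cos (x / 2) <= sin (x / 2) * cos (x / 2).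
  by apply: ler_wpM2r => //; lra.
have : x * (2 * cos (x / 2) ^+ 2 - 1) >= 0 by apply: mulr_ge0 => //; rewrite -cE.
by rewrite expr2; nra.
Qed.

Lemma sin_le_homo x y : 0 <= x -> x <= y -> y <= pi / 2 -> sin x <= sin y.
Proof.
apply: (@nondecreasing_of_deriv sin cos 0 (pi / 2)) => z.
by move=> /andP[? ?]; apply: cos_ge0_pihalf; have := @pi_ge0 R; lra.
Qed.

Lemma cos_le_homo x y : 0 <= x -> x <= y -> y <= pi -> cos y <= cos x.
Proof.
move=> x0 xy yp.
pose f z := - cos z : R.
suff : f x <= f y by rewrite lerN2.
apply: (@nondecreasing_of_deriv f sin 0 pi) => //.
  by move=> z; apply: is_derive_eq; rewrite opprK.
by move=> z /andP[? ?]; apply: sin_ge0_pi; rewrite !ltW.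
Qed.

Lemma cos_subE x y :
  cos x - cos y = 2 * sin ((x + y) / 2) * sin ((y - x) / 2).
Proof.
set a := (x + y) / 2; set b := (y - x) / 2.
have -> : x = a - b by rewrite /a /b; lra.
have -> : y = a + b by rewrite /a /b; lra.
by rewrite cosB cosD; ring.
Qed.

(** With b half the gap and c the midpoint, b <= c <= pi - b, so sin c >= sin b
    in cos x - cos y = 2 sin c sin b: the cosine separates two angles at least
    quadratically, uniformly up to the ends of [0, pi]. *)
Lemma cos_sub_ge x y : 0 <= x -> x <= y -> y <= pi ->
  (y - x) ^+ 2 <= 8 * (cos x - cos y).
Proof.
move=> x0 xy yp; have pi0 := @pi_ge0 R.
have hb : (y - x) / 2 / 2 <= sin ((y - x) / 2) by apply: sin_ge_half; lra.
have hab : sin ((y - x) / 2) <= sin ((x + y) / 2).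
  have [c|c] := leP ((x + y) / 2) (pi / 2); first by apply: sin_le_homo; lra.
  have -> : sin ((x + y) / 2) = sin (pi - (x + y) / 2).
    by rewrite sinB sinpi cospi; ring.
  by apply: sin_le_homo; lra.
rewrite cos_subE.
have b0 : 0 <= (y - x) / 2 / 2 by lra.
nra.
Qed.

Definition corr_range k : Prop := -1 <= k <= 1.

Lemma acos_dist_sqr k1 k2 : corr_range k1 -> corr_range k2 ->
  (acos k1 - acos k2) ^+ 2 <= 8 * `|k1 - k2|.
Proof.
move=> h1 h2.
have [/andP[p1 q1] e1] := acos_def h1; have [/andP[p2 q2] e2] := acos_def h2.
rewrite -[in X in _ <= X]e1 -[in X in _ <= X]e2.
have [le|/ltW le] := leP (acos k1) (acos k2).
  by rewrite ger0_norm ?subr_ge0 ?cos_le_homo // -sqrrN opprB cos_sub_ge.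
by rewrite ler0_norm ?subr_le0 ?cos_le_homo // opprB cos_sub_ge.
Qed.

Lemma acos_le k1 k2 : corr_range k1 -> corr_range k2 -> k1 <= k2 ->
  acos k2 <= acos k1.
Proof.
move=> h1 h2 h; case: (leP (acos k2) (acos k1)) => // lt.
have [/andP[p1 q1] e1] := acos_def h1; have [/andP[p2 q2] e2] := acos_def h2.
have := cos_sub_ge p1 (ltW lt) q2; rewrite e1 e2.
have : 0 < (acos k2 - acos k1) ^+ 2 by rewrite exprn_even_gt0 //= subr_eq0 gt_eqF.
by move: h; lra.
Qed.

Lemma pi_neq0 : pi != 0 :> R.
Proof. by rewrite gt_eqF ?pi_gt0. Qed.

Lemma pi_le4 : pi <= 4 :> R.
Proof. by have := @pihalf_lt2 R; lra. Qed.

End AngleCalculus.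

(** * Correlations of two signals along the layers *)

Section ReluCorrelation.
Context {R : realType}.
Implicit Types x y k : R.

(** The coefficients of y and of (|y| / |x|) x in 2 Q_{x,y} y, when x and y have
    cosine k. *)
Definition pass_coef k : R := (pi - acos k) / pi.
Definition mix_coef k : R := Num.sqrt (1 - k ^+ 2) / pi.
(** The cosine of the images of two vectors of cosine k under a layer whose
    Gram matrices are exactly those of the weight distribution condition. *)
Definition relu_corr k : R := pass_coef k * k + mix_coef k.
Definition corr k (i : nat) : R := iter i relu_corr k.

(** The analogues of pass_coef and mix_coef for i layers in a row. *)
Fixpoint xi k (i : nat) : R :=
  if i is i'.+1 then pass_coef (corr k i') * xi k i' else 1.
Fixpoint zeta k (i : nat) : R :=
  if i is i'.+1 then pass_coef (corr k i') * zeta k i' + mix_coef (corr k i')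
  else 0.

Lemma pass_coef_ge0 k : corr_range k -> 0 <= pass_coef k.
Proof.
by move=> h; apply: divr_ge0; rewrite ?pi_ge0 // subr_ge0 acos_lepi.
Qed.

Lemma pass_coef_le1 k : corr_range k -> pass_coef k <= 1.
Proof.
move=> h; rewrite ler_pdivrMr ?pi_gt0 // mul1r gerBl; exact: acos_ge0.
Qed.

Lemma mix_coef_ge0 k : 0 <= mix_coef k.
Proof. by apply: divr_ge0; rewrite ?pi_ge0 // sqrtr_ge0. Qed.

Lemma mix_coef_le k : mix_coef k <= 2^-1.
Proof.
rewrite ler_pdivrMr ?pi_gt0 //; have h := @pi_ge2 R.
apply: (@le_trans _ _ 1); last lra.
rewrite -[X in _ <= X]sqrtr1 ler_sqrt ?ler01 //.
by have := sqr_ge0 k; lra.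
Qed.

Lemma relu_corrE k : corr_range k -> relu_corr k = k + sin_sub (acos k) / pi.
Proof.
move=> h; rewrite /relu_corr /pass_coef /mix_coef /sin_sub sin_acos //.
have [_ ->] := acos_def h.
by have := @pi_neq0 R; move: (@pi R) => q q0; field.
Qed.

Lemma relu_corrE' k : corr_range k -> relu_corr k = sin_sub (pi - acos k) / pi.
Proof.
move=> h; rewrite relu_corrE // /sin_sub.
rewrite sinB cosB cospi sinpi; have [_ ->] := acos_def h.
by have := @pi_neq0 R; move: (@pi R) => q q0; field.
Qed.

Lemma relu_corr_ge k : corr_range k -> k <= relu_corr k.
Proof.
move=> h; rewrite relu_corrE // lerDl; apply: divr_ge0; last exact: pi_ge0.
by apply: sin_sub_ge0; [exact: acos_ge0 | exact: acos_lepi].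
Qed.

Lemma relu_corr_ge0 k : corr_range k -> 0 <= relu_corr k.
Proof.
move=> h; rewrite relu_corrE' //; apply: divr_ge0; last exact: pi_ge0.
apply: sin_sub_ge0; first by rewrite subr_ge0 acos_lepi.
by rewrite gerBl acos_ge0.
Qed.

Lemma corr_range1 : corr_range (1 : R). Proof. by rewrite /corr_range; lra. Qed.
Lemma corr_rangeN1 : corr_range (-1 : R). Proof. by rewrite /corr_range; lra. Qed.

Lemma relu_corr1 : relu_corr 1 = 1.
Proof. by rewrite (relu_corrE corr_range1) acos1 sin_sub0 mul0r addr0. Qed.

Lemma relu_corrN1 : relu_corr (-1) = 0.
Proof. by rewrite (relu_corrE' corr_rangeN1) acosN1 subrr sin_sub0 mul0r. Qed.

(** As a function of the angle t, relu_corr and its excess over the identity are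
    sin x - x cos x at x = pi - t and at x = t, up to the factor pi, and that
    function is increasing. Nonexpansiveness in the cosine, rather than in the
    angle, is what lets the errors of successive layers simply add up. *)
Lemma relu_corr_mono k1 k2 : corr_range k1 -> corr_range k2 -> k1 <= k2 ->
  0 <= relu_corr k2 - relu_corr k1 <= k2 - k1.
Proof.
move=> h1 h2 le; have la := acos_le h1 h2 le.
have [/andP[p1 q1] _] := acos_def h1; have [/andP[p2 q2] _] := acos_def h2.
apply/andP; split.
  rewrite subr_ge0 !relu_corrE' // ler_pM2r ?invr_gt0 ?pi_gt0 //.
  by apply: sin_sub_le; lra.
rewrite !relu_corrE //.
have : sin_sub (acos k2) / pi <= sin_sub (acos k1) / pi.
  by rewrite ler_pM2r ?invr_gt0 ?pi_gt0 //; apply: sin_sub_le; lra.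
by lra.
Qed.

Lemma relu_corr_lip k1 k2 : corr_range k1 -> corr_range k2 ->
  `|relu_corr k1 - relu_corr k2| <= `|k1 - k2|.
Proof.
move=> h1 h2; have [le|/ltW le] := leP k1 k2.
  have /andP[a b] := relu_corr_mono h1 h2 le.
  by rewrite distrC [X in _ <= X]distrC !ger0_norm //; lra.
have /andP[a b] := relu_corr_mono h2 h1 le.
by rewrite !ger0_norm //; lra.
Qed.

Lemma relu_corr_range k : corr_range k -> corr_range (relu_corr k).
Proof.
move=> h; rewrite /corr_range; have := relu_corr_ge0 h.
have /andP[_ k1] := h.
have /andP[a _] := relu_corr_mono h corr_range1 k1.
by move: a; rewrite relu_corr1; lra.
Qed.

Lemma corr_in k i : corr_range k -> corr_range (corr k i).
Proof. by move=> h; elim: i => //= i; exact: relu_corr_range. Qed.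

Lemma corrS k i : corr k i.+1 = relu_corr (corr k i). Proof. by []. Qed.

Lemma corr_lip k1 k2 i : corr_range k1 -> corr_range k2 ->
  `|corr k1 i - corr k2 i| <= `|k1 - k2|.
Proof.
move=> h1 h2; elim: i => //= i; apply: le_trans.
by apply: relu_corr_lip; exact: corr_in.
Qed.

Lemma corr1 i : corr 1 i = 1.
Proof. by elim: i => //= i ->; exact: relu_corr1. Qed.

Lemma corrS_ge0 k i : corr_range k -> 0 <= corr k i.+1.
Proof. by move=> h; apply/relu_corr_ge0/corr_in. Qed.

(** One layer makes the correlation nonnegative, and the next one sends 0 to
    1 / pi. Hence a second layer keeps every correlation away from 0, and with
    it the scalar factors that the networks exchange. *)
Lemma corr_ge k i : corr_range k -> (2 <= i)%N -> 4^-1 <= corr k i.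
Proof.
move=> h; elim: i => // -[//|[_ _|i IH _]]; last first.
  by apply: le_trans (IH _) _ => //; apply/relu_corr_ge/corr_in.
rewrite corrS; have r0 : corr_range (0 : R) by rewrite /corr_range; lra.
have /andP[a _] := relu_corr_mono r0 (corr_in 1 h) (corrS_ge0 0 h).
apply: le_trans (_ : relu_corr 0 <= _); last by rewrite -subr_ge0.
rewrite /relu_corr mulr0 add0r /mix_coef expr0n subr0 sqrtr1 div1r.
by rewrite lef_pV2 ?posrE ?pi_gt0 ?pi_le4.
Qed.

Lemma corr_decomp k i : corr k i = xi k i * k + zeta k i.
Proof.
elim: i => [|i IH]; first by rewrite /= mul1r addr0.
by rewrite corrS /relu_corr {2}IH /=; ring.
Qed.

Lemma xi_ge0 k i : corr_range k -> 0 <= xi k i.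
Proof.
move=> h; elim: i => //= i IH; apply: mulr_ge0 => //.
by apply/pass_coef_ge0/corr_in.
Qed.

Lemma xi_le1 k i : corr_range k -> xi k i <= 1.
Proof.
move=> h; elim: i => //= i IH; rewrite -[X in _ <= X]mul1r.
have r := corr_in i h.
by apply: ler_pM; rewrite ?xi_ge0 ?pass_coef_ge0 ?pass_coef_le1.
Qed.

Lemma zeta_ge0 k i : corr_range k -> 0 <= zeta k i.
Proof.
move=> h; elim: i => //= i IH; apply: addr_ge0; last exact: mix_coef_ge0.
by apply: mulr_ge0 => //; apply/pass_coef_ge0/corr_in.
Qed.

Lemma zeta_le2 k i : corr_range k -> zeta k i <= 2.
Proof.
move=> h; have := corr_decomp k i; have /andP[_ c] := corr_in i h.
have x0 := xi_ge0 i h; have x1 := xi_le1 i h; have /andP[k1 k2] := h.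
by nra.
Qed.

Lemma pass_coef1 : pass_coef 1 = 1.
Proof. by rewrite /pass_coef acos1 subr0 divff // gt_eqF ?pi_gt0. Qed.

Lemma mix_coef1 : mix_coef 1 = 0.
Proof. by rewrite /mix_coef expr1n subrr sqrtr0 mul0r. Qed.

Lemma xi1 i : xi 1 i = 1.
Proof. by elim: i => //= i ->; rewrite corr1 pass_coef1 mulr1. Qed.

Lemma zeta1 i : zeta 1 i = 0.
Proof. by elim: i => //= i ->; rewrite corr1 mix_coef1 mulr0 addr0. Qed.

(** The hypothesis is quadratic in b because, at cosines 1 and -1, the angle is
    only Hoelder of exponent 1 / 2 in the cosine. *)
Lemma pass_coef_dist k1 k2 (b : R) : corr_range k1 -> corr_range k2 ->
  0 <= b -> 8 * `|k1 - k2| <= (2 * b) ^+ 2 -> `|pass_coef k1 - pass_coef k2| <= b.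
Proof.
move=> h1 h2 b0 hb; rewrite /pass_coef -mulrBl.
have -> : pi - acos k1 - (pi - acos k2) = - (acos k1 - acos k2) by ring.
rewrite normrM normrN normfV (ger0_norm (pi_ge0 R)) ler_pdivrMr ?pi_gt0 //.
have : `|acos k1 - acos k2| <= 2 * b.
  rewrite -(@ler_pXn2r _ 2) ?nnegrE ?normr_ge0 ?mulr_ge0 //.
  rewrite real_normK ?num_real //; exact: le_trans (acos_dist_sqr h1 h2) hb.
by move=> /le_trans; apply; rewrite mulrC ler_wpM2l ?pi_ge2.
Qed.

Lemma sqrtr_dist x y : 0 <= x -> 0 <= y ->
  (Num.sqrt x - Num.sqrt y) ^+ 2 <= `|x - y|.
Proof.
move=> x0 y0.
have := sqr_sqrtr x0; have := sqr_sqrtr y0.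
have := sqrtr_ge0 x; have := sqrtr_ge0 y.
move: (Num.sqrt x) (Num.sqrt y) => a b b0 a0 <- <-.
have [le|/ltW le] := leP b a.
  by rewrite ger0_norm; nra.
by rewrite ler0_norm; nra.
Qed.

Lemma mix_coef_dist k1 k2 (b : R) : corr_range k1 -> corr_range k2 ->
  0 <= b -> 2 * `|k1 - k2| <= (2 * b) ^+ 2 -> `|mix_coef k1 - mix_coef k2| <= b.
Proof.
move=> h1 h2 b0 hb; rewrite /mix_coef -mulrBl.
rewrite normrM normfV (ger0_norm (pi_ge0 R)) ler_pdivrMr ?pi_gt0 //.
suff : `|Num.sqrt (1 - k1 ^+ 2) - Num.sqrt (1 - k2 ^+ 2)| <= 2 * b.
  by move=> /le_trans; apply; rewrite mulrC ler_wpM2l ?pi_ge2.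
rewrite -(@ler_pXn2r _ 2) ?nnegrE ?normr_ge0 ?mulr_ge0 //.
move: h1 h2; rewrite /corr_range => h1 h2.
rewrite real_normK ?num_real //; apply: le_trans hb.
apply: le_trans (sqrtr_dist _ _) _; try nra.
have -> : 1 - k1 ^+ 2 - (1 - k2 ^+ 2) = - ((k1 + k2) * (k1 - k2)) by ring.
by rewrite normrN normrM ler_wpM2r // ler_norml; lra.
Qed.

End ReluCorrelation.

(** * Decay of the angles with depth *)

Section AngleDecay.
Context {R : realType}.
Implicit Types x y k : R.

(** In other words, one layer increases the reciprocal of the angle by at least
    1 / (3 pi), so that the bound iterates. With x the angle and y the bound,
    cos y - cos x <= (x - y) sin x, and the cubic bound on sin x - x cos x
    absorbs the right-hand side. *)
Lemma acos_relu_corr_le k : 0 <= k <= 1 ->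
  acos (relu_corr k) <= 3 * pi * acos k / (3 * pi + acos k).
Proof.
move=> /andP[k0 k1]; have pp := @pi_gt0 R.
have h : corr_range k by rewrite /corr_range; lra.
have [/andP[x0 _] xE] := acos_def h; set x := acos k in x0 xE *.
have xh : x <= pi / 2.
  by rewrite -acos0; apply: acos_le => //; rewrite /corr_range; lra.
pose y := 3 * pi * x / (3 * pi + x).
have y0 : 0 <= y by apply: divr_ge0; rewrite ?mulr_ge0 //; lra.
have yE : (x - y) * (3 * pi + x) = x ^+ 2.
  rewrite /y; have : 3 * pi + x != 0 by rewrite gt_eqF //; lra.
  by move: (@pi R) => q q0; field.
have yx : 0 <= x - y by have := sqr_ge0 x; nra.
have yd : (x - y) * pi <= x ^+ 2 / 3 by nra.
have s0 : 0 <= sin x by apply: sin_ge0_pi; lra.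
have cy : cos y <= relu_corr k.
  rewrite relu_corrE // -/x -xE -lerBlDl cos_subE.
  have h1 : sin ((y + x) / 2) <= sin x by apply: sin_le_homo; lra.
  have h2 : sin ((x - y) / 2) <= (x - y) / 2 by apply: sin_le_id; lra.
  have h3 : 0 <= sin ((x - y) / 2) by apply: sin_ge0_pi; lra.
  have h4 : 0 <= sin ((y + x) / 2) by apply: sin_ge0_pi; lra.
  have h5 := sin_sub_cubic x0 xh.
  rewrite ler_pdivlMr //.
  have h6 : sin ((y + x) / 2) * sin ((x - y) / 2) <= sin x * ((x - y) / 2).
    exact: ler_pM.
  have h7 : (x - y) * pi * sin x <= x ^+ 2 / 3 * sin x by apply: ler_wpM2r.
  by nra.
have yp : y <= pi by lra.
rewrite -/y -[X in _ <= X]cosK ?in_itv /= ?y0 ?yp //.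
apply: acos_le => //; first by rewrite /corr_range cos_geN1 cos_le1.
exact: relu_corr_range.
Qed.

Lemma acos_corr_le k i : corr_range k ->
  acos (corr k i.+1) <= 3 * pi / i.+4%:R.
Proof.
move=> h; have pp := @pi_gt0 R.
elim: i => [|i IH].
  have : acos (corr k 1) <= pi / 2.
    rewrite -acos0; apply: acos_le; rewrite ?corrS_ge0 //.
      by rewrite /corr_range; lra.
    exact: corr_in.
  by lra.
have r := corr_in i.+1 h; have r0 := corrS_ge0 i h; have /andP[_ r1] := r.
have a0 := acos_ge0 r.
rewrite corrS; apply: le_trans (acos_relu_corr_le _) _; first by rewrite r0.
move: IH; set t := acos _ in a0 *.
have -> : i.+4.+1%:R = i.+4%:R + 1 :> R by rewrite -natr1.
have : 0 < i.+4%:R :> R by [].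
move: (i.+4%:R : R) => q q0; rewrite ler_pdivlMr // => IH.
rewrite ler_pdivlMr ?ler_pdivrMr; try lra.
rewrite mulrAC ler_pdivrMr; last lra.
by nra.
Qed.

Lemma pass_coef_corr_ge k i : corr_range k ->
  i.+1%:R / i.+4%:R <= pass_coef (corr k i.+1).
Proof.
move=> h; have pp := @pi_gt0 R; have := acos_corr_le i h.
rewrite /pass_coef => le.
rewrite ler_pdivlMr //.
have -> : i.+1%:R / i.+4%:R * pi = pi - 3 * pi / i.+4%:R :> R.
  have : i.+4%:R = i.+1%:R + 3 :> R by rewrite -natrD addn3.
  have : i.+1%:R + 3 != 0 :> R by rewrite gt_eqF.
  move: (i.+1%:R : R) => q q3 ->; move: (@pi R) => w; field; exact: q3.
by rewrite lerD2l lerN2.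
Qed.

(** By the decay of the angles, the factors of xi after the first are at least
    i / (i + 3), whose product is 6 / (d (d + 1) (d + 2)) >= 1 / d ^ 3. *)
Lemma xi_ge k d : corr_range k -> (0 < d)%N ->
  pass_coef k <= xi k d * d%:R ^+ 3.
Proof.
move=> h; case: d => // d _.
suff H : pass_coef k * 6 <= xi k d.+1 * (d.+1%:R * d.+2%:R * d.+3%:R).
  have p0 := pass_coef_ge0 h; have x0 := xi_ge0 d.+1 h; move: H x0.
  have -> : d.+3%:R = d.+1%:R + 2 :> R by rewrite -natrD addn2.
  have -> : d.+2%:R = d.+1%:R + 1 :> R by rewrite natr1.
  have : 1 <= d.+1%:R :> R by rewrite ler1n.
  move: (d.+1%:R : R) (xi k d.+1) => q z q1 H z0.
  have q3 : q * (q + 1) * (q + 2) <= 6 * q ^+ 3.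
    have -> : 6 * q ^+ 3 = q * (6 * q ^+ 2) by ring.
    by rewrite -mulrA; apply: ler_wpM2l; nra.
  have : z * (q * (q + 1) * (q + 2)) <= z * (6 * q ^+ 3) by apply: ler_wpM2l.
  by lra.
elim: d => [|d IH]; first by rewrite /= mulr1; lra.
apply: le_trans IH _.
have -> : xi k d.+2 = pass_coef (corr k d.+1) * xi k d.+1 by [].
have c := pass_coef_corr_ge d h; have x0 := xi_ge0 d.+1 h.
have q4 : 0 < d.+4%:R :> R by [].
move: c; rewrite ler_pdivrMr //; move=> c.
have -> : pass_coef (corr k d.+1) * xi k d.+1 * (d.+2%:R * d.+3%:R * d.+4%:R)
  = xi k d.+1 * (d.+2%:R * d.+3%:R) * (pass_coef (corr k d.+1) * d.+4%:R).
  by ring.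
have -> : xi k d.+1 * (d.+1%:R * d.+2%:R * d.+3%:R) =
  xi k d.+1 * (d.+2%:R * d.+3%:R) * d.+1%:R by ring.
have x2 : 0 <= xi k d.+1 * (d.+2%:R * d.+3%:R) by apply: mulr_ge0 => //; apply: mulr_ge0.
exact: ler_wpM2l c.
Qed.

Lemma theta_checkE i : theta_check i = acos (corr (-1 : R) i).
Proof.
elim: i => [|i IH]; first by rewrite /theta_check /= acosN1.
rewrite /theta_check iterS -/(theta_check i) IH /gtheta corrS /relu_corr.
have r := corr_in i (@corr_rangeN1 R); rewrite sin_acos //.
have [_ ->] := acos_def r; congr acos; rewrite /pass_coef /mix_coef.
by have := @pi_neq0 R; move: (@pi R) => q q0; field.
Qed.

(** For opposite vectors the coefficient xi vanishes from the first layer on, so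
    their correlation is all zeta, and zeta is the sum that defines rho. The
    positivity of rho and its limit are thus statements about correlations. *)
Lemma rho_corr a : rho a.+1 = corr (-1 : R) a.+1.
Proof.
elim: a => [|a IH]; first by rewrite /rho big_geq //= relu_corrN1.
have r := corr_in a.+1 (@corr_rangeN1 R).
rewrite corrS /relu_corr -[in X in _ = _ * X + _]IH.
rewrite /rho big_nat_recr // [\prod_(a.+2 <= _ < a.+2) _]big_geq // mulr1.
rewrite (theta_checkE a.+1) (sin_acos r); congr (_ + _).
rewrite mulr_sumr; apply: eq_big_nat => i /andP[_ ia].
rewrite (@big_nat_recr _ _ _ a.+1) // (theta_checkE a.+1).
by apply: etrans (mulrA _ _ _) _; exact: mulrC.
Qed.

Lemma rho_gt0 a : (2 <= a)%N -> 0 < rho a :> R.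
Proof.
case: a => // a a2; rewrite rho_corr.
by apply: lt_le_trans (corr_ge (@corr_rangeN1 R) a2).
Qed.

Lemma rho_cvg : (rho a : R) @[a --> \oo] --> (1 : R).
Proof.
rewrite -(cvg_shiftS (fun a => rho a : R)) /=.
apply: (@squeeze_cvgr _ _ _ _ (fun n => 1 - 12 * harmonic n) (fun=> 1)).
- near=> n; rewrite rho_corr; have r := corr_in n.+1 (@corr_rangeN1 R).
  have /andP[_ r1] := r; rewrite r1 andbT.
  have [/andP[t0 tp] tE] := acos_def r.
  have tn := acos_corr_le n (@corr_rangeN1 R).
  move: (acos (corr (-1) n.+1)) t0 tp tE tn => t t0 tp tE tn; rewrite -tE.
  have := cos_subE 0 t; rewrite cos0 add0r subr0.
  have s2 := @sin_le1 R (t / 2).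
  have s0 : 0 <= sin (t / 2) by apply: sin_ge0_pi; lra.
  have s1 : sin (t / 2) <= t / 2 by apply: sin_le_id; lra.
  move=> cE.
  have ct : 1 - cos t <= t by nra.
  have : 3 * pi / n.+4%:R <= 12 * harmonic n :> R.
    rewrite /harmonic ler_pdivrMr //.
    have : 1 <= n.+1%:R^-1 * n.+4%:R :> R.
      by rewrite mulrC ler_pdivlMr // mul1r ler_nat ltnS -[n.+3]addn3 leq_addr.
    rewrite -mulrA; move: (n.+1%:R^-1 * n.+4%:R : R) => q q1.
    by have := @pi_le4 R; have := @pi_ge0 R; lra.
  by move=> h; have := le_trans tn h; lra.
- rewrite -[X in _ --> X]subr0 -(mulr0 12); apply: cvgB; first exact: cvg_cst.
  by apply: cvgM; [exact: cvg_cst | exact: cvg_harmonic].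
- exact: cvg_cst.
Unshelve. all: by end_near. Qed.

End AngleDecay.

(** * Euclidean norms and the spectral norm *)

Section EuclideanNorm.
Context {R : realType}.

Section Norm.
Context {k : nat}.
Implicit Types (x y z : 'cV[R]_k) (a : R).

Lemma norm2_ge0 x : 0 <= norm2 x. Proof. exact: sqrtr_ge0. Qed.

Lemma norm2_0 : norm2 (0 : 'cV[R]_k) = 0.
Proof.
by rewrite /norm2 big1 ?sqrtr0 // => i _; rewrite mxE expr0n.
Qed.

Lemma norm2_eq0 x : (norm2 x == 0) = (x == 0).
Proof.
apply/idP/eqP => [|->]; last by rewrite norm2_0.
by apply: contraTeq; exact: norm2_neq0.
Qed.

Lemma norm2_gt0 x : x != 0 -> 0 < norm2 x.
Proof. by move=> x0; rewrite lt_neqAle eq_sym norm2_neq0 ?norm2_ge0. Qed.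

Lemma norm2Z a x : norm2 (a *: x) = `|a| * norm2 x.
Proof.
apply/eqP; rewrite -(@eqrXn2 _ 2) ?mulr_ge0 ?norm2_ge0 //.
by rewrite exprMn real_normK ?num_real // !norm2_sqr dotvZl dotvZr mulrA expr2.
Qed.

Lemma norm2Z_ge0 a x : 0 <= a -> norm2 (a *: x) = a * norm2 x.
Proof. by move=> a0; rewrite norm2Z ger0_norm. Qed.

Lemma norm2N x : norm2 (- x) = norm2 x.
Proof. by rewrite -scaleN1r norm2Z normrN1 mul1r. Qed.

Lemma norm2B x y : norm2 (x - y) = norm2 (y - x).
Proof. by rewrite -norm2N opprB. Qed.

Lemma dotv0l x : dotv 0 x = 0.
Proof. by rewrite -(scale0r 0) dotvZl mul0r. Qed.

Lemma dotv0r x : dotv x 0 = 0.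
Proof. by rewrite dotvC dotv0l. Qed.

Lemma dotvNl x y : dotv (- x) y = - dotv x y.
Proof. by rewrite -scaleN1r dotvZl mulN1r. Qed.

Lemma dotvNr x y : dotv x (- y) = - dotv x y.
Proof. by rewrite dotvC dotvNl dotvC. Qed.

Lemma dotvBl x y z : dotv (x - y) z = dotv x z - dotv y z.
Proof. by rewrite dotvDl dotvNl. Qed.

Lemma dotvBr x y z : dotv x (y - z) = dotv x y - dotv x z.
Proof. by rewrite dotvDr dotvNr. Qed.

Lemma dotv_le x y : `|dotv x y| <= norm2 x * norm2 y.
Proof.
rewrite -(@ler_pXn2r _ 2) ?nnegrE ?normr_ge0 ?mulr_ge0 ?norm2_ge0 //.
rewrite real_normK ?num_real // exprMn !norm2_sqr.
have [->|y0] := eqVneq y 0; first by rewrite !dotv0r mulr0 expr0n.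
have Y0 : 0 < dotv y y by rewrite -norm2_sqr exprn_gt0 // norm2_gt0.
have := dotv_ge0 (dotv y y *: x - dotv x y *: y).
rewrite !(dotvBl, dotvBr, dotvZl, dotvZr) [dotv y x]dotvC.
move: (dotv x x) (dotv y y) (dotv x y) Y0 => X Y c Y0 H.
have : 0 <= Y * (X * Y - c ^+ 2) by move: H; congr (0 <= _); ring.
by rewrite pmulr_rge0 // subr_ge0.
Qed.

Lemma ler_norm2D x y : norm2 (x + y) <= norm2 x + norm2 y.
Proof.
rewrite -(@ler_pXn2r _ 2) ?nnegrE ?addr_ge0 ?norm2_ge0 //.
rewrite norm2_sqr !(dotvDl, dotvDr) sqrrD -!norm2_sqr (dotvC y x).
have /ler_normlP[_] := dotv_le x y.
by rewrite mulr2n; lra.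
Qed.

Lemma ler_norm2_dist x y : norm2 x <= norm2 y + norm2 (x - y).
Proof. by have := ler_norm2D y (x - y); rewrite addrC subrK addrC. Qed.

Lemma norm2_le_sqr x a : 0 <= a -> norm2 x ^+ 2 <= a ^+ 2 -> norm2 x <= a.
Proof. by move=> a0; rewrite ler_pXn2r ?nnegrE ?norm2_ge0. Qed.

Lemma cosv_range x y : corr_range (dotv x y / (norm2 x * norm2 y)).
Proof.
rewrite /corr_range -ler_norml normrM normfV.
have p0 : 0 <= norm2 x * norm2 y by rewrite mulr_ge0 ?norm2_ge0.
rewrite (ger0_norm p0).
have [->|p] := eqVneq (norm2 x * norm2 y) 0; first by rewrite invr0 mulr0.
by rewrite ler_pdivrMr ?mul1r ?dotv_le // lt_neqAle eq_sym p.
Qed.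

End Norm.

Lemma dotv_mulmx (q k : nat) (A : 'M[R]_(q, k)) x y :
  dotv x (A *m y) = dotv (A^T *m x) y.
Proof.
rewrite /dotv; under eq_bigr do rewrite mxE mulr_sumr.
rewrite exchange_big /=; apply: eq_bigr => j _.
by rewrite mxE mulr_suml; apply: eq_bigr => i _; rewrite mxE mulrCA mulrA.
Qed.

Lemma mulmx_rowE (q k : nat) (A : 'M[R]_(q, k)) (x : 'cV[R]_k) i :
  (A *m x) i 0 = dotv (row i A)^T x.
Proof. by rewrite mxE; apply: eq_bigr => j _; rewrite !mxE. Qed.

Lemma norm2_mulmx_bound (q k : nat) (A : 'M[R]_(q, k)) :
  exists2 C : R, 0 <= C & forall x, norm2 (A *m x) <= C * norm2 x.
Proof.
exists (Num.sqrt (\sum_i norm2 (row i A)^T ^+ 2)) => [|x].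
  exact: sqrtr_ge0.
have S0 : 0 <= \sum_i norm2 (row i A)^T ^+ 2.
  by apply: sumr_ge0 => i _; exact: sqr_ge0.
apply: norm2_le_sqr; first by rewrite mulr_ge0 ?sqrtr_ge0 ?norm2_ge0.
rewrite exprMn (sqr_sqrtr S0) mulr_suml norm2_sqr.
apply: ler_sum => i _; rewrite -expr2 mulmx_rowE -exprMn.
by rewrite -[X in X <= _]real_normK ?num_real // ler_pXn2r ?nnegrE ?mulr_ge0
   ?norm2_ge0 ?dotv_le.
Qed.

Lemma spectral_norm_le (q k : nat) (A : 'M[R]_(q, k)) (e : R) :
  spectral_norm A <= e -> forall x, norm2 (A *m x) <= e * norm2 x.
Proof.
move=> Ae x; have [C C0 HC] := norm2_mulmx_bound A.
have [->|x0] := eqVneq x 0; first by rewrite mulmx0 !norm2_0 mulr0.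
have n0 := norm2_gt0 x0.
have : norm2 (A *m unitv x) <= e.
  apply: le_trans Ae; apply: sup_upper_bound.
    split; first by exists (norm2 (A *m 0)), 0 => //=; rewrite norm2_0.
    exists C => _ [z /= z1 <-]; apply: le_trans (HC z) _.
    by rewrite -[X in _ <= X]mulr1 ler_wpM2l.
  exists (unitv x) => //=; rewrite /unitv norm2Z_ge0 ?invr_ge0 ?norm2_ge0 //.
  by rewrite mulVf // gt_eqF.
rewrite /unitv -scalemxAr norm2Z_ge0 ?invr_ge0 ?norm2_ge0 //.
by rewrite mulrC ler_pdivrMr.
Qed.

Lemma norm2_trmx_le (q k : nat) (A : 'M[R]_(q, k)) (L : R) : 0 <= L ->
    (forall x, norm2 (A *m x) ^+ 2 <= L * norm2 x ^+ 2) ->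
  forall y, norm2 (A^T *m y) ^+ 2 <= L * norm2 y ^+ 2.
Proof.
move=> L0 H y; set z := A^T *m y.
have [->|z0] := eqVneq z 0; first by rewrite norm2_0 expr0n mulr_ge0 ?sqr_ge0.
have Z0 : 0 < norm2 z ^+ 2 by rewrite exprn_gt0 // norm2_gt0.
have h : norm2 z ^+ 2 <= norm2 y * norm2 (A *m z).
  rewrite norm2_sqr {1}/z -dotv_mulmx; exact: le_trans (ler_norm _) (dotv_le _ _).
have h2 : (norm2 z ^+ 2) ^+ 2 <= norm2 y ^+ 2 * (L * norm2 z ^+ 2).
  apply: (@le_trans _ _ ((norm2 y * norm2 (A *m z)) ^+ 2)).
    by rewrite ler_pXn2r ?nnegrE ?sqr_ge0 ?mulr_ge0 ?norm2_ge0.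
  by rewrite exprMn ler_wpM2l ?sqr_ge0.
rewrite -(ler_pM2r Z0) -expr2; apply: le_trans h2 _.
by rewrite mulrCA mulrA.
Qed.

End EuclideanNorm.

(** * Gram matrices of one layer *)

Section Gram.
Context {R : realType}.

Definition cosv {k : nat} (x y : 'cV[R]_k) : R :=
  dotv x y / (norm2 x * norm2 y).

Lemma dotv_cosv {k : nat} (x y : 'cV[R]_k) :
  dotv x y = norm2 x * norm2 y * cosv x y.
Proof.
rewrite /cosv; have [->|x0] := eqVneq x 0.
  by rewrite dotv0l norm2_0 mul0r mul0r.
have [->|y0] := eqVneq y 0; first by rewrite dotv0r norm2_0 mulr0 mul0r.
by have := norm2_neq0 x0; have := norm2_neq0 y0; move=> *; field; apply/andP.
Qed.

Lemma cosvv {k : nat} (x : 'cV[R]_k) : x != 0 -> cosv x x = 1.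
Proof.
by move=> x0; rewrite /cosv -norm2_sqr expr2 divff // mulf_neq0 // norm2_neq0.
Qed.

Lemma Qmx_mulmx {k : nat} (x y : 'cV[R]_k) : x != 0 -> y != 0 ->
  Qmx x y *m y = 2^-1 *: (pass_coef (cosv x y) *: y
                  + (mix_coef (cosv x y) * (norm2 y / norm2 x)) *: x).
Proof.
move=> x0 y0; have [_ My _] := swap_mxP x0 y0.
have yE : y = norm2 y *: unitv y.
  by rewrite scalerA mulfV ?scale1r ?norm2_neq0.
rewrite /Qmx mulmxDl mul_scalar_mx -scalemxAl [swap_mx x y *m _]
  (_ : _ = (norm2 y / norm2 x) *: x); last first.
  by rewrite {2}yE -scalemxAr My /unitv scalerA.
rewrite /angle -/(cosv x y) sin_acos; last exact: cosv_range.
rewrite scalerDr !scalerA /pass_coef /mix_coef.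
have := @pi_neq0 R; move: (@pi R) => q q0.
by congr (_ *: _ + _ *: _); field; rewrite ?norm2_neq0 ?q0.
Qed.

Lemma Qmx_diag {k : nat} (x : 'cV[R]_k) : x != 0 -> Qmx x x = (2^-1)%:M.
Proof.
move=> x0; rewrite /Qmx /angle -/(cosv x x) cosvv // acos1 sin0 mul0r scale0r.
rewrite addr0 subr0; congr (_%:M).
by have := @pi_neq0 R; move: (@pi R) => q q0; field.
Qed.

Lemma dotv_Qmx {k : nat} (x y : 'cV[R]_k) : x != 0 -> y != 0 ->
  dotv x (Qmx x y *m y) = norm2 x * norm2 y * relu_corr (cosv x y) / 2.
Proof.
move=> x0 y0; rewrite Qmx_mulmx // dotvZr dotvDr !dotvZr dotv_cosv -norm2_sqr.
by rewrite /relu_corr; have := norm2_neq0 x0; move=> *; field.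
Qed.

Lemma relu_mulmx {q k : nat} (W : 'M[R]_(q, k)) x :
  relu (W *m x) = Wplus W x *m x.
Proof.
rewrite /Wplus -mulmxA mul_diag_mx; apply/colP => i; rewrite !mxE.
by case: ltP => h; rewrite ?mul1r ?mul0r.
Qed.

Lemma WplusE {q k : nat} (W : 'M[R]_(q, k)) x i j :
  Wplus W x i j = (0 < (W *m x) i 0)%R%:R * W i j.
Proof. by rewrite /Wplus mul_diag_mx mxE; congr (_ * _); rewrite mxE. Qed.

Lemma gram_Wplus {q k : nat} (W : 'M[R]_(q, k)) x y :
  \sum_(i < q) ((0 < (W *m x) i 0) && (0 < (W *m y) i 0))%R%:R
                    *: ((row i W)^T *m row i W)
  = (Wplus W x)^T *m Wplus W y.
Proof.
apply/matrixP => a b; rewrite summxE [RHS]mxE; apply: eq_bigr => i _.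
rewrite mxE [X in _ * X = _]mxE big_ord1 [in RHS]mxE !WplusE.
rewrite [(row i W)^T a 0]mxE ![row i W _ _]mxE.
by case: (0 < _)%R; case: (0 < _)%R; rewrite /= ?mul1r ?mul0r ?mulr0.
Qed.

Lemma WDC_gram {q k : nat} (W : 'M[R]_(q, k)) (e : R) x y v : WDC W e 1 ->
    x != 0 -> y != 0 ->
  norm2 ((Wplus W x)^T *m (Wplus W y *m v) - Qmx x y *m v) <= e * norm2 v.
Proof.
move=> H x0 y0; have := H x y x0 y0; rewrite gram_Wplus scale1r => Hs.
by rewrite mulmxA -mulmxBl; exact: spectral_norm_le.
Qed.

End Gram.

(** * Distortion by one layer *)

Section OneLayer.
Context {R : realType}.

Lemma Wplus_norm {q k : nat} (W : 'M[R]_(q, k)) (e : R) x v : WDC W e 1 ->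
    x != 0 ->
  `|2 * norm2 (Wplus W x *m v) ^+ 2 - norm2 v ^+ 2| <= 2 * e * norm2 v ^+ 2.
Proof.
move=> H x0; have := WDC_gram v H x0 x0; rewrite Qmx_diag // mul_scalar_mx.
set g := _ *m (_ *m v) => hg.
have -> : 2 * norm2 (Wplus W x *m v) ^+ 2 - norm2 v ^+ 2
    = 2 * dotv v (g - 2^-1 *: v).
  rewrite dotvBr dotvZr -norm2_sqr /g dotv_mulmx trmxK -norm2_sqr.
  by field.
rewrite normrM ger0_norm //.
have := dotv_le v (g - 2^-1 *: v).
have : norm2 v * norm2 (g - 2^-1 *: v) <= norm2 v * (e * norm2 v).
  by rewrite ler_wpM2l ?norm2_ge0.
by rewrite expr2; lra.
Qed.

(** In the next two lemmas A stands for the factor 2 ^ k by which k layers shrink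
    squared norms. *)
Lemma norm_prod_dist (A d a b X Y : R) : 0 <= A -> 0 <= d -> d <= 1 ->
    0 <= a -> 0 <= b -> 0 <= X -> 0 <= Y ->
    `|A * a ^+ 2 - X ^+ 2| <= d * X ^+ 2 ->
    `|A * b ^+ 2 - Y ^+ 2| <= d * Y ^+ 2 ->
  `|A * (a * b) - X * Y| <= d * (X * Y).
Proof.
move=> A0 d0 d1 a0 b0 X0 Y0; rewrite !ler_distl => /andP[a1 a2] /andP[b1 b2].
have XY0 : 0 <= X * Y by apply: mulr_ge0.
have AB : (A * (a * b)) ^+ 2 = (A * a ^+ 2) * (A * b ^+ 2) by ring.
have ab0 : 0 <= A * (a * b) by rewrite !mulr_ge0.
have Aa0 : 0 <= A * a ^+ 2 by rewrite mulr_ge0 ?sqr_ge0.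
have Ab0 : 0 <= A * b ^+ 2 by rewrite mulr_ge0 ?sqr_ge0.
apply/andP; split.
  have -> : X * Y - d * (X * Y) = (1 - d) * (X * Y) by ring.
  rewrite -(@ler_pXn2r _ 2) ?nnegrE ?mulr_ge0 ?subr_ge0 // AB.
  have -> : ((1 - d) * (X * Y)) ^+ 2
    = (X ^+ 2 - d * X ^+ 2) * (Y ^+ 2 - d * Y ^+ 2) by ring.
  have x1 : 0 <= X ^+ 2 - d * X ^+ 2 by have := sqr_ge0 X; nra.
  have y1 : 0 <= Y ^+ 2 - d * Y ^+ 2 by have := sqr_ge0 Y; nra.
  exact: ler_pM.
have -> : X * Y + d * (X * Y) = (1 + d) * (X * Y) by ring.
rewrite -(@ler_pXn2r _ 2) ?nnegrE ?mulr_ge0 ?addr_ge0 // AB.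
have -> : ((1 + d) * (X * Y)) ^+ 2
  = (X ^+ 2 + d * X ^+ 2) * (Y ^+ 2 + d * Y ^+ 2) by ring.
exact: ler_pM.
Qed.

Lemma norm_ratio_dist (A d a b X Y : R) : 0 < A -> 0 <= d -> d <= 4^-1 ->
    0 < a -> 0 <= b -> 0 < X -> 0 <= Y ->
    `|A * a ^+ 2 - X ^+ 2| <= d * X ^+ 2 ->
    `|A * b ^+ 2 - Y ^+ 2| <= d * Y ^+ 2 ->
  `|b / a - Y / X| <= 2 * d * (Y / X).
Proof.
move=> A0 d0 d1 a0 b0 X0 Y0; rewrite !ler_distl => /andP[a1 a2] /andP[b1 b2].
have X2 : 0 < X ^+ 2 by rewrite exprn_gt0.
have Y2 := sqr_ge0 Y.
have XY : 0 <= X ^+ 2 * Y ^+ 2 by rewrite mulr_ge0 ?sqr_ge0.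
apply/andP; split.
  have -> : Y / X - 2 * d * (Y / X) = (1 - 2 * d) * Y / X by ring.
  rewrite ler_pdivrMr // mulrAC ler_pdivlMr //.
  rewrite -(@ler_pXn2r _ 2) ?nnegrE ?mulr_ge0 ?subr_ge0 ?(ltW a0) ?(ltW X0) //;
    last lra.
  rewrite -(ler_pM2l A0).
  have -> : A * ((1 - 2 * d) * Y * a) ^+ 2
    = (1 - 2 * d) ^+ 2 * Y ^+ 2 * (A * a ^+ 2) by ring.
  have -> : A * (b * X) ^+ 2 = A * b ^+ 2 * X ^+ 2 by ring.
  apply: (@le_trans _ _ ((1 - 2 * d) ^+ 2 * Y ^+ 2 * (X ^+ 2 + d * X ^+ 2))).
    by apply: ler_wpM2l => //; apply: mulr_ge0; exact: sqr_ge0.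
  apply: (@le_trans _ _ ((Y ^+ 2 - d * Y ^+ 2) * X ^+ 2)); last first.
    by apply: ler_wpM2r; rewrite ?(ltW X2) //.
  have -> : (1 - 2 * d) ^+ 2 * Y ^+ 2 * (X ^+ 2 + d * X ^+ 2)
    = (X ^+ 2 * Y ^+ 2) * ((1 - 2 * d) ^+ 2 * (1 + d)) by ring.
  have -> : (Y ^+ 2 - d * Y ^+ 2) * X ^+ 2
    = (X ^+ 2 * Y ^+ 2) * (1 - d) by ring.
  apply: ler_wpM2l => //.
  have -> : (1 - 2 * d) ^+ 2 * (1 + d) = 1 - d + d * (-2 + 4 * d ^+ 2) by ring.
  by nra.
have -> : Y / X + 2 * d * (Y / X) = (1 + 2 * d) * Y / X by ring.
rewrite ler_pdivrMr // mulrAC ler_pdivlMr //.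
rewrite -(@ler_pXn2r _ 2) ?nnegrE ?mulr_ge0 ?addr_ge0 ?(ltW a0) ?(ltW X0) //;
  last by apply: mulr_ge0.
rewrite -(ler_pM2l A0).
have -> : A * ((1 + 2 * d) * Y * a) ^+ 2
  = (1 + 2 * d) ^+ 2 * Y ^+ 2 * (A * a ^+ 2) by ring.
have -> : A * (b * X) ^+ 2 = A * b ^+ 2 * X ^+ 2 by ring.
apply: (@le_trans _ _ ((1 + 2 * d) ^+ 2 * Y ^+ 2 * (X ^+ 2 - d * X ^+ 2))); last first.
  by apply: ler_wpM2l => //; apply: mulr_ge0; exact: sqr_ge0.
apply: (@le_trans _ _ ((Y ^+ 2 + d * Y ^+ 2) * X ^+ 2)).
  by apply: ler_wpM2r; rewrite ?(ltW X2) //.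
have -> : (1 + 2 * d) ^+ 2 * Y ^+ 2 * (X ^+ 2 - d * X ^+ 2)
  = (X ^+ 2 * Y ^+ 2) * ((1 + 2 * d) ^+ 2 * (1 - d)) by ring.
have -> : (Y ^+ 2 + d * Y ^+ 2) * X ^+ 2
  = (X ^+ 2 * Y ^+ 2) * (1 + d) by ring.
apply: ler_wpM2l => //.
have -> : (1 + 2 * d) ^+ 2 * (1 - d) = 1 + d + d * (2 - 4 * d ^+ 2) by ring.
by nra.
Qed.

Lemma cosv_relu_layer {q k : nat} (W : 'M[R]_(q, k)) (e : R) x y : WDC W e 1 ->
    0 <= e -> e <= 16^-1 -> x != 0 -> y != 0 ->
  `|cosv (relu (W *m x)) (relu (W *m y)) - relu_corr (cosv x y)| <= 8 * e.
Proof.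
move=> H e0 e1 x0 y0; rewrite !relu_mulmx.
set a := Wplus W x *m x; set c := Wplus W y *m y.
have X0 := norm2_gt0 x0; have Y0 := norm2_gt0 y0.
have r := relu_corr_range (@cosv_range R k x y); rewrite -/(cosv x y) in r.
have f0 := relu_corr_ge0 (@cosv_range R k x y); rewrite -/(cosv x y) in f0.
have /andP[_ f1] := r.
have na := Wplus_norm x H x0; have nc := Wplus_norm y H y0.
rewrite -/a in na; rewrite -/c in nc.
have P0 : 0 < norm2 x * norm2 y by apply: mulr_gt0.
have := @norm_prod_dist 2 (2 * e) _ _ _ _ _ _ _ _ _ _ _ na nc.
rewrite !norm2_ge0 ler0n => /(_ isT _ _ isT isT isT isT) S.
have {}S : `|2 * (norm2 a * norm2 c) - norm2 x * norm2 y|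
   <= 2 * e * (norm2 x * norm2 y) by apply: S; lra.
have D : `|2 * dotv a c - norm2 x * norm2 y * relu_corr (cosv x y)|
   <= 2 * e * (norm2 x * norm2 y).
  have := WDC_gram y H x0 y0; rewrite -/c; set g := _ *m c => hg.
  have -> : 2 * dotv a c - norm2 x * norm2 y * relu_corr (cosv x y)
      = 2 * dotv x (g - Qmx x y *m y).
    by rewrite dotvBr dotv_Qmx // /g dotv_mulmx trmxK; field.
  rewrite normrM ger0_norm //.
  have := dotv_le x (g - Qmx x y *m y).
  have : norm2 x * norm2 (g - Qmx x y *m y) <= norm2 x * (e * norm2 y).
    by rewrite ler_wpM2l ?norm2_ge0.
  by lra.
rewrite /cosv -/(cosv x y); move: (relu_corr _) (norm2 a * norm2 c) (dotv a c)
  (norm2 x * norm2 y) f0 f1 P0 S D {r na nc} => f S g P f0 f1 P0.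
rewrite !ler_distl => /andP[s1 s2] /andP[d1 d2].
have S0 : 0 < S by nra.
by rewrite ler_pdivrMr // ler_pdivlMr //; apply/andP; split; nra.
Qed.

End OneLayer.

(** * Forward and backward passes through frozen layers *)

Section BackProjection.
Context {R : realType}.

(** The mean of 2 ^ k times the back-projection, through k layers frozen at x, of
    the image of y. *)
Definition backproj (k : nat) (n : nat) (x y : 'cV[R]_n) : 'cV[R]_n :=
  xi (cosv x y) k *: y + (zeta (cosv x y) k * (norm2 y / norm2 x)) *: x.

Lemma norm_ratioK n (x y : 'cV[R]_n) : x != 0 ->
  norm2 ((norm2 y / norm2 x) *: x) = norm2 y.
Proof.
move=> x0; rewrite norm2Z_ge0 ?divr_ge0 ?norm2_ge0 //.
by rewrite mulfVK // norm2_neq0.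
Qed.

Lemma backproj_norm k n (x y : 'cV[R]_n) : x != 0 ->
  norm2 (backproj k x y) <= 3 * norm2 y.
Proof.
move=> x0; apply: le_trans (ler_norm2D _ _) _.
rewrite -scalerA norm2Z [norm2 (zeta _ _ *: _)]norm2Z norm_ratioK //.
have r : corr_range (cosv x y) by exact: cosv_range.
rewrite !ger0_norm ?xi_ge0 ?zeta_ge0 //.
have := xi_le1 k r; have := zeta_le2 k r; have := norm2_ge0 y.
by nra.
Qed.

End BackProjection.

Section Layers.
Context {R : realType}.
Variables (N : nat -> nat) (W : forall i, 'M[R]_(N i.+1, N i)).

(** The layers with the activation pattern frozen at x: the piecewise linear map
    that they define is linear where the pattern does not change. *)
Fixpoint layers_mx (k : nat) (x : 'cV[R]_(N 0%N)) : 'M[R]_(N k, N 0%N) :=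
  match k with
  | 0%N => 1%:M
  | k'.+1 => Wplus (W k') (layers W k' x) *m layers_mx k' x
  end.

Lemma layers_mxE k x : layers W k x = layers_mx k x *m x.
Proof.
by elim: k => [|k IH] /=; rewrite ?mul1mx // relu_mulmx {2}IH mulmxA.
Qed.

Variable (e : R).

Definition layers_WDC k := forall i, (i < k)%N -> WDC (W i) e 1.

Lemma layers_WDCS k : layers_WDC k.+1 -> layers_WDC k.
Proof. by move=> H i ik; apply: H; rewrite ltnW. Qed.

Let smallS k : 0 <= e -> k.+1%:R * e <= 16^-1 -> k%:R * e <= 16^-1 /\ e <= 16^-1.
Proof.
move=> e0; rewrite -natr1 mulrDl mul1r => h.
have h1 : 0 <= k%:R * e by rewrite mulr_ge0.
by split; lra.
Qed.

(** The lower bound on norms keeps the features of x away from 0, so that the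
    condition on the weights, which concerns nonzero vectors only, applies at
    the next layer. *)
Lemma layers_norm k x : 0 <= e -> layers_WDC k -> k%:R * e <= 16^-1 -> x != 0 ->
  layers W k x != 0 /\
  forall v, `|2 ^+ k * norm2 (layers_mx k x *m v) ^+ 2 - norm2 v ^+ 2|
    <= 4 * (k%:R * e) * norm2 v ^+ 2.
Proof.
move=> e0 H hk x0.
suff L v : `|2 ^+ k * norm2 (layers_mx k x *m v) ^+ 2 - norm2 v ^+ 2|
    <= 4 * (k%:R * e) * norm2 v ^+ 2.
  split=> //; rewrite -norm2_eq0 layers_mxE; apply/eqP => n0.
  have := L x; rewrite n0 expr0n mulr0 sub0r normrN ger0_norm ?sqr_ge0 //.
  have : 0 < norm2 x ^+ 2 by rewrite exprn_gt0 // norm2_gt0.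
  by nra.
elim: k H hk v => [|k IH] H hk v.
  by rewrite /= mul1mx expr0 mul1r subrr normr0 mul0r mulr0 mul0r.
have [hk' he] := smallS e0 hk; have {}IH := IH (layers_WDCS H) hk'.
have xk0 : layers W k x != 0.
  rewrite -norm2_eq0 layers_mxE; apply/eqP => n0.
  have := IH x; rewrite n0 expr0n mulr0 sub0r normrN ger0_norm ?sqr_ge0 //.
  have : 0 < norm2 x ^+ 2 by rewrite exprn_gt0 // norm2_gt0.
  by nra.
have := Wplus_norm (layers_mx k x *m v) (H k (ltnSn k)) xk0.
rewrite /= -mulmxA; set a := norm2 (Wplus _ _ *m _); move: (IH v).
set c := norm2 (layers_mx k x *m v) => hc ha.
have P0 : 0 < 2 ^+ k :> R by rewrite exprn_gt0.
have n0 := sqr_ge0 (norm2 v).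
have ha' : `|2 ^+ k.+1 * a ^+ 2 - 2 ^+ k * c ^+ 2| <= 2 * e * (2 ^+ k * c ^+ 2).
  have -> : 2 ^+ k.+1 * a ^+ 2 - 2 ^+ k * c ^+ 2
    = 2 ^+ k * (2 * a ^+ 2 - c ^+ 2) by rewrite exprS; ring.
  by rewrite normrM (gtr0_norm P0) [X in _ <= X]mulrCA ler_pM2l.
apply: le_trans (ler_distD (2 ^+ k * c ^+ 2) _ _) _.
have k0 : 0 <= k%:R * e by rewrite mulr_ge0.
have -> : k.+1%:R * e = k%:R * e + e by rewrite -natr1; ring.
move: hc ha'; set C := 2 ^+ k * c ^+ 2; set V := norm2 v ^+ 2 in n0 *.
move=> hc ha'; have : C <= 2 * V.
  by move: hc; rewrite ler_distl => /andP[_]; nra.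
move=> hC; have : 2 * e * C <= 2 * e * (2 * V) by apply: ler_wpM2l => //; lra.
by lra.
Qed.

Lemma layers_neq0 k x : 0 <= e -> layers_WDC k -> k%:R * e <= 16^-1 -> x != 0 ->
  layers W k x != 0.
Proof. by move=> e0 H hk x0; have [] := layers_norm e0 H hk x0. Qed.

Lemma layers_norm_self k x : 0 <= e -> layers_WDC k -> k%:R * e <= 16^-1 -> x != 0 ->
  `|2 ^+ k * norm2 (layers W k x) ^+ 2 - norm2 x ^+ 2|
    <= 4 * (k%:R * e) * norm2 x ^+ 2.
Proof. by move=> e0 H hk x0; rewrite layers_mxE; have [_] := layers_norm e0 H hk x0. Qed.

Lemma layers_norm_prod k x y : 0 <= e -> layers_WDC k -> k%:R * e <= 16^-1 ->
    x != 0 -> y != 0 ->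
  `|2 ^+ k * (norm2 (layers W k x) * norm2 (layers W k y)) - norm2 x * norm2 y|
    <= 4 * (k%:R * e) * (norm2 x * norm2 y).
Proof.
move=> e0 H hk x0 y0; have k0 : 0 <= k%:R * e by rewrite mulr_ge0.
apply: norm_prod_dist; rewrite ?norm2_ge0 ?exprn_ge0 ?mulr_ge0 //; first lra.
  exact: layers_norm_self.
exact: layers_norm_self.
Qed.

Lemma layers_norm_ratio k x y : 0 <= e -> layers_WDC k -> k%:R * e <= 16^-1 ->
    x != 0 -> y != 0 ->
  `|norm2 (layers W k y) / norm2 (layers W k x) - norm2 y / norm2 x|
    <= 8 * (k%:R * e) * (norm2 y / norm2 x).
Proof.
move=> e0 H hk x0 y0; have k0 : 0 <= k%:R * e by rewrite mulr_ge0.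
have -> : 8 * (k%:R * e) = 2 * (4 * (k%:R * e)) by ring.
apply: (@norm_ratio_dist _ (2 ^+ k)); rewrite ?norm2_ge0 ?exprn_gt0 ?norm2_gt0 //.
- by rewrite mulr_ge0.
- by lra.
- exact: layers_neq0.
- exact: layers_norm_self.
- exact: layers_norm_self.
Qed.

Lemma layers_corr k x y : 0 <= e -> layers_WDC k -> k%:R * e <= 16^-1 ->
    x != 0 -> y != 0 ->
  `|cosv (layers W k x) (layers W k y) - corr (cosv x y) k| <= 8 * (k%:R * e).
Proof.
move=> e0; elim: k => [|k IH] H hk x0 y0; first by rewrite /= subrr normr0 mul0r mulr0.
have [hk' he] := smallS e0 hk; have H' := layers_WDCS H.
have {}IH := IH H' hk' x0 y0.
have := cosv_relu_layer (H k (ltnSn k)) e0 he (layers_neq0 e0 H' hk' x0)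
  (layers_neq0 e0 H' hk' y0).
have := relu_corr_lip (cosv_range (layers W k x) (layers W k y))
  (corr_in k (cosv_range x y)).
rewrite -!/(cosv _ _) => h1 h2.
apply: le_trans (ler_distD (relu_corr (cosv (layers W k x) (layers W k y))) _ _) _.
by rewrite -natr1 mulrDl; move: h1 h2 IH; rewrite -corrS /=; lra.
Qed.

(** Back-propagation contracts as much as the forward pass, so an error
    relative to the current features becomes the same relative error at the
    input. *)
Lemma backprop_error k x y v (c : R) : 0 <= e -> layers_WDC k -> k%:R * e <= 16^-1 ->
    x != 0 -> y != 0 -> 0 <= c -> norm2 v <= c * norm2 (layers W k y) ->
  2 ^+ k * norm2 ((layers_mx k x)^T *m v) <= 5 / 4 * c * norm2 y.
Proof.
move=> e0 H hk x0 y0 c0 hv; have k0 : 0 <= k%:R * e by rewrite mulr_ge0.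
have P0 : 0 < 2 ^+ k :> R by rewrite exprn_gt0.
have [_ L] := layers_norm e0 H hk x0.
have := layers_norm_self e0 H hk y0; rewrite ler_distl => /andP[_ hy].
have T : norm2 ((layers_mx k x)^T *m v) ^+ 2 <= (5 / 4 / 2 ^+ k) * norm2 v ^+ 2.
  apply: norm2_trmx_le => [|z]; first by rewrite divr_ge0 ?ltW.
  have := L z; rewrite ler_distl => /andP[_ h].
  have n0 := sqr_ge0 (norm2 z).
  rewrite mulrAC ler_pdivlMr // mulrC; nra.
rewrite -(@ler_pXn2r _ 2) ?nnegrE ?mulr_ge0 ?norm2_ge0 ?(ltW P0) //.
rewrite exprMn.
have h1 : norm2 v ^+ 2 <= c ^+ 2 * norm2 (layers W k y) ^+ 2.
  by rewrite -exprMn ler_pXn2r ?nnegrE ?mulr_ge0 ?norm2_ge0.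
have h2 : (2 ^+ k) ^+ 2 * norm2 ((layers_mx k x)^T *m v) ^+ 2
    <= (2 ^+ k) ^+ 2 * ((5 / 4 / 2 ^+ k) * norm2 v ^+ 2).
  by rewrite ler_wpM2l ?sqr_ge0.
apply: le_trans h2 _.
have -> : (2 ^+ k) ^+ 2 * (5 / 4 / 2 ^+ k * norm2 v ^+ 2)
   = 5 / 4 * (2 ^+ k * norm2 v ^+ 2).
  by field; rewrite gt_eqF.
have h3 : 2 ^+ k * norm2 v ^+ 2
    <= c ^+ 2 * (2 ^+ k * norm2 (layers W k y) ^+ 2).
  by rewrite [X in _ <= X]mulrCA ler_wpM2l // ltW.
have h4 : c ^+ 2 * (2 ^+ k * norm2 (layers W k y) ^+ 2)
   <= c ^+ 2 * (5 / 4 * norm2 y ^+ 2).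
  rewrite ler_wpM2l ?sqr_ge0 //; apply: le_trans hy _.
  by have := sqr_ge0 (norm2 y); nra.
have -> : (5 / 4 * c * norm2 y) ^+ 2 = 5 / 4 * (c ^+ 2 * (5 / 4 * norm2 y ^+ 2)).
  by field.
by lra.
Qed.

Lemma backprop_self k x : 0 <= e -> layers_WDC k -> k%:R * e <= 16^-1 -> x != 0 ->
  norm2 (2 ^+ k *: ((layers_mx k x)^T *m layers W k x) - x)
    <= 4 * (k%:R * e) * norm2 x.
Proof.
move=> e0; elim: k => [|k IH] H hk x0.
  by rewrite /= expr0 scale1r trmx1 mul1mx subrr norm2_0 mul0r mulr0 mul0r.
have [hk' he] := smallS e0 hk; have H' := layers_WDCS H.
have {}IH := IH H' hk' x0; have xk0 := layers_neq0 e0 H' hk' x0.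
have := WDC_gram (layers W k x) (H k (ltnSn k)) xk0 xk0.
rewrite Qmx_diag // mul_scalar_mx; set v := (_ - _) => hv.
have := backprop_error e0 H' hk' x0 x0 e0 hv => hb.
have -> : 2 ^+ k.+1 *: ((layers_mx k.+1 x)^T *m layers W k.+1 x) - x
  = (2 ^+ k *: ((layers_mx k x)^T *m layers W k x) - x)
    + 2 ^+ k.+1 *: ((layers_mx k x)^T *m v).
  rewrite /= trmx_mul relu_mulmx -mulmxA /v mulmxBr scalerBr -scalemxAr.
  by rewrite scalerA exprS mulrAC mulfV // mul1r addrAC addrCA subrr addr0.
apply: le_trans (ler_norm2D _ _) _.
rewrite norm2Z_ge0 ?exprn_ge0 // exprS -mulrA -natr1 mulrDl.
by have := norm2_ge0 x; nra.
Qed.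

(** The next step of the recursion for the back-projection, with the mean Q in
    place of the Gram matrix of a layer. Here y is propagated with its own
    patterns and x with its own, and the coefficients of Q are those of their
    current angle, which is where the error b comes from: 12 b for pass_coef
    acting on a vector of norm at most 3 |y|, 2 b for mix_coef, and 2 b for the
    distortion of norms. *)
Lemma backprop_Q k x y (b : R) : 0 <= e -> layers_WDC k -> k%:R * e <= b ^+ 2 ->
    0 <= b -> b <= 4^-1 -> x != 0 -> y != 0 ->
  norm2 (2 ^+ k.+1 *: ((layers_mx k x)^T *m
      (Qmx (layers W k x) (layers W k y) *m layers W k y))
    - backproj k.+1 x y)
  <= norm2 (2 ^+ k *: ((layers_mx k x)^T *m layers W k y) - backproj k x y)
     + 16 * b * norm2 y.
Proof.
move=> e0 H hb b0 b1 x0 y0; have hk : k%:R * e <= 16^-1 by nra.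
have k0 : 0 <= k%:R * e by rewrite mulr_ge0.
have xk0 := layers_neq0 e0 H hk x0; have yk0 := layers_neq0 e0 H hk y0.
rewrite (Qmx_mulmx xk0 yk0).
set xk := layers W k x; set yk := layers W k y.
set c := cosv xk yk; set c' := corr (cosv x y) k.
have rc : corr_range c by exact: cosv_range.
have rc' : corr_range c' by exact/corr_in/cosv_range.
set ratio := norm2 yk / norm2 xk; set ratio' := norm2 y / norm2 x.
set L := (layers_mx k x)^T; set u := 2 ^+ k *: (L *m yk).
set z := 2 ^+ k *: (L *m xk).
have -> : 2 ^+ k.+1 *: (L *m (2^-1 *: (pass_coef c *: yk
    + (mix_coef c * ratio) *: xk))) - backproj k.+1 x y
  = pass_coef c *: (u - backproj k x y)
    + (pass_coef c - pass_coef c') *: backproj k x y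
    + (mix_coef c *: (ratio *: (z - x) + (ratio - ratio') *: x)
       + (mix_coef c - mix_coef c') *: (ratio' *: x)).
  have -> : backproj k.+1 x y = pass_coef c' *: backproj k x y
     + (mix_coef c' * ratio') *: x.
    rewrite /backproj /= scalerDr -addrA !scalerA -scalerDl -/c' -/ratio'.
    by congr (_ + _ *: _); ring.
  rewrite -scalemxAr mulmxDr -!scalemxAr exprS.
  rewrite /u /z; move: (L *m yk) (L *m xk) (backproj k x y) => U Z B.
  by apply/colP => i; rewrite !mxE; field.
have dc : `|c - c'| <= 8 * (k%:R * e) by exact: layers_corr.
have dp : `|pass_coef c - pass_coef c'| <= 4 * b.
  by apply: pass_coef_dist => //; nra.
have dm : `|mix_coef c - mix_coef c'| <= 2 * b.
  by apply: mix_coef_dist => //; nra.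
have dr : `|ratio - ratio'| <= 8 * (k%:R * e) * ratio' by exact: layers_norm_ratio.
have dz : norm2 (z - x) <= 4 * (k%:R * e) * norm2 x by exact: backprop_self.
have X0 := norm2_gt0 x0; have Y0 := norm2_gt0 y0.
have r0 : 0 <= ratio by rewrite divr_ge0 ?norm2_ge0.
have r0' : 0 <= ratio' by rewrite divr_ge0 ?norm2_ge0.
have rX : ratio' * norm2 x = norm2 y by rewrite /ratio' mulfVK // gt_eqF.
have p0 := pass_coef_ge0 rc; have p1 := pass_coef_le1 rc.
have m0 := mix_coef_ge0 c; have m1 := mix_coef_le c.
apply: le_trans (ler_norm2D _ _) _.
have t1 : norm2 (pass_coef c *: (u - backproj k x y)
    + (pass_coef c - pass_coef c') *: backproj k x y)
    <= norm2 (u - backproj k x y) + 12 * b * norm2 y.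
  apply: le_trans (ler_norm2D _ _) _; rewrite !norm2Z (ger0_norm p0).
  have h1 : pass_coef c * norm2 (u - backproj k x y) <= 1 * norm2 (u - backproj k x y).
    by rewrite ler_wpM2r ?norm2_ge0.
  have h2 : `|pass_coef c - pass_coef c'| * norm2 (backproj k x y)
     <= 4 * b * (3 * norm2 y).
    by apply: ler_pM; rewrite ?norm2_ge0 ?backproj_norm.
  by lra.
have t2 : norm2 (ratio *: (z - x) + (ratio - ratio') *: x) <= 14 * (k%:R * e) * norm2 y.
  apply: le_trans (ler_norm2D _ _) _; rewrite !norm2Z (ger0_norm r0).
  have h1 : ratio <= 3 / 2 * ratio'.
    by move: dr; rewrite ler_distl => /andP[_ h]; nra.
  have h2 : ratio * norm2 (z - x) <= (3 / 2 * ratio') * (4 * (k%:R * e) * norm2 x).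
    by apply: ler_pM; rewrite ?norm2_ge0.
  have h3 : `|ratio - ratio'| * norm2 x <= 8 * (k%:R * e) * ratio' * norm2 x.
    by rewrite ler_wpM2r ?norm2_ge0.
  by rewrite -rX; lra.
have t3 : norm2 (mix_coef c *: (ratio *: (z - x) + (ratio - ratio') *: x)
       + (mix_coef c - mix_coef c') *: (ratio' *: x)) <= 4 * b * norm2 y.
  apply: le_trans (ler_norm2D _ _) _.
  rewrite [norm2 (mix_coef c *: _)]norm2Z (ger0_norm m0).
  rewrite [norm2 (_ *: (ratio' *: _))]norm2Z norm2Z_ge0 // rX.
  have h1 : mix_coef c * norm2 (ratio *: (z - x) + (ratio - ratio') *: x)
    <= 2^-1 * (14 * (k%:R * e) * norm2 y) by apply: ler_pM; rewrite ?norm2_ge0.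
  have h2 : `|mix_coef c - mix_coef c'| * norm2 y <= 2 * b * norm2 y.
    by rewrite ler_wpM2r ?norm2_ge0.
  have h3 : 7 * (k%:R * e) * norm2 y <= 2 * b * norm2 y.
    by rewrite ler_wpM2r ?norm2_ge0 //; nra.
  by lra.
by lra.
Qed.

(** Seen from the top, each layer contributes its Gram matrix, which is replaced
    by Q; as Q only combines the features of x and y, the recursion closes on
    the span of x and y. The errors of the layers add up. *)
Lemma backprop_layers k x y (b : R) : 0 <= e -> layers_WDC k -> k%:R * e <= b ^+ 2 ->
    0 <= b -> b <= 4^-1 -> x != 0 -> y != 0 ->
  norm2 (2 ^+ k *: ((layers_mx k x)^T *m layers W k y) - backproj k x y)
    <= 17 * (k%:R * b) * norm2 y.
Proof.
move=> e0; elim: k => [|k IH] H hb b0 b1 x0 y0.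
  rewrite /backproj /= expr0 !scale1r trmx1 mul1mx mul0r scale0r addr0 subrr.
  by rewrite norm2_0 mul0r mulr0 mul0r.
have H' := layers_WDCS H; have k0 : 0 <= k%:R * e by rewrite mulr_ge0.
have [hb' he] : k%:R * e <= b ^+ 2 /\ e <= b ^+ 2.
  by move: hb; rewrite -natr1 mulrDl mul1r => h; split; lra.
have hk' : k%:R * e <= 16^-1 by nra.
have {}IH := IH H' hb' b0 b1 x0 y0.
have hQ := backprop_Q e0 H' hb' b0 b1 x0 y0.
have := WDC_gram (layers W k y) (H k (ltnSn k)) (layers_neq0 e0 H' hk' x0)
  (layers_neq0 e0 H' hk' y0).
set q := Qmx _ _ *m _ in hQ *; set v := (_ - q) => hv.
have he' := backprop_error e0 H' hk' x0 y0 e0 hv.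
have -> : 2 ^+ k.+1 *: ((layers_mx k.+1 x)^T *m layers W k.+1 y) - backproj k.+1 x y
  = (2 ^+ k.+1 *: ((layers_mx k x)^T *m q) - backproj k.+1 x y)
    + 2 ^+ k.+1 *: ((layers_mx k x)^T *m v).
  rewrite [layers W k.+1 y]/= [layers_mx k.+1 x]/= trmx_mul relu_mulmx -mulmxA.
  rewrite /v (mulmxBr _ _ q) scalerBr.
  by rewrite [RHS]addrC [RHS]addrA subrK.
apply: le_trans (ler_norm2D _ _) _.
move: hQ; set A := norm2 (_ - backproj k.+1 x y) => hQ.
rewrite norm2Z_ge0 ?exprn_ge0 // exprS -mulrA -natr1 mulrDl mul1r.
have Y0 := norm2_ge0 y.
have : 5 / 2 * e * norm2 y <= b * norm2 y by rewrite ler_wpM2r //; nra.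
by lra.
Qed.

End Layers.

(** * The cross term of the two networks *)

Section CrossTerm.
Context {R : realType}.

(** The joint condition is symmetric in the two networks, and each half of it
    serves the gradient in one of the two variables. *)
Definition joint_WDC_left {l k r : nat} (B : 'M[R]_(l, k)) (C : 'M[R]_(l, r))
    (eps alpha : R) : Prop :=
  forall (h x : 'cV[R]_k) (m y : 'cV[R]_r),
    h != 0 -> x != 0 -> m != 0 -> y != 0 ->
    spectral_norm
      ((Wplus B h)^T
         *m diag_mx (hadamard (Wplus C m *m m) (Wplus C y *m y))^T
         *m Wplus B x
       - (alpha / l%:R * dotv m (Qmx m y *m y)) *: Qmx h x)
      <= eps / l%:R * norm2 m * norm2 y.

Lemma joint_WDC_leftl {l k r : nat} (B : 'M[R]_(l, k)) (C : 'M[R]_(l, r)) eps alpha :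
  joint_WDC B C eps alpha -> joint_WDC_left B C eps alpha.
Proof. by move=> H h x m y h0 x0 m0 y0; have [] := H h x m y h0 x0 m0 y0. Qed.

Lemma joint_WDC_leftr {l k r : nat} (B : 'M[R]_(l, k)) (C : 'M[R]_(l, r)) eps alpha :
  joint_WDC B C eps alpha -> joint_WDC_left C B eps alpha.
Proof. by move=> H h x m y h0 x0 m0 y0; have [] := H m y h x m0 y0 h0 x0. Qed.

Lemma layers0 (N : nat -> nat) (W : forall i, 'M[R]_(N i.+1, N i)) k :
  layers W k 0 = 0.
Proof. by rewrite layers_mxE mulmx0. Qed.

Lemma network0 (N : nat -> nat) (W : forall i, 'M[R]_(N i.+1, N i)) k l
    (V : 'M[R]_(l, N k)) : network W V 0 = 0.
Proof. by rewrite /network layers0 relu_mulmx mulmx0. Qed.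

Definition network_mx (N : nat -> nat) (W : forall i, 'M[R]_(N i.+1, N i))
    (k l : nat) (V : 'M[R]_(l, N k)) (x : 'cV[R]_(N 0%N)) : 'M[R]_(l, N 0%N) :=
  Wplus V (layers W k x) *m layers_mx W k x.

Lemma hadamardE k (x y : 'cV[R]_k) : diag_mx x^T *m y = hadamard x y.
Proof. by rewrite mul_diag_mx; apply/colP => i; rewrite !mxE. Qed.

Lemma hadamardC k (x y : 'cV[R]_k) : hadamard x y = hadamard y x.
Proof. by apply/colP => i; rewrite !mxE mulrC. Qed.

Lemma hadamard0 k (x : 'cV[R]_k) : hadamard x 0 = 0.
Proof. by apply/colP => i; rewrite !mxE mulr0. Qed.

(** In the mean, the network of m only enters through a scalar, the inner product
    of its outputs at m and m', and that of h only through a back-projection. *)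
Definition cross_mean (k1 k2 n p : nat) (h h' : 'cV[R]_n) (m m' : 'cV[R]_p) :=
  (norm2 m * norm2 m' * corr (cosv m m') k2.+1) *: backproj k1.+1 h h'.

Lemma cross_mean_diag k1 k2 n p (h : 'cV[R]_n) (m : 'cV[R]_p) :
  h != 0 -> m != 0 -> cross_mean k1 k2 h h m m = norm2 m ^+ 2 *: h.
Proof.
move=> h0 m0; rewrite /cross_mean /backproj !cosvv // corr1 xi1 zeta1.
by rewrite mul0r scale0r addr0 scale1r mulr1 expr2.
Qed.

Variables (N P : nat -> nat).
Variables (W1 : forall i, 'M[R]_(N i.+1, N i)) (W2 : forall i, 'M[R]_(P i.+1, P i)).
Variables (k1 k2 l : nat) (V1 : 'M[R]_(l, N k1)) (V2 : 'M[R]_(l, P k2)).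

(** Where it exists, the gradient in h of the objective is, up to the choice of
    patterns, the difference of two such terms, one with (h', m') = (h, m) and
    one with (h', m') = (h0, m0). *)
Definition cross (h h' : 'cV[R]_(N 0%N)) (m m' : 'cV[R]_(P 0%N)) : 'cV[R]_(N 0%N) :=
  (network_mx W1 V1 h)^T
    *m hadamard (hadamard (network W2 V2 m) (network W2 V2 m')) (network W1 V1 h').

Variables (e alpha b : R).

(** The joint condition replaces the last layers of both networks at once by a
    scalar times Q. The scalar is the norm product times one more step of the
    correlation of m and m', and applying Q is one more step of the
    back-projection in h. *)
Lemma cross_close h h' m m' : 0 <= e -> 0 <= alpha -> alpha <= 1 ->
    0 <= b -> b <= 4^-1 -> k1.+1%:R * e <= b ^+ 2 -> k2.+1%:R * e <= b ^+ 2 ->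
    (0 < l)%N -> layers_WDC W1 e k1 -> layers_WDC W2 e k2 ->
    joint_WDC_left V1 V2 e alpha -> h != 0 -> m != 0 ->
  norm2 ((2 ^+ k1.+1 * 2 ^+ k2.+1 * l%:R) *: cross h h' m m'
     - alpha *: cross_mean k1 k2 h h' m m')
    <= 33 * (k1.+1%:R * b) * (norm2 m * norm2 m' * norm2 h').
Proof.
move=> e0 a0 a1 b0 b1 hb1 hb2 l0 H1 H2 J h0 m0.
have [->|h'0] := eqVneq h' 0.
  rewrite /cross network0 hadamard0 mulmx0 scaler0 /cross_mean /backproj norm2_0.
  by rewrite mul0r mulr0 scale0r !scaler0 addr0 !scaler0 subr0 norm2_0 !mulr0.
have [->|m'0] := eqVneq m' 0.
  rewrite /cross network0 hadamard0 hadamardC hadamard0 mulmx0 scaler0.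
  by rewrite /cross_mean norm2_0 mulr0 mul0r scale0r scaler0 subr0 norm2_0 mul0r mulr0.
have k1e : 0 <= k1%:R * e by rewrite mulr_ge0.
have k2e : 0 <= k2%:R * e by rewrite mulr_ge0.
have k1b : 0 <= k1%:R * b by rewrite mulr_ge0.
have [hb1' he] : k1%:R * e <= b ^+ 2 /\ e <= b ^+ 2.
  by move: hb1; rewrite -natr1 mulrDl mul1r => ?; split; lra.
have hb2' : k2%:R * e <= b ^+ 2.
  by move: hb2; rewrite -natr1 mulrDl mul1r => ?; lra.
have hk1 : k1%:R * e <= 16^-1 by nra.
have hk2 : k2%:R * e <= 16^-1 by nra.
set hk := layers W1 k1 h; set hk' := layers W1 k1 h'.
set mk := layers W2 k2 m; set mk' := layers W2 k2 m'.
have hk_0 : hk != 0 by apply: (layers_neq0 e0).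
have hk'_0 : hk' != 0 by apply: (layers_neq0 e0).
have mk_0 : mk != 0 by apply: (layers_neq0 e0).
have mk'_0 : mk' != 0 by apply: (layers_neq0 e0).
have l0R : 0 < l%:R :> R by rewrite ltr0n.
pose g := 2 ^+ k2.+1 * dotv mk (Qmx mk mk' *m mk').
pose L := (layers_mx W1 k1 h)^T.
pose q := 2 ^+ k1.+1 *: (L *m (Qmx hk hk' *m hk')).
have := spectral_norm_le (J hk hk' mk mk' hk_0 hk'_0 mk_0 mk'_0) hk'.
rewrite mulmxBl -scalemxAl; set v := (_ - _) => hv.
have cE : (2 ^+ k1.+1 * 2 ^+ k2.+1 * l%:R) *: cross h h' m m'
   = (2 ^+ k1.+1 * 2 ^+ k2.+1 * l%:R) *: (L *m v) + (alpha * g) *: q.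
  have -> : cross h h' m m'
     = L *m v + (alpha / l%:R * dotv mk (Qmx mk mk' *m mk')) *:
         (L *m (Qmx hk hk' *m hk')).
    rewrite scalemxAr -mulmxDr /v subrK /cross /network_mx trmx_mul -mulmxA.
    rewrite -hadamardE /network !relu_mulmx -/hk -/hk' -/mk -/mk'.
    by rewrite -!mulmxA.
  rewrite scalerDr; congr (_ + _); rewrite /q /g !scalerA; congr (_ *: _).
  by field; rewrite gt_eqF.
have M0 : 0 < norm2 m * norm2 m' by rewrite mulr_gt0 // norm2_gt0.
have H0 : 0 <= norm2 h' by exact: norm2_ge0.
have P2 : 0 < 2 ^+ k2 :> R by rewrite exprn_gt0.
have hB := layers_norm_prod e0 H2 hk2 m0 m'0; rewrite -/mk -/mk' in hB.
set M := norm2 m * norm2 m' in M0 hB *.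
pose B := 2 ^+ k2 * (norm2 mk * norm2 mk').
have B0 : 0 <= B by rewrite !mulr_ge0 ?norm2_ge0 ?ltW.
have hB2 : B <= 5 / 4 * M by move: hB; rewrite -/B ler_distl => /andP[_]; nra.
have t1 : norm2 ((2 ^+ k1.+1 * 2 ^+ k2.+1 * l%:R) *: (L *m v))
   <= 25 / 4 * e * (M * norm2 h').
  have c0 : 0 <= e / l%:R * norm2 mk * norm2 mk'.
    by rewrite !mulr_ge0 ?norm2_ge0 // invr_ge0 ltW.
  have := backprop_error e0 H1 hk1 h0 h'0 c0 hv => h1.
  have s0 : 0 <= 2 ^+ k1.+1 * 2 ^+ k2.+1 * l%:R :> R.
    by rewrite !mulr_ge0 ?exprn_ge0.
  rewrite norm2Z_ge0 // !exprS -/L.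
  have -> : 2 * 2 ^+ k1 * (2 * 2 ^+ k2) * l%:R * norm2 (L *m v)
     = (4 * 2 ^+ k2 * l%:R) * (2 ^+ k1 * norm2 (L *m v)) by ring.
  apply: (@le_trans _ _ (4 * 2 ^+ k2 * l%:R *
     (5 / 4 * (e / l%:R * norm2 mk * norm2 mk') * norm2 h'))).
    by apply: ler_wpM2l => //; rewrite !mulr_ge0 ?exprn_ge0.
  have -> : 4 * 2 ^+ k2 * l%:R *
     (5 / 4 * (e / l%:R * norm2 mk * norm2 mk') * norm2 h')
     = 5 * e * norm2 h' * B by rewrite /B; field; rewrite gt_eqF.
  have -> : 25 / 4 * e * (M * norm2 h') = 5 * e * norm2 h' * (5 / 4 * M) by field.
  by apply: ler_wpM2l => //; rewrite !mulr_ge0.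
set kb := corr (cosv m m') k2.+1.
have hphi : `|relu_corr (cosv mk mk') - kb| <= 8 * (k2%:R * e).
  apply: le_trans (layers_corr e0 H2 hk2 m0 m'0).
  rewrite /kb corrS; apply: relu_corr_lip; first exact: cosv_range.
  by apply/corr_in/cosv_range.
have r := relu_corr_range (@cosv_range R _ mk mk'); rewrite -/(cosv mk mk') in r.
have f0 := relu_corr_ge0 (@cosv_range R _ mk mk'); rewrite -/(cosv mk mk') in f0.
have /andP[_ f1] := r.
have gE : g = B * relu_corr (cosv mk mk').
  by rewrite /g dotv_Qmx // /B exprS; field.
set ph := relu_corr _ in gE hphi f0 f1.
have g0 : 0 <= g by rewrite gE mulr_ge0.
have g1 : g <= 5 / 4 * M by rewrite gE; nra.
have gd : `|g - M * kb| <= 3 * b * M.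
  have -> : g - M * kb = (B - M) * ph + M * (ph - kb) by rewrite gE; ring.
  apply: le_trans (ler_normD _ _) _; rewrite [`|(B - M) * ph|]normrM
    [`|M * (ph - kb)|]normrM (gtr0_norm M0) (ger0_norm f0).
  have h1 : `|B - M| * ph <= 4 * (k2%:R * e) * M * 1 by apply: ler_pM.
  have h2 : M * `|ph - kb| <= M * (8 * (k2%:R * e)) by rewrite ler_wpM2l // ltW.
  have h3 : M * (12 * (k2%:R * e)) <= M * (3 * b) by rewrite ler_wpM2l ?(ltW M0) //; nra.
  by lra.
have hq : norm2 (q - backproj k1.+1 h h') <= 17 * (k1.+1%:R * b) * norm2 h'.
  have h1 := backprop_Q e0 H1 hb1' b0 b1 h0 h'0.
  have h2 := backprop_layers e0 H1 hb1' b0 b1 h0 h'0.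
  rewrite -natr1 mulrDl mul1r; move: h1; rewrite -/hk -/hk' -/L -/q => h1.
  have h3 : 0 <= b * norm2 h' by rewrite mulr_ge0.
  by lra.
have bp := backproj_norm k1.+1 h' h0.
set bpv := backproj k1.+1 h h' in hq bp.
have -> : (2 ^+ k1.+1 * 2 ^+ k2.+1 * l%:R) *: cross h h' m m'
   - alpha *: cross_mean k1 k2 h h' m m'
  = (2 ^+ k1.+1 * 2 ^+ k2.+1 * l%:R) *: (L *m v)
    + alpha *: (g *: (q - bpv) + (g - M * kb) *: bpv).
  rewrite cE /cross_mean -/bpv -/M -/kb; move: (_ *: (L *m v)) => Z.
  by apply/colP => i; rewrite !mxE; ring.
apply: le_trans (ler_norm2D _ _) _; rewrite [norm2 (alpha *: _)]norm2Z_ge0 //.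
have t2 : norm2 (g *: (q - bpv) + (g - M * kb) *: bpv)
   <= 85 / 4 * (k1.+1%:R * b) * (M * norm2 h') + 9 * b * (M * norm2 h').
  apply: le_trans (ler_norm2D _ _) _; rewrite !norm2Z (ger0_norm g0).
  have h1 : g * norm2 (q - bpv) <= (5 / 4 * M) * (17 * (k1.+1%:R * b) * norm2 h').
    by apply: ler_pM; rewrite ?norm2_ge0.
  have h2 : `|g - M * kb| * norm2 bpv <= 3 * b * M * (3 * norm2 h').
    by apply: ler_pM; rewrite ?norm2_ge0.
  by lra.
have MH : 0 <= M * norm2 h' by apply: mulr_ge0 => //; exact: ltW.
have t3 : alpha * norm2 (g *: (q - bpv) + (g - M * kb) *: bpv)
   <= 1 * norm2 (g *: (q - bpv) + (g - M * kb) *: bpv).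
  by rewrite ler_wpM2r ?norm2_ge0.
have kb1 : b <= k1.+1%:R * b by rewrite ler_peMl // ler1n.
move: t1 t2 t3 kb1; set E := M * norm2 h' in MH *; set K := k1.+1%:R * b.
move=> t1 t2 t3 kb1.
have t4 : (25 / 4 * e + 9 * b) * E <= (47 / 4 * K) * E.
  by rewrite ler_wpM2r //; nra.
by lra.
Qed.

End CrossTerm.

(** * Continuity of the mean field *)

Section Continuity.
Context {R : realType} {T : Type} {F : set_system T} {FF : Filter F}.

Lemma cvg_col n (f : T -> 'cV[R]_n) (v : 'cV[R]_n) :
  (forall i, f x i 0 @[x --> F] --> v i 0) -> f @ F --> v.
Proof.
move=> H t [P hP sub].
have : \forall x \near F, forall i, P i 0 (f x i 0).
  by apply: filter_forall => i; apply: H; exact: hP.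
by apply: filterS => x Px; apply: sub => i j; rewrite (ord1 j).
Qed.

Lemma cvg_coord n (f : T -> 'cV[R]_n) (v : 'cV[R]_n) i :
  f @ F --> v -> f x i 0 @[x --> F] --> v i 0.
Proof.
by move=> H; apply: (@continuous_cvg _ _ _ _ _ f (fun M : 'cV[R]_n => M i 0));
  [exact: coord_continuous | exact: H].
Qed.

Lemma cvg_sumr (I : finType) (f : I -> T -> R) (a : I -> R) :
    (forall i, f i @ F --> a i) ->
  \sum_i f i x @[x --> F] --> \sum_i a i.
Proof.
by move=> H; apply: cvg_big => // ; exact: add_continuous.
Qed.

Lemma cvg_dotv n (f g : T -> 'cV[R]_n) (v w : 'cV[R]_n) : f @ F --> v -> g @ F --> w ->
  dotv (f x) (g x) @[x --> F] --> dotv v w.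
Proof.
by move=> fv gw; apply: cvg_sumr => i; apply: cvgM; exact: cvg_coord.
Qed.

Lemma cvg_norm2 n (f : T -> 'cV[R]_n) (v : 'cV[R]_n) : f @ F --> v ->
  norm2 (f x) @[x --> F] --> norm2 v.
Proof.
move=> fv; have E z : norm2 z = Num.sqrt (dotv z z) :> R.
  by rewrite -norm2_sqr sqrtr_sqr ger0_norm // norm2_ge0.
rewrite E; under eq_fun do rewrite E.
apply: (@continuous_cvg _ _ _ _ _ (fun x => dotv (f x) (f x)) Num.sqrt).
  exact: sqrt_continuous.
exact: cvg_dotv.
Qed.

Lemma cvg_hadamard n (f g : T -> 'cV[R]_n) (v w : 'cV[R]_n) : f @ F --> v -> g @ F --> w ->
  hadamard (f x) (g x) @[x --> F] --> hadamard v w.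
Proof.
move=> fv gw; apply: cvg_col => i; rewrite mxE; under eq_fun do rewrite mxE.
by apply: cvgM; exact: cvg_coord.
Qed.

Lemma cvg_cosv n (f g : T -> 'cV[R]_n) (v w : 'cV[R]_n) : v != 0 -> w != 0 ->
  f @ F --> v -> g @ F --> w -> cosv (f x) (g x) @[x --> F] --> cosv v w.
Proof.
move=> v0 w0 fv gw; apply: cvgM; first exact: cvg_dotv.
apply: cvgV; first by rewrite mulf_neq0 // norm2_neq0.
by apply: cvgM; exact: cvg_norm2.
Qed.

Lemma cvg_acos (f : T -> R) (k : R) : (forall x, corr_range (f x)) -> corr_range k ->
  f @ F --> k -> acos (f x) @[x --> F] --> acos k.
Proof.
move=> fr kr fk.
apply/cvgrPdist_le => e e0.
have e1 : 0 < e ^+ 2 / 8 by rewrite divr_gt0 // exprn_gt0.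
move/cvgrPdist_le : fk => /(_ _ e1); apply: filterS => x hx.
rewrite -(@ler_pXn2r _ 2) ?nnegrE ?normr_ge0 ?(ltW e0) //.
rewrite real_normK ?num_real //; apply: le_trans (acos_dist_sqr kr (fr x)) _.
by move: hx; lra.
Qed.

Lemma cvg_pass_coef (f : T -> R) (k : R) : (forall x, corr_range (f x)) ->
  corr_range k -> f @ F --> k -> pass_coef (f x) @[x --> F] --> pass_coef k.
Proof.
move=> fr kr fk; apply: cvgM; last exact: cvg_cst.
by apply: cvgB; [exact: cvg_cst | exact: cvg_acos].
Qed.

Lemma cvg_mix_coef (f : T -> R) (k : R) :
  f @ F --> k -> mix_coef (f x) @[x --> F] --> mix_coef k.
Proof.
move=> fk; apply: cvgM; last exact: cvg_cst.
apply: (@continuous_cvg _ _ _ _ _ (fun x => 1 - f x ^+ 2) Num.sqrt).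
  exact: sqrt_continuous.
apply: cvgB; first exact: cvg_cst.
by under eq_fun do rewrite expr2; rewrite expr2; apply: cvgM.
Qed.

Lemma cvg_corr (f : T -> R) (k : R) i : (forall x, corr_range (f x)) ->
  corr_range k -> f @ F --> k -> corr (f x) i @[x --> F] --> corr k i.
Proof.
move=> fr kr fk; elim: i => [//|i IH].
have fr' x : corr_range (corr (f x) i) by exact: corr_in.
apply: cvgD; last exact: cvg_mix_coef.
by apply: cvgM => //; apply: cvg_pass_coef => //; exact: corr_in.
Qed.

Lemma cvg_xi (f : T -> R) (k : R) i : (forall x, corr_range (f x)) ->
  corr_range k -> f @ F --> k -> xi (f x) i @[x --> F] --> xi k i.
Proof.
move=> fr kr fk; elim: i => [|i IH]; first exact: cvg_cst.
apply: cvgM => //; apply: cvg_pass_coef; last exact: cvg_corr.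
  by move=> x; exact: corr_in.
exact: corr_in.
Qed.

Lemma cvg_zeta (f : T -> R) (k : R) i : (forall x, corr_range (f x)) ->
  corr_range k -> f @ F --> k -> zeta (f x) i @[x --> F] --> zeta k i.
Proof.
move=> fr kr fk; elim: i => [|i IH]; first exact: cvg_cst.
apply: cvgD; last by apply: cvg_mix_coef; exact: cvg_corr.
apply: cvgM => //; apply: cvg_pass_coef; last exact: cvg_corr.
  by move=> x; exact: corr_in.
exact: corr_in.
Qed.

Lemma backproj0 n k (x : 'cV[R]_n) : backproj k x 0 = 0.
Proof. by rewrite /backproj norm2_0 scaler0 add0r mul0r mulr0 scale0r. Qed.

Lemma cvg_backproj n k (f : T -> 'cV[R]_n) (v y : 'cV[R]_n) : v != 0 -> f @ F --> v ->
  backproj k (f x) y @[x --> F] --> backproj k v y.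
Proof.
move=> v0 fv; have [->|y0] := eqVneq y 0.
  by rewrite backproj0; under eq_fun do rewrite backproj0; exact: cvg_cst.
have c : cosv (f x) y @[x --> F] --> cosv v y.
  by apply: cvg_cosv => //; exact: cvg_cst.
have fr x : corr_range (cosv (f x) y) by exact: cosv_range.
have kr : corr_range (cosv v y) by exact: cosv_range.
apply: cvgD.
  by apply: cvgZ; [exact: cvg_xi | exact: cvg_cst].
apply: cvgZ => //; apply: cvgM; first exact: cvg_zeta.
apply: cvgM; first exact: cvg_cst.
by apply: cvgV; [exact: norm2_neq0 | exact: cvg_norm2].
Qed.

Lemma cvg_cross_mean n p k1 k2 (fh : T -> 'cV[R]_n) (fm : T -> 'cV[R]_p)
    (h h' : 'cV[R]_n) (m m' : 'cV[R]_p) : h != 0 -> m != 0 -> fh @ F --> h -> fm @ F --> m ->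
  cross_mean k1 k2 (fh x) h' (fm x) m' @[x --> F]
    --> cross_mean k1 k2 h h' m m'.
Proof.
move=> h0 m0 hh mm; apply: cvgZ; last exact: cvg_backproj.
have [->|m'0] := eqVneq m' 0.
  rewrite norm2_0 mulr0 mul0r; under eq_fun do rewrite mulr0 mul0r.
  exact: cvg_cst.
apply: cvgM.
  by apply: cvgM; [exact: cvg_norm2 | exact: cvg_cst].
apply: cvg_corr; [by move=> x; exact: cosv_range | exact: cosv_range |].
by apply: cvg_cosv => //; exact: cvg_cst.
Qed.

End Continuity.

(** * Networks along rays *)

Section Germs.
Context {R : realType}.

Lemma colDZE n (x y : 'cV[R]_n) (a : R) i : (x + a *: y) i 0 = x i 0 + a * y i 0.
Proof. by rewrite !mxE. Qed.

Lemma near_pos (u c : R) : 0 < u -> \forall t \near 0^'+, 0 < u + t * c.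
Proof.
move=> u0; have c1 : 0 < `|c| + 1 by rewrite ltr_wpDl.
near=> t.
have t0 : 0 < t by near: t; exact: nbhs_right_gt.
have : t < u / (`|c| + 1).
  by near: t; apply: nbhs_right_lt; rewrite divr_gt0.
rewrite ltr_pdivlMr // => h.
have := ler_norm (- c); rewrite normrN => hc.
have : t * - c <= t * `|c| by rewrite ler_pM2l.
by lra.
Unshelve. all: by end_near. Qed.

(** The sign of a + delta b + t c when t is infinitesimal compared with delta,
    itself infinitesimal. *)
Definition lexpos (a b c : R) : bool :=
  (0 < a) || ((a == 0) && ((0 < b) || ((b == 0) && (0 < c)))).

Lemma lexpos_near (a b c : R) : \forall delta \near 0^'+,
  Num.max (a + delta * b) 0 = (lexpos a b c)%:R * (a + delta * b) /\
  \forall t \near 0^'+, (0 < a + delta * b + t * c) = lexpos a b c.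
Proof.
rewrite /lexpos; case: (ltrgtP 0 a) => [a0|a0|<-].
- near=> delta; have d0 : 0 < a + delta * b by near: delta; exact: near_pos.
  rewrite /= mul1r max_l ?ltW //; split=> //.
  by near=> t; near: t; exact: near_pos.
- near=> delta.
  have d0 : 0 < - a + delta * - b by near: delta; apply: near_pos; lra.
  rewrite /= mul0r max_r; last lra; split=> //.
  near=> t; apply/negbTE; rewrite -leNgt.
  suff : 0 < - (a + delta * b) + t * - c by lra.
  by near: t; apply: near_pos; lra.
- case: (ltrgtP 0 b) => [b0|b0|<-] /=.
  + near=> delta; have d0 : 0 < delta by near: delta; exact: nbhs_right_gt.
    rewrite add0r mul1r max_l ?mulr_ge0 ?ltW //; split=> //.
    by near=> t; near: t; apply: near_pos; exact: mulr_gt0.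
  + near=> delta; have d0 : 0 < delta by near: delta; exact: nbhs_right_gt.
    have db : 0 < - (delta * b) by rewrite -mulrN mulr_gt0 //; lra.
    rewrite add0r mul0r max_r; last lra; split=> //.
    near=> t; apply/negbTE; rewrite -leNgt.
    suff : 0 < - (delta * b) + t * - c by lra.
    by near: t; exact: near_pos.
  + near=> delta; rewrite mulr0 addr0 mulr0 maxxx; split=> //.
    near=> t; have t0 : 0 < t by near: t; exact: nbhs_right_gt.
    by rewrite add0r pmulr_rgt0.
Unshelve. all: by end_near. Qed.

Definition lex_mx {q : nat} (A B C : 'cV[R]_q) : 'M[R]_q :=
  diag_mx (\row_i (lexpos (A i 0) (B i 0) (C i 0))%:R).

(** Each preactivation is affine in delta and t, so its sign is eventually the
    lexicographic sign of its three coefficients: the pattern is constant. *)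
Lemma layer_germ {q k : nat} (W : 'M[R]_(q, k)) (X Y Z : 'cV[R]_k) :
  let D := lex_mx (W *m X) (W *m Y) (W *m Z) in
  \forall delta \near 0^'+,
    relu (W *m (X + delta *: Y)) = D *m W *m X + delta *: (D *m W *m Y) /\
    \forall t \near 0^'+, Wplus W (X + delta *: Y + t *: Z) = D *m W.
Proof.
move=> D.
have : \forall delta \near 0^'+, forall i : 'I_q, let a := (W *m X) i 0 in
    let b := (W *m Y) i 0 in let c := (W *m Z) i 0 in
    Num.max (a + delta * b) 0 = (lexpos a b c)%:R * (a + delta * b) /\
    \forall t \near 0^'+, (0 < a + delta * b + t * c) = lexpos a b c.
  by apply: filter_forall => i; exact: lexpos_near.
apply: filterS => delta H; split.
  rewrite -!mulmxA scalemxAr -mulmxDr /D /lex_mx mul_diag_mx.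
  apply/colP => i; have [h _] := H i.
  have e : (W *m (X + delta *: Y)) i 0 = (W *m X) i 0 + delta * (W *m Y) i 0.
    by rewrite mulmxDr -scalemxAr colDZE.
  rewrite /relu mxE e h [RHS]mxE; congr (_ * _); first by rewrite [RHS]mxE.
  by rewrite colDZE.
have : \forall t \near 0^'+, forall i : 'I_q,
    (0 < (W *m X) i 0 + delta * (W *m Y) i 0 + t * (W *m Z) i 0)
     = lexpos ((W *m X) i 0) ((W *m Y) i 0) ((W *m Z) i 0).
  by apply: filter_forall => i; have [] := H i.
apply: filterS => t Ht; rewrite /Wplus /D /lex_mx; congr (diag_mx _ *m W).
apply/rowP => i; rewrite [LHS]mxE [RHS]mxE -Ht.
by rewrite !mulmxDr -!scalemxAr !colDZE.
Qed.

(** J is meant to be the network frozen at a point; that Z is the image of g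
    under it at points of the family, not at x, lets the weight conditions
    bound one-sided derivatives. The scale delta serves the limits of gradients
    along w, the scale t the derivatives at the points of that ray. *)
Definition affine_germ {n q : nat} (G : 'cV[R]_n -> 'cV[R]_q)
    (J : 'cV[R]_n -> 'M[R]_(q, n)) (x w g : 'cV[R]_n) (X Y Z : 'cV[R]_q) : Prop :=
  \forall delta \near 0^'+, G (x + delta *: w) = X + delta *: Y /\
    \forall t \near 0^'+, G (x + delta *: w + t *: g) = X + delta *: Y + t *: Z
      /\ J (x + delta *: w + t *: g) *m g = Z.

Lemma germ_relu_layer {n k q : nat} (V : 'M[R]_(q, k)) G
    (J : 'cV[R]_n -> 'M[R]_(k, n)) x w g X Y Z :
    affine_germ G J x w g X Y Z ->
  exists X' Y' Z', affine_germ (fun z => relu (V *m G z))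
    (fun z => Wplus V (G z) *m J z) x w g X' Y' Z'.
Proof.
move=> H; set D := lex_mx (V *m X) (V *m Y) (V *m Z).
exists (D *m V *m X), (D *m V *m Y), (D *m V *m Z).
have := layer_germ V X Y Z; rewrite -/D => HD.
near=> delta.
have [h1 h2] : relu (V *m (X + delta *: Y)) = D *m V *m X + delta *: (D *m V *m Y) /\
    \forall t \near 0^'+, Wplus V (X + delta *: Y + t *: Z) = D *m V.
  by near: delta.
have [h3 h4] : G (x + delta *: w) = X + delta *: Y /\
    \forall t \near 0^'+, G (x + delta *: w + t *: g) = X + delta *: Y + t *: Z
      /\ J (x + delta *: w + t *: g) *m g = Z by near: delta.
split; first by rewrite h3.
near=> t.
have h5 : Wplus V (X + delta *: Y + t *: Z) = D *m V by near: t.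
have [h6 h7] : G (x + delta *: w + t *: g) = X + delta *: Y + t *: Z
      /\ J (x + delta *: w + t *: g) *m g = Z by near: t.
rewrite h6 relu_mulmx h5 -[in X in _ /\ X]mulmxA h7; split=> //.
by rewrite !mulmxDr -!scalemxAr.
Unshelve. all: by end_near. Qed.

Lemma layers_germ (N : nat -> nat) (W : forall i, 'M[R]_(N i.+1, N i)) k x w g :
  exists X Y Z, affine_germ (layers W k) (layers_mx W k) x w g X Y Z.
Proof.
elim: k => [|k [X [Y [Z IH]]]].
  exists x, w, g; near=> delta; split=> //; near=> t; split=> //.
  by rewrite /= mul1mx.
by have := germ_relu_layer (W k) IH.
Unshelve. all: by end_near. Qed.

Lemma network_germ (N : nat -> nat) (W : forall i, 'M[R]_(N i.+1, N i)) k l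
    (V : 'M[R]_(l, N k)) x w g :
  exists X Y Z, affine_germ (network W V) (network_mx W V) x w g X Y Z.
Proof.
have [X [Y [Z H]]] := layers_germ W k x w g.
exact: (germ_relu_layer V H).
Qed.

Lemma network_ray (N : nat -> nat) (W : forall i, 'M[R]_(N i.+1, N i)) k l
    (V : 'M[R]_(l, N k)) x g :
  exists Z, \forall t \near 0^'+,
    network W V (x + t *: g) = network W V x + t *: Z /\
    network_mx W V (x + t *: g) *m g = Z.
Proof.
have [X [Y [Z H]]] := network_germ W V x 0 g.
have [delta [h1 h2]] := filter_ex H; exists Z.
by move: h1 h2; rewrite scaler0 addr0 => <-.
Qed.

Lemma dir_quotient_cvg (n p l : nat) (G1 : 'cV[R]_n -> 'cV[R]_l)
    (G2 : 'cV[R]_p -> 'cV[R]_l) h0 m0 (u g : 'cV[R]_n * 'cV[R]_p) Z1 Z2 :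
    (\forall t \near 0^'+, G1 (u.1 + t *: g.1) = G1 u.1 + t *: Z1) ->
    (\forall t \near 0^'+, G2 (u.2 + t *: g.2) = G2 u.2 + t *: Z2) ->
  dir_quotient (objective G1 G2 h0 m0) u g @ 0^'+ -->
    dotv (hadamard (G1 u.1) (G2 u.2) - hadamard (G1 h0) (G2 m0))
         (hadamard Z1 (G2 u.2) + hadamard (G1 u.1) Z2).
Proof.
move=> H1 H2; set A := G1 u.1; set B := G2 u.2.
set y0 := hadamard (G1 h0) (G2 m0).
pose r i := A i 0 * B i 0 - y0 i 0.
pose P i := Z1 i 0 * B i 0 + A i 0 * Z2 i 0.
pose Q i := Z1 i 0 * Z2 i 0.
pose q i (t : R) := r i * P i + t * (r i * Q i + 2^-1 * (P i + t * Q i) ^+ 2).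
have E : {near 0^'+, (fun t => \sum_i q i t) =1
    dir_quotient (objective G1 G2 h0 m0) u g}.
  near=> t; have t0 : t != 0.
    by rewrite gt_eqF //; near: t; exact: nbhs_right_gt.
  have e1 : G1 (u.1 + t *: g.1) = A + t *: Z1 by near: t.
  have e2 : G2 (u.2 + t *: g.2) = B + t *: Z2 by near: t.
  rewrite /dir_quotient /objective /= e1 e2 -/A -/B -/y0 !norm2_sqr /dotv.
  rewrite !mulr_sumr -sumrB mulr_suml; apply: eq_bigr => i _.
  rewrite !mxE /q /r /P /Q.
  by rewrite (_ : y0 i 0 = G1 h0 i 0 * G2 m0 i 0) ?mxE //; field.
apply: cvg_trans (near_eq_cvg E) _.
have -> : dotv (hadamard A B - y0) (hadamard Z1 B + hadamard A Z2)
    = \sum_i (r i * P i).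
  by apply: eq_bigr => i _; rewrite /r /P !mxE.
apply: cvg_sumr => i.
have -> : r i * P i = r i * P i + 0 * (r i * Q i + 2^-1 * (P i + 0 * Q i) ^+ 2).
  by rewrite mul0r addr0.
have ct : (t : R) @[t --> 0^'+] --> (0 : R) by apply: cvg_at_right_filter; exact: cvg_id.
have cc (c : R) : c @[t --> (0 : R)^'+] --> c by exact: cvg_cst.
have cs : P i + t * Q i @[t --> 0^'+] --> P i + 0 * Q i.
  by apply: cvgD; [exact: cc | apply: cvgM; [exact: ct | exact: cc]].
rewrite /q; apply: cvgD; first exact: cc.
apply: cvgM; first exact: ct.
apply: cvgD; first exact: cc.
apply: cvgM; first exact: cc.
under eq_fun do rewrite expr2.
by rewrite expr2; apply: cvgM; exact: cs.
Unshelve. all: by end_near. Qed.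

End Germs.

(** * Directional derivatives and gradients *)

Section DirectionalDerivative.
Context {R : realType} {n p : nat}.
Implicit Types (f : 'cV[R]_n * 'cV[R]_p -> R) (u v w : 'cV[R]_n * 'cV[R]_p).

Lemma dir_quotient_derive f u v : differentiable f u ->
  dir_quotient f u v @ 0^'+ --> 'D_v f u.
Proof.
move=> df.
have E : dir_quotient f u v
    = (fun h : R => h^-1 *: ((f \o shift u) (h *: v) - f u)).
  by apply/funext => t; rewrite /dir_quotient /= [t *: v + u]addrC mulrC.
rewrite E; apply: cvg_dnbhs_at_right; exact: diff_derivable.
Qed.

Lemma dir_deriveE f u v (D : R) : dir_quotient f u v @ 0^'+ --> D ->
  dir_derivable f u v /\ dir_derive f u v = D.
Proof.
move=> H; split; first by apply/cvg_ex; exists D.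
by apply/cvg_lim.
Qed.

Lemma derive_grad_h f u (x : 'cV[R]_n) : differentiable f u ->
  'D_((x, 0 : 'cV[R]_p)) f u = dotv (grad_h f u) x.
Proof.
move=> df; rewrite deriveE //.
have -> : (x, 0 : 'cV[R]_p) = \sum_i x i 0 *: (delta_mx i 0 : 'cV[R]_n, 0 : 'cV[R]_p).
  rewrite [RHS]surjective_pairing !raddf_sum /=; congr (_, _).
    rewrite {1}(matrix_sum_delta x); apply: eq_bigr => i _.
    by rewrite big_ord1.
  by rewrite big1 // => i _; rewrite scaler0.
rewrite linear_sum; apply: eq_bigr => i _.
by rewrite linearZ /= -deriveE // mxE mulrC.
Qed.

End DirectionalDerivative.

Section Swap.
Context {R : realType} {n p : nat}.
Implicit Types (f : 'cV[R]_n * 'cV[R]_p -> R) (u v w : 'cV[R]_n * 'cV[R]_p).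

Definition swap {A B : Type} (u : A * B) : B * A := (u.2, u.1).

Lemma grad_m_swap f (f' : 'cV[R]_p * 'cV[R]_n -> R) u :
  (forall v, f v = f' (swap v)) -> grad_m f u = grad_h f' (swap u).
Proof.
move=> ff; apply/colP => i; rewrite !mxE /derive.
set v := (0, _); set v' := (_, 0).
suff -> : (fun h : R => h^-1 *: ((f \o shift u) (h *: v) - f u))
    = (fun h : R => h^-1 *: ((f' \o shift (swap u)) (h *: v') - f' (swap u))).
  by [].
by apply/funext => h; rewrite /= !ff.
Qed.

Lemma dir_quotient_swap f (f' : 'cV[R]_p * 'cV[R]_n -> R) u v :
    (forall v, f v = f' (swap v)) ->
  dir_quotient f u v = dir_quotient f' (swap u) (swap v).
Proof.
by move=> ff; apply/funext => t; rewrite /dir_quotient !ff.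
Qed.

Lemma differentiable_swap f (f' : 'cV[R]_p * 'cV[R]_n -> R) u :
    (forall v, f v = f' (swap v)) -> differentiable f u ->
  differentiable f' (swap u).
Proof.
move=> ff df.
have -> : f' = f \o swap by apply/funext => -[a b]; rewrite /= ff.
apply: differentiable_comp; last by case: u df.
apply: differentiable_pair; apply: linear_differentiable => z.
  exact: cvg_snd.
exact: cvg_fst.
Qed.

End Swap.

(** * The gradient of the objective *)

Lemma descent_scalar (R : realFieldType) (c a z b q D s : R) :
  0 < c -> 0 <= a -> 0 <= z -> `|c * D - - q| <= s * a -> z <= s ->
  3 * s < b -> b <= c * a + z -> `|c * a ^+ 2 - q| <= z * a -> D < 0.
Proof.
move=> c0 a0 z0 H hg big gM dM.
have a1 : 2 * s < c * a by lra.
have ap : 0 < a.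
  have s0 : 0 <= s by exact: le_trans hg.
  rewrite lt_neqAle a0 andbT eq_sym; apply/eqP => aE; move: a1; rewrite aE mulr0; lra.
move: H dM; rewrite !ler_norml => /andP[_ H] /andP[_ dM].
have h2 : z * a <= s * a by rewrite ler_pM2r.
have h3 : 2 * s * a < c * a * a by rewrite ltr_pM2r.
have : c * D < 0 by move: dM; rewrite expr2; lra.
by rewrite pmulr_rlt0.
Qed.

Section GradientOfObjective.
Context {R : realType}.
Variables (N P : nat -> nat).
Variables (W1 : forall i, 'M[R]_(N i.+1, N i)) (W2 : forall i, 'M[R]_(P i.+1, P i)).
Variables (k1 k2 l : nat) (V1 : 'M[R]_(l, N k1)) (V2 : 'M[R]_(l, P k2)).
Variables (h0 : 'cV[R]_(N 0%N)) (m0 : 'cV[R]_(P 0%N)).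

Let G1 := network W1 V1.
Let G2 := network W2 V2.
Let f := objective G1 G2 h0 m0.
Let y0 := hadamard (G1 h0) (G2 m0).
Let C := cross W1 W2 V1 V2.

Definition mean_grad (h : 'cV[R]_(N 0%N)) (m : 'cV[R]_(P 0%N)) :=
  norm2 m ^+ 2 *: h - cross_mean k1 k2 h h0 m m0.

Definition mean_scale (h : 'cV[R]_(N 0%N)) (m : 'cV[R]_(P 0%N)) : R :=
  norm2 m * (norm2 m * norm2 h + norm2 m0 * norm2 h0).

Variables (c alpha E : R).
Hypothesis cross_mean_close : forall h h' m m', h != 0 -> m != 0 ->
  norm2 (c *: C h h' m m' - alpha *: cross_mean k1 k2 h h' m m')
    <= E * (norm2 m * norm2 m' * norm2 h').

Lemma cross_dotv h m x :
  dotv (C h h m m - C h h0 m m0) x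
  = dotv (hadamard (G1 h) (G2 m) - y0)
      (hadamard (network_mx W1 V1 h *m x) (G2 m)).
Proof.
rewrite /C /cross -mulmxBr -[X in dotv (X *m _)]trmxK trmxK.
rewrite -{1}[network_mx W1 V1 h]trmxK -dotv_mulmx trmxK.
by apply: eq_bigr => i _; rewrite /y0 /G1 /G2 !mxE; ring.
Qed.

Lemma cross_grad_close h m x : h != 0 -> m != 0 ->
  `|c * dotv (C h h m m - C h h0 m m0) x - alpha * dotv (mean_grad h m) x|
    <= E * mean_scale h m * norm2 x.
Proof.
move=> hn0 mn0.
rewrite -dotvZl -dotvZl -dotvBl; apply: le_trans (dotv_le _ _) _.
apply: ler_wpM2r; first exact: norm2_ge0.
have -> : c *: (C h h m m - C h h0 m m0) - alpha *: mean_grad h m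
  = (c *: C h h m m - alpha *: cross_mean k1 k2 h h m m)
    - (c *: C h h0 m m0 - alpha *: cross_mean k1 k2 h h0 m m0).
  rewrite cross_mean_diag // /mean_grad.
  by move: (cross_mean _ _ _ _ _ _) => Z; apply/colP => i; rewrite !mxE; ring.
apply: le_trans (ler_norm2D _ _) _; rewrite norm2N.
apply: le_trans (lerD (cross_mean_close h m hn0 mn0)
  (cross_mean_close h0 m0 hn0 mn0)) _.
by rewrite le_eqVlt; apply/orP; left; apply/eqP; rewrite /mean_scale; ring.
Qed.

Lemma near_neq0 n (h x : 'cV[R]_n) : h != 0 ->
  \forall t \near 0^'+, h + t *: x != 0.
Proof.
move=> hn0; near=> t; have t0 : 0 < t by near: t; exact: nbhs_right_gt.
have : 0 < norm2 h + t * - norm2 x by near: t; apply: near_pos; exact: norm2_gt0.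
move=> hp; rewrite -norm2_eq0 gt_eqF //.
have := ler_norm2_dist h (h + t *: x).
rewrite opprD addNKr norm2N norm2Z_ge0 ?(ltW t0) //.
by lra.
Unshelve. all: by end_near. Qed.

Lemma cvg_ray n (h x : 'cV[R]_n) : h + t *: x @[t --> 0^'+] --> h.
Proof.
apply: cvg_col => i; under eq_fun do rewrite colDZE.
suff : h i 0 + t * x i 0 @[t --> 0^'+] --> h i 0 + 0 * x i 0.
  by rewrite mul0r addr0.
apply: cvgD; first exact: cvg_cst.
apply: cvgM; last exact: cvg_cst.
by apply: cvg_at_right_filter; exact: cvg_id.
Qed.

Lemma cvg_mean_grad T (F : set_system T) {FF : Filter F}
    (fh : T -> 'cV[R]_(N 0%N)) (fm : T -> 'cV[R]_(P 0%N))
    (h : 'cV[R]_(N 0%N)) (m : 'cV[R]_(P 0%N)) :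
    h != 0 -> m != 0 -> fh @ F --> h -> fm @ F --> m ->
  mean_grad (fh x) (fm x) @[x --> F] --> mean_grad h m.
Proof.
move=> hn0 mn0 hh mm; apply: cvgB; last exact: cvg_cross_mean.
by apply: cvgZ => //; apply: cvgM; exact: cvg_norm2.
Qed.

Lemma cvg_mean_scale T (F : set_system T) {FF : Filter F}
    (fh : T -> 'cV[R]_(N 0%N)) (fm : T -> 'cV[R]_(P 0%N))
    (h : 'cV[R]_(N 0%N)) (m : 'cV[R]_(P 0%N)) :
    fh @ F --> h -> fm @ F --> m ->
  mean_scale (fh x) (fm x) @[x --> F] --> mean_scale h m.
Proof.
move=> hh mm; apply: cvgM; first exact: cvg_norm2.
apply: cvgD; last exact: cvg_cst.
by apply: cvgM; exact: cvg_norm2.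
Qed.

(** The activation patterns at u and just after u along the ray may differ, and
    the one-sided derivative sees the latter: the bound at u is the limit of the
    bounds along the ray. *)
Lemma dir_derivative_close u x : u.1 != 0 -> u.2 != 0 ->
  exists D : R, dir_quotient f u (x, 0) @ 0^'+ --> D /\
    `|c * D - alpha * dotv (mean_grad u.1 u.2) x|
      <= E * mean_scale u.1 u.2 * norm2 x.
Proof.
case: u => h m /= hn0 mn0.
have [Z HZ] := network_ray W1 V1 h x.
have H1 : \forall t \near 0^'+, G1 (h + t *: x) = G1 h + t *: Z.
  by apply: filterS HZ => t [].
have H2 : \forall t \near 0^'+, G2 (m + t *: 0) = G2 m + t *: 0.
  by near=> t; rewrite !scaler0 !addr0.
pose D t := dotv (hadamard (G1 h + t *: Z) (G2 m) - y0) (hadamard Z (G2 m)).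
have DD : D t @[t --> 0^'+] --> D 0.
  apply: cvg_dotv; last exact: cvg_cst.
  apply: cvgB; last exact: cvg_cst.
  apply: cvg_hadamard; last exact: cvg_cst.
  by rewrite scale0r addr0; exact: cvg_ray.
exists (D 0); split.
  have := @dir_quotient_cvg R _ _ _ G1 G2 h0 m0 (h, m) (x, 0) Z 0 H1 H2.
  by rewrite /D scale0r addr0 /= hadamard0 addr0.
have cD : `|c * D t - alpha * dotv (mean_grad (h + t *: x) m) x| @[t --> 0^'+]
   --> `|c * D 0 - alpha * dotv (mean_grad h m) x|.
  apply: cvg_norm; apply: cvgB; first by apply: cvgM => //; exact: cvg_cst.
  apply: cvgM; first exact: cvg_cst.
  apply: cvg_dotv; last exact: cvg_cst.
  by apply: cvg_mean_grad => //; [exact: cvg_ray | exact: cvg_cst].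
have cE : E * mean_scale (h + t *: x) m * norm2 x @[t --> 0^'+]
   --> E * mean_scale h m * norm2 x.
  apply: cvgM; last exact: cvg_cst.
  apply: cvgM; first exact: cvg_cst.
  by apply: cvg_mean_scale; [exact: cvg_ray | exact: cvg_cst].
apply: (ler_cvg_to cD cE); near=> t.
have hn : h + t *: x != 0 by near: t; exact: near_neq0.
have [e1 e2] : network W1 V1 (h + t *: x) = network W1 V1 h + t *: Z /\
    network_mx W1 V1 (h + t *: x) *m x = Z by near: t.
have := cross_grad_close x hn mn0; rewrite cross_dotv e2.
by rewrite {1}/G1 e1.
Unshelve. all: by end_near. Qed.

(** Differentiability makes all directional bounds about one vector, so testing
    against the deviation itself bounds its norm with no loss in the
    dimension. *)
Lemma grad_close u : u.1 != 0 -> u.2 != 0 -> differentiable f u ->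
  norm2 (c *: grad_h f u - alpha *: mean_grad u.1 u.2)
    <= E * mean_scale u.1 u.2.
Proof.
move=> hn0 mn0 df; set z := _ - _.
have [D [HD]] := dir_derivative_close z hn0 mn0.
have -> : D = dotv (grad_h f u) z.
  rewrite -derive_grad_h //; apply: (cvg_unique _ HD).
    exact: norm_hausdorff.
  exact: dir_quotient_derive.
rewrite -dotvZl -dotvZl -dotvBl -/z => H.
have [->|z0] := eqVneq z 0.
  have := @cross_mean_close u.1 u.1 u.2 u.2 hn0 mn0.
  have := @cross_mean_close u.1 h0 u.2 m0 hn0 mn0.
  rewrite norm2_0 => /(le_trans (norm2_ge0 _)) a /(le_trans (norm2_ge0 _)) b.
  by rewrite /mean_scale; lra.
move: (le_trans (ler_norm _) H); rewrite -norm2_sqr expr2 ler_pM2r //.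
exact: norm2_gt0.
Qed.

Lemma grad_h_cvg u w : admissible_shift f u w ->
  cvg (grad_h f (u + delta *: w) @[delta --> 0^'+]).
Proof.
move=> adm.
have [X2 [Y2 [Z2 H2]]] := network_germ W2 V2 u.2 w.2 0.
suff L i : cvg (grad_h f (u + delta *: w) i 0 @[delta --> 0^'+]).
  apply/cvg_ex; exists (\col_i lim (grad_h f (u + delta *: w) i 0 @[delta --> 0^'+])).
  by apply: cvg_col => i; rewrite mxE; exact: L.
have [X1 [Y1 [Z1 H1]]] := network_germ W1 V1 u.1 w.1 (delta_mx i 0).
pose A delta : 'cV[R]_l := X1 + delta *: Y1.
pose B delta : 'cV[R]_l := X2 + delta *: Y2.
pose D delta := dotv (hadamard (A delta) (B delta) - y0) (hadamard Z1 (B delta)).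
have DD : D delta @[delta --> 0^'+] -->
    dotv (hadamard X1 X2 - y0) (hadamard Z1 X2).
  apply: cvg_dotv.
    apply: cvgB; last exact: cvg_cst.
    by apply: cvg_hadamard; exact: cvg_ray.
  by apply: cvg_hadamard; [exact: cvg_cst | exact: cvg_ray].
apply/cvg_ex; eexists; apply: cvg_trans DD; apply: near_eq_cvg.
near=> delta; rewrite mxE.
have df : differentiable f (u + delta *: w) by near: delta.
have [e1 n1] : G1 (u.1 + delta *: w.1) = A delta /\ \forall t \near 0^'+,
    G1 (u.1 + delta *: w.1 + t *: delta_mx i 0) = A delta + t *: Z1
      /\ network_mx W1 V1 (u.1 + delta *: w.1 + t *: delta_mx i 0)
         *m delta_mx i 0 = Z1 by near: delta.
have e2 : G2 (u.2 + delta *: w.2) = B delta.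
  have : G2 (u.2 + delta *: w.2) = B delta /\ \forall t \near 0^'+,
    G2 (u.2 + delta *: w.2 + t *: 0) = B delta + t *: Z2
      /\ network_mx W2 V2 (u.2 + delta *: w.2 + t *: 0) *m 0 = Z2 by near: delta.
  by case.
have HD := @dir_quotient_derive _ _ _ _ _ (delta_mx i 0, 0) df.
apply: (cvg_unique _ _ HD); first exact: norm_hausdorff.
have := @dir_quotient_cvg R _ _ _ G1 G2 h0 m0 (u + delta *: w) (delta_mx i 0, 0) Z1 0.
rewrite /= e1 e2 hadamard0 addr0; apply.
  by apply: filterS n1 => t [].
by near=> t; rewrite !scaler0 !addr0.
Unshelve. all: by end_near. Qed.

Lemma lim_grad_close u w : u.1 != 0 -> u.2 != 0 -> admissible_shift f u w ->
  norm2 (c *: lim (grad_h f (u + delta *: w) @[delta --> 0^'+])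
         - alpha *: mean_grad u.1 u.2) <= E * mean_scale u.1 u.2.
Proof.
move=> hn0 mn0 adm; have cG := grad_h_cvg adm.
apply: (@ler_cvg_to _ (0 : R)^'+ _ _
  (fun delta => norm2 (c *: grad_h f (u + delta *: w)
      - alpha *: mean_grad (u + delta *: w).1 (u + delta *: w).2))
  (fun delta => E * mean_scale (u + delta *: w).1 (u + delta *: w).2)).
- apply: cvg_norm2; apply: cvgB; first by apply: cvgZ => //; exact: cvg_cst.
  apply: cvgZ; first exact: cvg_cst.
  by apply: cvg_mean_grad => //; exact: cvg_ray.
- apply: cvgM; first exact: cvg_cst.
  by apply: cvg_mean_scale; exact: cvg_ray.
near=> delta.
have a1 : (u + delta *: w).1 != 0 by near: delta; exact: near_neq0.
have a2 : (u + delta *: w).2 != 0 by near: delta; exact: near_neq0.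
have df : differentiable f (u + delta *: w) by near: delta.
have H := grad_close a1 a2 df. exact: H.
Unshelve. all: by end_near. Qed.

(** The limiting gradient and the one-sided derivatives are each within the
    slack of the same mean field, hence the factor 3. *)
Lemma descent_h u w : 0 < c -> u.1 != 0 -> u.2 != 0 -> admissible_shift f u w ->
    3 * (E * mean_scale u.1 u.2) < norm2 (alpha *: mean_grad u.1 u.2) ->
  dir_derivable f u (- g1_dir f u w) /\ dir_derive f u (- g1_dir f u w) < 0.
Proof.
move=> c0 hn0 mn0 adm big.
have := lim_grad_close hn0 mn0 adm; rewrite /g1_dir.
set g := lim _; set M := alpha *: _ in big *; set s := E * _ in big * => hg.
have -> : - (g, 0 : 'cV[R]_(P 0%N)) = (- g, 0).
  by rewrite [LHS]surjective_pairing /= oppr0.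
have [D [HD H]] := dir_derivative_close (- g) hn0 mn0.
have [d1 ->] := dir_deriveE HD; split=> //.
move: H; rewrite -dotvZl -/M -/s norm2N dotvNr => H.
have gg : norm2 (c *: g) <= norm2 (c *: g - M) + norm2 M.
  by have := ler_norm2D (c *: g - M) M; rewrite subrK.
have gM : norm2 M <= norm2 (c *: g) + norm2 (c *: g - M).
  by have := ler_norm2_dist M (c *: g); rewrite norm2B.
have dM : `|dotv (c *: g - M) g| <= norm2 (c *: g - M) * norm2 g by exact: dotv_le.
have cg : norm2 (c *: g) = c * norm2 g by rewrite norm2Z_ge0 // ltW.
have dE : dotv (c *: g - M) g = c * norm2 g ^+ 2 - dotv M g.
  by rewrite dotvBl dotvZl norm2_sqr.
move: H hg big gg gM dM; rewrite cg dE; move: (norm2_ge0 g) (norm2_ge0 (c *: g - M)).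
move: (norm2 g) (norm2 (c *: g - M)) (norm2 M) (dotv M g) => a z b q.
move=> a0 z0 H hg big gg gM dM.
exact: (descent_scalar c0 a0 z0 H hg big gM dM).
Qed.

End GradientOfObjective.

(** * The axes *)

Section Axes.
Context {R : realType}.

Lemma network_ge0 (N : nat -> nat) (W : forall i, 'M[R]_(N i.+1, N i)) k l
    (V : 'M[R]_(l, N k)) x i : 0 <= network W V x i 0.
Proof. by rewrite /network /relu mxE le_max lexx orbT. Qed.

Lemma objective_swap n p l (G1 : 'cV[R]_n -> 'cV[R]_l) (G2 : 'cV[R]_p -> 'cV[R]_l)
    h0 m0 u :
  objective G1 G2 h0 m0 u = objective G2 G1 m0 h0 (swap u).
Proof. by rewrite /objective /swap /= !(hadamardC (G1 _)). Qed.

(** On an axis the product of the two networks vanishes, so to first order the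
    objective only sees its inner product with the entrywise nonnegative
    target. *)
Lemma axis_derivative_le0 (N P : nat -> nat)
    (W1 : forall i, 'M[R]_(N i.+1, N i)) (W2 : forall i, 'M[R]_(P i.+1, P i))
    k1 k2 l (V1 : 'M[R]_(l, N k1)) (V2 : 'M[R]_(l, P k2)) h0 m0 h v :
  let f := objective (network W1 V1) (network W2 V2) h0 m0 in
  dir_derivable f (h, 0) v /\ dir_derive f (h, 0) v <= 0.
Proof.
move=> f.
have [Z1 H1] := network_ray W1 V1 h v.1.
have [Z2 H2] := network_ray W2 V2 0 v.2.
have H1' : \forall t \near 0^'+,
    network W1 V1 (h + t *: v.1) = network W1 V1 h + t *: Z1.
  by apply: filterS H1 => t [].
have H2' : \forall t \near 0^'+,
    network W2 V2 (0 + t *: v.2) = network W2 V2 0 + t *: Z2.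
  by apply: filterS H2 => t [].
have := @dir_quotient_cvg R _ _ _ (network W1 V1) (network W2 V2) h0 m0 (h, 0)
  v Z1 Z2 H1' H2'.
move=> /dir_deriveE[d1 ->]; split=> //=.
rewrite network0 !hadamard0 !add0r dotvNl oppr_le0; apply: sumr_ge0 => i _.
have hE (x y : 'cV[R]_l) : hadamard x y i 0 = x i 0 * y i 0 by rewrite mxE.
rewrite !hE; apply: mulr_ge0; first by apply: mulr_ge0; exact: network_ge0.
apply: mulr_ge0; first exact: network_ge0.
have [t [[e2 _] t0]] := filter_ex (filterI H2 (nbhs_right_gt 0)).
have := network_ge0 W2 V2 (0 + t *: v.2) i.
rewrite e2 network0 add0r.
have -> : (t *: Z2) i 0 = t * Z2 i 0 by rewrite mxE.
by rewrite pmulr_rge0.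
Qed.

End Axes.

(** * Where the mean gradient is small *)

Section Landscape.
Context {R : realType}.

Lemma dotv_unitv_cosv n (x y : 'cV[R]_n) : dotv (unitv x) (unitv y) = cosv x y.
Proof. by rewrite /unitv dotvZl dotvZr /cosv invfM mulrA mulrC. Qed.

Lemma norm2_unitvK n (x : 'cV[R]_n) : x != 0 -> norm2 x *: unitv x = x.
Proof. by move=> x0; rewrite /unitv scalerA mulfV ?scale1r ?norm2_neq0. Qed.

Lemma norm2_unitv n (x : 'cV[R]_n) : x != 0 -> norm2 (unitv x) = 1.
Proof.
move=> x0; rewrite /unitv norm2Z_ge0 ?invr_ge0 ?norm2_ge0 //.
by rewrite mulVf ?norm2_neq0.
Qed.

Lemma dotv_unitvr n (x y : 'cV[R]_n) : x != 0 ->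
  dotv x (unitv y) = norm2 x * cosv x y.
Proof. by move=> x0; rewrite -{1}(norm2_unitvK x0) dotvZl dotv_unitv_cosv. Qed.

(** If the cosine is nonnegative then pass_coef >= 1 / 2 and the sine is small. If
    it is negative then pass_coef is only bounded below by a multiple of the
    sine, and the square of the sine is what is controlled, hence the w ^ 2. *)
Lemma direction_dichotomy n (h h0 : 'cV[R]_n) d (a w : R) :
    h != 0 -> h0 != 0 -> (0 < d)%N ->
    pass_coef (cosv h h0) * Num.sqrt (1 - cosv h h0 ^+ 2) <= 12 * a ->
    96 * a <= w ^+ 2 -> 0 <= w -> w <= 1 ->
  (norm2 (unitv h - unitv h0) <= w /\ `|corr (cosv h h0) d - 1| <= w) \/
  (norm2 (unitv h + unitv h0) <= w /\ `|corr (cosv h h0) d - rho d| <= w).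
Proof.
move=> hn0 h0n0 d0; have r : corr_range (cosv h h0) by exact: cosv_range.
have u1 := dotv_unitv hn0; have u2 := dotv_unitv h0n0.
have n1 : norm2 (unitv h - unitv h0) ^+ 2 = 2 - 2 * cosv h h0.
  rewrite norm2_sqr !(dotvBl, dotvBr) u1 u2 (dotvC (unitv h0)) dotv_unitv_cosv.
  by ring.
have n2 : norm2 (unitv h + unitv h0) ^+ 2 = 2 + 2 * cosv h h0.
  rewrite norm2_sqr !(dotvDl, dotvDr) u1 u2 (dotvC (unitv h0)) dotv_unitv_cosv.
  by ring.
set k := cosv h h0 in r n1 n2 *; set S := Num.sqrt _ => H aw w0 w1.
have /andP[k1 k2] := r.
have S0 : 0 <= S by exact: sqrtr_ge0.
have S2 : S ^+ 2 = 1 - k ^+ 2 by rewrite sqr_sqrtr //; nra.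
have p0 := pass_coef_ge0 r.
have ww : w ^+ 2 <= w by nra.
have [k0|k0] := leP 0 k.
  have ph : 2^-1 <= pass_coef k.
    rewrite ler_pdivlMr ?pi_gt0 //.
    have : acos k <= pi / 2.
      by rewrite -acos0; apply: acos_le => //; rewrite /corr_range; lra.
    by lra.
  have SS : S <= w ^+ 2 / 4 by nra.
  have S3 : S ^+ 2 <= w ^+ 2 / 2 by nra.
  left; split.
    apply: norm2_le_sqr => //; rewrite n1; nra.
  have := corr_lip d r (@corr_range1 R); rewrite corr1 => /le_trans; apply.
  by rewrite ler0_norm; nra.
have psi : S <= pi - acos k.
  rewrite /S -sin_acos //.
  have -> : sin (acos k) = sin (pi - acos k).
    by rewrite sinB sinpi cospi; ring.
  by apply: sin_le_id; rewrite subr_ge0 acos_lepi.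
have ph : S / 4 <= pass_coef k.
  rewrite ler_pdivlMr ?pi_gt0 //; have := @pi_le4 R; have := @pi_ge0 R.
  by nra.
have S3 : S ^+ 2 <= w ^+ 2 / 2 by rewrite expr2; nra.
right; split.
  by apply: norm2_le_sqr => //; rewrite n2; nra.
case: d d0 => // d _; rewrite rho_corr.
have := corr_lip d.+1 r (@corr_rangeN1 R) => /le_trans; apply.
by rewrite opprK ger0_norm; nra.
Qed.

(** The vector is tested against the direction of h, where the two coefficients
    of the back-projection combine into a correlation, and against the part of
    h0 orthogonal to h, where only xi remains. *)
Lemma mean_grad_components n p (h h0 : 'cV[R]_n) (m m0 : 'cV[R]_p) d (q : R) :
    h != 0 -> h0 != 0 -> 0 <= q ->
  let B := norm2 (norm2 m *: h - (norm2 m0 * q) *: backproj d h h0) in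
  let r := norm2 h * norm2 m in let r0 := norm2 h0 * norm2 m0 in
  `|r - r0 * (corr (cosv h h0) d * q)| <= B /\
  r0 * q * (xi (cosv h h0) d * Num.sqrt (1 - cosv h h0 ^+ 2)) <= B.
Proof.
move=> hn0 h0n0 q0 B r r0.
have rg : corr_range (cosv h h0) by exact: cosv_range.
set z := _ - _ in B *; set k := cosv h h0 in rg *.
have X0 := norm2_gt0 hn0.
have hu : dotv h (unitv h) = norm2 h by rewrite dotv_unitvr // cosvv // mulr1.
have h0u : dotv h0 (unitv h) = norm2 h0 * k.
  by rewrite dotv_unitvr // /k /cosv dotvC [norm2 h0 * norm2 h]mulrC.
split.
  have <- : dotv z (unitv h) = r - r0 * (corr k d * q).
    rewrite /z dotvBl !dotvZl hu /backproj dotvDl !dotvZl hu h0u corr_decomp.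
    rewrite -/k /r /r0; move: (xi k d) (zeta k d) => x y.
    by field; rewrite gt_eqF.
  apply: le_trans (dotv_le _ _) _.
  by rewrite norm2_unitv // mulr1.
pose o := unitv h0 - k *: unitv h.
set S := Num.sqrt _; have S0 : 0 <= S by exact: sqrtr_ge0.
have S2 : S ^+ 2 = 1 - k ^+ 2.
  by rewrite sqr_sqrtr //; move: rg; rewrite /corr_range; nra.
have oS : norm2 o <= S.
  apply: norm2_le_sqr => //; rewrite norm2_sqr S2 /o.
  have := dotv_unitv hn0; have := dotv_unitv h0n0; have := dotv_unitv_cosv h h0.
  rewrite -/k; move: (unitv h) (unitv h0) => a b ab bb aa.
  rewrite !(dotvBl, dotvBr, dotvZl, dotvZr) (dotvC b a) aa bb ab.
  by rewrite le_eqVlt; apply/orP; left; apply/eqP; ring.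
have ho : dotv h o = 0.
  by rewrite /o dotvBr dotvZr hu dotv_unitvr // -/k; ring.
have h0o : dotv h0 o = norm2 h0 * S ^+ 2.
  rewrite /o dotvBr dotvZr h0u dotv_unitvr // cosvv // S2; ring.
have zo : dotv z o = - (r0 * q * (xi k d * S) * S).
  rewrite /z dotvBl !dotvZl ho /backproj dotvDl !dotvZl ho h0o -/k /r0.
  by move: (xi k d) (zeta k d) => x y; ring.
have [Sz|Sn0] := eqVneq S 0; first by rewrite Sz !mulr0 norm2_ge0.
have Sp : 0 < S by rewrite lt_neqAle eq_sym Sn0.
rewrite -(ler_pM2r Sp).
have : - dotv z o <= B * S.
  apply: le_trans (ler_norm _) _; rewrite normrN; apply: le_trans (dotv_le _ _) _.
  by rewrite ler_wpM2l ?norm2_ge0.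
by rewrite zo opprK.
Qed.

Section Pair.
Context {n p : nat}.
Implicit Types (u v : 'cV[R]_n * 'cV[R]_p).

Lemma norm2_pairE u : norm2_pair u = norm2 (col_mx u.1 u.2).
Proof.
rewrite /norm2_pair !norm2_sqr /dotv /norm2; congr Num.sqrt.
rewrite big_split_ord /=; congr (_ + _); apply: eq_bigr => i _.
  by rewrite col_mxEu expr2.
by rewrite col_mxEd expr2.
Qed.

Lemma norm2_pair_sqr u : norm2_pair u ^+ 2 = norm2 u.1 ^+ 2 + norm2 u.2 ^+ 2.
Proof.
by rewrite /norm2_pair [LHS]sqr_sqrtr //; apply: addr_ge0; exact: sqr_ge0.
Qed.

Lemma norm2_pair_le u v (a : R) : 0 <= a ->
    norm2 u.1 <= a * norm2 v.1 -> norm2 u.2 <= a * norm2 v.2 ->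
  norm2_pair u <= a * norm2_pair v.
Proof.
move=> a0 h1 h2; rewrite norm2_pairE; apply: norm2_le_sqr.
  by rewrite mulr_ge0 ?sqrtr_ge0.
rewrite -norm2_pairE exprMn !norm2_pair_sqr.
by rewrite mulrDr -!exprMn lerD // ler_pXn2r ?nnegrE ?mulr_ge0 ?norm2_ge0.
Qed.

Lemma ler_norm2_pairB u v : norm2_pair (u - v) <= norm2_pair u + norm2_pair v.
Proof.
rewrite !norm2_pairE /= -(norm2N (col_mx v.1 v.2)).
by apply: le_trans (ler_norm2D _ _); rewrite opp_col_mx add_col_mx.
Qed.

Lemma norm2_pair_ge1 u : norm2 u.1 <= norm2_pair u.
Proof.
apply: norm2_le_sqr; first exact: sqrtr_ge0.
by rewrite norm2_pair_sqr lerDl sqr_ge0.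
Qed.

Lemma norm2_pair_ge2 u : norm2 u.2 <= norm2_pair u.
Proof.
apply: norm2_le_sqr; first exact: sqrtr_ge0.
by rewrite norm2_pair_sqr lerDr sqr_ge0.
Qed.

(** With relative radius above 1 the neighborhood swallows everything, because
    the rescaled centers (c ht, mt / c) are unbounded. *)
Lemma hyper_nbhd_full (eta : R) (ht : 'cV[R]_n) (mt : 'cV[R]_p) u :
  1 < eta -> ht != 0 \/ mt != 0 -> hyper_nbhd eta ht mt u.
Proof.
move=> e1 nz; rewrite /hyper_nbhd /=.
suff [c [c0 hc]] : exists c : R, 0 < c /\
    norm2_pair u <= (eta - 1) * norm2_pair (c *: ht, c^-1 *: mt).
  by exists c; split=> //; apply: le_trans (ler_norm2_pairB _ _) _; lra.
have e0 : 0 < eta - 1 by lra.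
have U0 : 0 <= norm2_pair u by exact: sqrtr_ge0.
have key x : 0 < x -> exists c : R, 0 < c /\ norm2_pair u <= (eta - 1) * (c * x).
  move=> x0; have ex : 0 < (eta - 1) * x by exact: mulr_gt0.
  exists ((norm2_pair u + 1) / ((eta - 1) * x)); split; first by rewrite divr_gt0 //; lra.
  by rewrite mulrCA divfK ?gt_eqF //; lra.
case: nz => [/norm2_gt0/key|/norm2_gt0/key] [c [c0 hc]].
  exists c; split=> //; apply: le_trans hc _; rewrite ler_pM2l //.
  apply: le_trans (norm2_pair_ge1 _); rewrite /= norm2Z_ge0 // ltW //.
exists c^-1; rewrite invr_gt0 invrK; split=> //.
apply: le_trans hc _; rewrite ler_pM2l //.
by apply: le_trans (norm2_pair_ge2 _); rewrite /= norm2Z_ge0 // ltW.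
Qed.

(** The parameter of the hyperbola is chosen to match the norm of h exactly, which
    leaves the product of the two norms to control that of m. *)
Lemma in_hyper_nbhd (h h0 : 'cV[R]_n) (m m0 : 'cV[R]_p) (s1 s2 q w eta : R) :
    h != 0 -> h0 != 0 -> m != 0 -> m0 != 0 ->
    norm2 (unitv h - s1 *: unitv h0) <= w ->
    norm2 (unitv m - s2 *: unitv m0) <= w ->
    `|s1| = 1 -> `|s2| = 1 -> 16^-1 <= q -> 0 <= w -> w <= 1 ->
    `|norm2 h * norm2 m - norm2 h0 * norm2 m0 * q|
      <= 3 * w * (norm2 h0 * norm2 m0) ->
    97 * w <= eta ->
  hyper_nbhd eta ((s1 * q) *: h0) (s2 *: m0) (h, m).
Proof.
move=> hn0 h0n0 mn0 m0n0 hw mw s11 s21 q16 w0 w1 hr we.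
have H0 := norm2_gt0 hn0; have H00 := norm2_gt0 h0n0.
have M0 := norm2_gt0 mn0; have M00 := norm2_gt0 m0n0.
have q0 : 0 < q by lra.
pose t := q * (norm2 h0 * norm2 m0) / norm2 h.
have t0 : 0 < t by rewrite /t divr_gt0 // !mulr_gt0.
have e0 : 0 <= eta by lra.
exists (norm2 h / (q * norm2 h0)); split.
  by rewrite divr_gt0 ?mulr_gt0.
have -> : (norm2 h / (q * norm2 h0)) *: ((s1 * q) *: h0)
    = norm2 h *: (s1 *: unitv h0).
  rewrite /unitv !scalerA; congr (_ *: _); field.
  by rewrite !gt_eqF.
have -> : (norm2 h / (q * norm2 h0))^-1 *: (s2 *: m0) = t *: (s2 *: unitv m0).
  rewrite /unitv !scalerA; congr (_ *: _); rewrite /t; field.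
  by rewrite !gt_eqF.
have tm : `|norm2 m - t| <= 48 * w * t.
  have -> : norm2 m - t = (norm2 h * norm2 m - norm2 h0 * norm2 m0 * q) / norm2 h.
    by rewrite /t; field; rewrite gt_eqF.
  rewrite normrM normfV (gtr0_norm H0) ler_pdivrMr //; apply: le_trans hr _.
  have -> : 48 * w * t * norm2 h = 3 * w * (norm2 h0 * norm2 m0) * (16 * q).
    by rewrite /t; field; rewrite gt_eqF.
  rewrite ler_peMr //; last lra.
  by rewrite !mulr_ge0 // ltW.
have nu1 : norm2 (s1 *: unitv h0) = 1 by rewrite norm2Z s11 norm2_unitv // mulr1.
have nu2 : norm2 (s2 *: unitv m0) = 1 by rewrite norm2Z s21 norm2_unitv // mulr1.
apply: norm2_pair_le => //=.
  have -> : h - norm2 h *: (s1 *: unitv h0) = norm2 h *: (unitv h - s1 *: unitv h0).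
    by rewrite scalerBr norm2_unitvK.
  rewrite (norm2Z _ (unitv h - _)) (norm2Z _ (s1 *: _)) nu1 (gtr0_norm H0).
  by rewrite mulr1 mulrC ler_pM2r //; lra.
rewrite (norm2Z _ (s2 *: _)) nu2 (gtr0_norm t0) mulr1.
have -> : m - t *: (s2 *: unitv m0)
   = norm2 m *: (unitv m - s2 *: unitv m0) + (norm2 m - t) *: (s2 *: unitv m0).
  by rewrite scalerBr norm2_unitvK // scalerBl addrA subrK.
apply: le_trans (ler_norm2D _ _) _.
rewrite (norm2Z _ (unitv m - _)) (norm2Z _ (s2 *: _)) nu2 (gtr0_norm M0) mulr1.
have mt : norm2 m <= 49 * t.
  by move: tm; rewrite ler_distl => /andP[_]; nra.
have h1 : norm2 m * norm2 (unitv m - s2 *: unitv m0) <= 49 * t * w.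
  by apply: ler_pM; rewrite ?norm2_ge0.
have : 97 * w * t <= eta * t by rewrite ler_pM2r.
by lra.
Qed.

End Pair.
End Landscape.

Section SmallMeanGradient.
Context {R : realType}.
Variables (N P : nat -> nat).

Lemma mean_grad_factor k1 k2 (h h0 : 'cV[R]_(N 0%N)) (m m0 : 'cV[R]_(P 0%N)) :
  mean_grad k1 k2 h0 m0 h m = norm2 m *: (norm2 m *: h
    - (norm2 m0 * corr (cosv m m0) k2.+1) *: backproj k1.+1 h h0).
Proof.
by rewrite /mean_grad /cross_mean scalerBr !scalerA expr2 [in RHS]mulrA.
Qed.

(** The component along h bounds r by 2 r0, after which all errors are relative
    to r0. The factor of m and m0 in the orthogonal component is at least 1 / 4
    because that network has two layers, and xi loses only d ^ 3 to
    pass_coef. *)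
Lemma small_mean_grad k1 k2 (h h0 : 'cV[R]_(N 0%N)) (m m0 : 'cV[R]_(P 0%N))
    (alpha E a : R) :
    h != 0 -> h0 != 0 -> m != 0 -> m0 != 0 -> (0 < k2)%N ->
    0 < alpha -> 0 <= a -> a <= 3^-1 -> 3 * E <= a * alpha ->
    norm2 (alpha *: mean_grad k1 k2 h0 m0 h m) <= 3 * (E * mean_scale h0 m0 h m) ->
  let r := norm2 h * norm2 m in let r0 := norm2 h0 * norm2 m0 in
  `|r - r0 * (corr (cosv h h0) k1.+1 * corr (cosv m m0) k2.+1)| <= 3 * a * r0 /\
  pass_coef (cosv h h0) * Num.sqrt (1 - cosv h h0 ^+ 2) <= 12 * (k1.+1%:R ^+ 3 * a).
Proof.
move=> hn0 h0n0 mn0 m0n0 k2_0 al0 a0 a1 Ea small r r0.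
have rh : corr_range (cosv h h0) by exact: cosv_range.
have rm : corr_range (cosv m m0) by exact: cosv_range.
have q4 : 4^-1 <= corr (cosv m m0) k2.+1 by exact: corr_ge.
have /andP[_ q1] := corr_in k2.+1 rm.
have /andP[_ p1] := corr_in k1.+1 rh; have p0 := corrS_ge0 k1 rh.
have M0 := norm2_gt0 mn0.
have r00 : 0 < r0 by rewrite /r0 mulr_gt0 // norm2_gt0.
move: small; rewrite mean_grad_factor.
set q := corr (cosv m m0) k2.+1 in q4 q1 *.
have q0 : 0 <= q by lra.
have := mean_grad_components m m0 k1.+1 hn0 h0n0 q0.
set B := norm2 (_ - _) => -[c1 c2].
have -> : norm2 (alpha *: (norm2 m *: (norm2 m *: h
    - (norm2 m0 * q) *: backproj k1.+1 h h0))) = alpha * (norm2 m * B).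
  by rewrite (norm2Z_ge0 _ (ltW al0)) (norm2Z_ge0 _ (ltW M0)).
have -> : mean_scale h0 m0 h m = norm2 m * (r + r0).
  by rewrite /mean_scale /r /r0 [norm2 h * _]mulrC [norm2 h0 * _]mulrC.
rewrite [alpha * _]mulrCA [E * _]mulrCA [3 * _]mulrCA ler_pM2l // => small.
rewrite -/r -/r0 in c1 c2.
set p := corr (cosv h h0) k1.+1 in p0 p1 c1 *.
set x := xi _ _ in c2; set S := Num.sqrt _ in c2 *.
have r_0 : 0 <= r by rewrite /r mulr_ge0 ?norm2_ge0.
have Bs : B <= a * (r + r0).
  rewrite -(ler_pM2l al0); apply: le_trans small _.
  rewrite !mulrA; apply: ler_wpM2r; first by rewrite addr_ge0 // ltW.
  by rewrite [alpha * a]mulrC.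
have pq : p * q <= 1 by rewrite -[X in _ <= X]mul1r; apply: ler_pM.
have rr : r <= 2 * r0.
  have h1 : r <= r0 * (p * q) + B by move: c1; rewrite ler_distl => /andP[].
  have h2 : r0 * (p * q) <= r0 * 1 by rewrite ler_pM2l.
  have h3 : a * (r + r0) <= 3^-1 * (r + r0) by rewrite ler_wpM2r // addr_ge0 // ltW.
  by lra.
have Bs' : B <= 3 * a * r0.
  have h3 : a * r <= a * (2 * r0) by rewrite ler_wpM2l.
  by lra.
split; first exact: le_trans c1 Bs'.
have xS : 0 <= x * S by rewrite mulr_ge0 ?xi_ge0 ?sqrtr_ge0.
have h1 : x * S <= 12 * a.
  have : q * (x * S) <= 3 * a.
    by rewrite -(ler_pM2l r00) [r0 * (q * _)]mulrA [r0 * (3 * a)]mulrC; exact: le_trans c2 Bs'.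
  have : 4^-1 * (x * S) <= q * (x * S) by rewrite ler_wpM2r.
  by lra.
have h2 : pass_coef (cosv h h0) * S <= x * k1.+1%:R ^+ 3 * S.
  by rewrite ler_wpM2r ?sqrtr_ge0 // xi_ge.
have h3 : k1.+1%:R ^+ 3 * (x * S) <= k1.+1%:R ^+ 3 * (12 * a) by rewrite ler_wpM2l ?exprn_ge0.
by lra.
Qed.

End SmallMeanGradient.

Section CriticalPoints.
Context {R : realType}.

Lemma prod_dist (p q p' q' w : R) : 0 <= q -> q <= 1 -> 0 <= p' -> p' <= 1 ->
  `|p - p'| <= w -> `|q - q'| <= w -> `|p * q - p' * q'| <= 2 * w.
Proof.
move=> q0 q1 p0 p1 hp hq.
have -> : p * q - p' * q' = (p - p') * q + p' * (q - q') by ring.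
apply: le_trans (ler_normD _ _) _; rewrite !normrM (ger0_norm q0) (ger0_norm p0).
have h1 : `|p - p'| * q <= w * 1 by apply: ler_pM.
have h2 : p' * `|q - q'| <= 1 * w by apply: ler_pM.
by lra.
Qed.

(** Each of h and m is almost parallel or almost antiparallel to its target, with
    correlation about 1 or about rho; the four combinations are the four
    neighborhoods. *)
Lemma critical_in_nbhds (N P : nat -> nat) k1 k2 (h h0 : 'cV[R]_(N 0%N)) (m m0 : 'cV[R]_(P 0%N))
    (alpha E a w eta : R) :
    h != 0 -> h0 != 0 -> m != 0 -> m0 != 0 -> (0 < k1)%N -> (0 < k2)%N ->
    0 < alpha -> 0 <= a -> 3 * E <= a * alpha ->
    96 * (k1.+1%:R ^+ 3 * a) <= w ^+ 2 -> 96 * (k2.+1%:R ^+ 3 * a) <= w ^+ 2 ->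
    0 <= w -> w <= 1 -> 97 * w <= eta ->
    norm2 (alpha *: mean_grad k1 k2 h0 m0 h m) <= 3 * (E * mean_scale h0 m0 h m) ->
    norm2 (alpha *: mean_grad k2 k1 m0 h0 m h) <= 3 * (E * mean_scale m0 h0 m h) ->
  [\/ hyper_nbhd eta h0 m0 (h, m),
      hyper_nbhd eta (- rho k1.+1 *: h0) m0 (h, m),
      hyper_nbhd eta (rho k2.+1 *: h0) (- m0) (h, m) |
      hyper_nbhd eta (- (rho k1.+1 * rho k2.+1) *: h0) (- m0) (h, m)].
Proof.
move=> hn0 h0n0 mn0 m0n0 k1_0 k2_0 al0 a0 Ea w1 w2 w_0 w_1 we.
have ww : w ^+ 2 <= w by nra.
have aw : 96 * a <= w.
  apply: le_trans ww; apply: le_trans w1; rewrite ler_pM2l // ler_peMl //.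
  by rewrite exprn_ege1 // ler1n.
have a1 : a <= 3^-1 by lra.
move=> /(small_mean_grad hn0 h0n0 mn0 m0n0 k2_0 al0 a0 a1 Ea) [hr hh].
move=> /(small_mean_grad mn0 m0n0 hn0 h0n0 k1_0 al0 a0 a1 Ea) [_ hm].
have rh : corr_range (cosv h h0) by exact: cosv_range.
have rm : corr_range (cosv m m0) by exact: cosv_range.
have r00 : 0 < norm2 h0 * norm2 m0 by rewrite mulr_gt0 // norm2_gt0.
have /andP[_ q1] := corr_in k2.+1 rm; have q0 := corrS_ge0 k2 rm.
have rho_bnd k : (0 < k)%N -> 4^-1 <= rho k.+1 :> R /\ rho k.+1 <= 1 :> R.
  move=> k0; rewrite rho_corr; split; first by apply: corr_ge; first exact: corr_rangeN1.
  by have /andP[] := corr_in k.+1 (@corr_rangeN1 R).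
have [ra ra1] := rho_bnd _ k1_0; have [rb rb1] := rho_bnd _ k2_0.
have one : 4^-1 <= 1 :> R by lra.
have fin (s1 s2 c1 c2 : R) : `|s1| = 1 -> `|s2| = 1 ->
    4^-1 <= c1 -> c1 <= 1 -> 4^-1 <= c2 -> c2 <= 1 ->
    norm2 (unitv h - s1 *: unitv h0) <= w ->
    norm2 (unitv m - s2 *: unitv m0) <= w ->
    `|corr (cosv h h0) k1.+1 - c1| <= w -> `|corr (cosv m m0) k2.+1 - c2| <= w ->
    hyper_nbhd eta ((s1 * (c1 * c2)) *: h0) (s2 *: m0) (h, m).
  move=> s11 s21 c1l c1u c2l c2u dh dm d1 d2.
  apply: (@in_hyper_nbhd _ _ _ _ _ _ _ _ _ _ w) => //; first by nra.
  have d3 : `|corr (cosv h h0) k1.+1 * corr (cosv m m0) k2.+1 - c1 * c2| <= 2 * w.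
    by apply: prod_dist => //; lra.
  have -> : norm2 h * norm2 m - norm2 h0 * norm2 m0 * (c1 * c2)
     = (norm2 h * norm2 m - norm2 h0 * norm2 m0
         * (corr (cosv h h0) k1.+1 * corr (cosv m m0) k2.+1))
       + norm2 h0 * norm2 m0
         * (corr (cosv h h0) k1.+1 * corr (cosv m m0) k2.+1 - c1 * c2) by ring.
  apply: le_trans (ler_normD _ _) _.
  rewrite [`|_ * (_ * _ - _)|]normrM (gtr0_norm r00).
  apply: le_trans (lerD hr (_ : _ <= norm2 h0 * norm2 m0 * (2 * w))) _.
    by rewrite ler_pM2l.
  have : 3 * a * (norm2 h0 * norm2 m0) <= w * (norm2 h0 * norm2 m0).
    by rewrite ler_pM2r //; lra.
  by lra.
have n1 : `|1 : R| = 1 by rewrite normr1.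
have n2 : `|-1 : R| = 1 by rewrite normrN1.
have [[dh ch]|[dh ch]] := direction_dichotomy hn0 h0n0 (ltn0Sn k1) hh w1 w_0 w_1;
have [[dm cm]|[dm cm]] := direction_dichotomy mn0 m0n0 (ltn0Sn k2) hm w2 w_0 w_1.
- by apply: Or41; have := fin 1 1 1 1; rewrite !mul1r !scale1r; apply.
- apply: Or43; have := fin 1 (-1) 1 (rho k2.+1).
  by rewrite !mul1r !scaleN1r scale1r opprK; apply.
- apply: Or42; have := fin (-1) 1 (rho k1.+1) 1.
  by rewrite mulr1 mulN1r !scaleN1r !scale1r opprK; apply.
- apply: Or44; have := fin (-1) (-1) (rho k1.+1) (rho k2.+1).
  by rewrite mulN1r !scaleN1r !opprK; apply.
Qed.

End CriticalPoints.

(** * Exchanging the two networks *)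

Section SwappedDescent.
Context {R : realType} {n p : nat}.
Variables (f : 'cV[R]_n * 'cV[R]_p -> R) (f' : 'cV[R]_p * 'cV[R]_n -> R).
Hypothesis ff : forall v, f v = f' (swap v).

Lemma grad_m_ray_swap u w :
  (fun delta : R => grad_m f (u + delta *: w))
  = (fun delta => grad_h f' (swap u + delta *: swap w)).
Proof. by apply/funext => delta; rewrite (grad_m_swap _ ff). Qed.

Lemma admissible_shift_swap u w : admissible_shift f u w ->
  admissible_shift f' (swap u) (swap w).
Proof. by apply: filterS => delta /(differentiable_swap ff). Qed.

Lemma g2_dir_swap u w : swap (- g2_dir f u w) = - g1_dir f' (swap u) (swap w).
Proof.
by rewrite /g2_dir /g1_dir grad_m_ray_swap.
Qed.

Lemma descent_swap u w :
  dir_derivable f' (swap u) (- g1_dir f' (swap u) (swap w)) /\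
  dir_derive f' (swap u) (- g1_dir f' (swap u) (swap w)) < 0 ->
  dir_derivable f u (- g2_dir f u w) /\ dir_derive f u (- g2_dir f u w) < 0.
Proof.
by rewrite /dir_derivable /dir_derive !(dir_quotient_swap _ _ ff) g2_dir_swap.
Qed.

End SwappedDescent.

Lemma hyper_nbhd_mono (R : realType) n p (eta eta' : R) (ht : 'cV[R]_n)
    (mt : 'cV[R]_p) u :
  eta <= eta' -> hyper_nbhd eta ht mt u -> hyper_nbhd eta' ht mt u.
Proof.
move=> le [c [c0 H]]; exists c; split=> //; apply: le_trans H _.
by apply: ler_wpM2r => //; exact: sqrtr_ge0.
Qed.

Lemma exprn_powR4 (R : realType) (x : R) : 0 < x -> (x `^ (1 / 4)) ^+ 4 = x.
Proof.
move=> x0; rewrite -powR_mulrn ?powR_ge0 // -powRrM div1r mulVf //.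
by rewrite powRr1 // ltW.
Qed.

(** * Choice of the constants *)

Section Constants.
Context {R : realType}.

(** The hypothesis bounds by 1 the relative radius of the largest neighborhood.
    It leaves many powers of the depths to spare: every bound reduces to
    X ^ k e <= al / 10 ^ 4 for k <= 8, with X = D S and e the fourth root of
    epsilon. *)
Lemma slack_constants (D S e al b a w : R) :
    2 <= D -> 2 <= S -> 0 < e -> 0 < al -> al <= 1 ->
    100 * 100 * (D ^+ 8 * S ^+ 8) * e <= al ->
    b = D * S * e ^+ 2 -> a = 99 * (D ^+ 2 * S ^+ 2 * e ^+ 2) / al ->
    w = 100 * (D ^+ 3 * S ^+ 3) * e / al ->
  [/\ b <= 4^-1, D * e ^+ 4 <= b ^+ 2, S * e ^+ 4 <= b ^+ 2,
      3 * (33 * (D * S * b)) < al &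
  [/\ 96 * (D ^+ 3 * a) <= w ^+ 2, 96 * (S ^+ 3 * a) <= w ^+ 2, w <= 1 &
      3 * (33 * (D * S * b)) <= a * al]].
Proof.
move=> D2 S2 e0 al0 al1 H bE aE wE.
have D1 : 1 <= D by exact: le_trans (ler1n _ 2) D2.
have S1 : 1 <= S by exact: le_trans (ler1n _ 2) S2.
have D0 : 0 < D by exact: lt_le_trans ltr01 D1.
have S0 : 0 < S by exact: lt_le_trans ltr01 S1.
have [X XE] : exists X, X = D * S by exists (D * S).
have X1 : 1 <= X by rewrite XE -[X in X <= _]mul1r; apply: ler_pM.
have X0 : 0 < X by exact: lt_le_trans ltr01 X1.
have DX : D <= X by rewrite XE ler_peMr // ltW.
have SX : S <= X by rewrite XE ler_peMl // ltW.
have XkE k : D ^+ k * S ^+ k = X ^+ k by rewrite XE exprMn.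
have Xmono i j : (i <= j)%N -> X ^+ i <= X ^+ j by move=> ij; rewrite ler_weXn2l.
have Xge0 k : 0 <= X ^+ k by rewrite exprn_ge0 // ltW.
have Xe k : (k <= 8)%N -> 100 * (100 * (X ^+ k * e)) <= al.
  move=> k8; apply: le_trans H; rewrite XkE.
  have -> Y : 100 * 100 * Y * e = 100 * (100 * (Y * e)) by ring.
  by rewrite ler_pM2l // ler_pM2l // ler_pM2r // Xmono.
have Xe1 := Xe 1%N isT; have Xe2 := Xe 2%N isT; have Xe3 := Xe 3%N isT.
have e1 : e <= 1.
  have := Xe 0%N isT; rewrite expr0 mul1r; clear -e0 al1; lra.
have e2 : e ^+ 2 <= e by rewrite expr2 ler_piMl // (ltW e0).
have ee : 0 <= e ^+ 2 by exact: sqr_ge0.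
have e4 : 0 <= e ^+ 4 by rewrite exprn_ge0 // ltW.
have XX : X <= X ^+ 2 by rewrite -[X in X <= _]expr1; exact: Xmono.
have bX : b = X * e ^+ 2 by rewrite bE XE.
have b2 : b ^+ 2 = X ^+ 2 * e ^+ 4 by rewrite bX; ring.
have wX : w = 100 * (X ^+ 3 * e) / al by rewrite wE XkE -[100 * _ * e]mulrA.
have aX : a = 99 * (X ^+ 2 * e ^+ 2) / al by rewrite aE XkE.
have DSb : 3 * (33 * (D * S * b)) = 99 * (X ^+ 2 * e ^+ 2) by rewrite bX -XE; ring.
have aw Z : 0 <= Z -> Z <= X -> 96 * (Z ^+ 3 * a) <= w ^+ 2.
  move=> Z0 ZX; rewrite aX wX.
  have -> : 96 * (Z ^+ 3 * (99 * (X ^+ 2 * e ^+ 2) / al))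
    = (96 * 99 * (Z ^+ 3 * X ^+ 2 * e ^+ 2) * al) / al ^+ 2.
    by field; rewrite gt_eqF.
  have -> : (100 * (X ^+ 3 * e) / al) ^+ 2
    = (100 * 100 * (X ^+ 6 * e ^+ 2)) / al ^+ 2.
    by field; rewrite gt_eqF.
  rewrite ler_pM2r ?invr_gt0 ?exprn_gt0 //.
  have z3 : Z ^+ 3 <= X ^+ 3 by rewrite ler_pXn2r // nnegrE // ltW.
  have h1 : Z ^+ 3 * X ^+ 2 * e ^+ 2 <= X ^+ 6 * e ^+ 2.
    apply: ler_wpM2r => //; apply: le_trans (_ : X ^+ 3 * X ^+ 2 <= _).
      by apply: ler_wpM2r.
    by rewrite -exprD; exact: Xmono.
  have h0 : 0 <= Z ^+ 3 * X ^+ 2 * e ^+ 2.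
    by apply: mulr_ge0 => //; apply: mulr_ge0 => //; exact: exprn_ge0.
  move: h0 h1; move: (Z ^+ 3 * X ^+ 2 * e ^+ 2) (X ^+ 6 * e ^+ 2) => u v h0 h1.
  have h2 : u * al <= v by apply: le_trans h1; rewrite ler_piMr.
  by clear -h2 h0 h1; lra.
have X2e : X ^+ 2 * e ^+ 2 <= X ^+ 2 * e by rewrite ler_wpM2l.
have X2e0 : 0 < X ^+ 2 * e by rewrite mulr_gt0 ?exprn_gt0.
have X1e : X * e ^+ 2 <= X * e by rewrite ler_wpM2l // ltW.
split.
- by rewrite bX; move: Xe1 X1e; rewrite expr1; clear -al1; lra.
- by rewrite b2 ler_wpM2r //; exact: le_trans DX XX.
- by rewrite b2 ler_wpM2r //; exact: le_trans SX XX.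
- by rewrite DSb; clear -X2e X2e0 Xe2; lra.
split; [exact: aw (ltW D0) DX | exact: aw (ltW S0) SX | |].
- rewrite wX ler_pdivrMr // mul1r; apply: le_trans Xe3.
  have : 0 <= X ^+ 3 * e by rewrite mulr_ge0 // ltW.
  by clear; lra.
- by rewrite DSb aX divfK ?gt_eqF.
Qed.

End Constants.

(** * The theorem *)

Section Descent.
Context {R : realType}.
Variables (N P : nat -> nat).
Variables (W1 : forall i, 'M[R]_(N i.+1, N i)) (W2 : forall i, 'M[R]_(P i.+1, P i)).
Variables (k1 k2 l : nat) (V1 : 'M[R]_(l, N k1)) (V2 : 'M[R]_(l, P k2)).

(** The factor S makes the slack symmetric in the two networks. *)
Lemma cross_mean_slack (e alpha b S : R) : 0 <= e -> 0 <= alpha -> alpha <= 1 ->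
    0 <= b -> b <= 4^-1 -> k1.+1%:R * e <= b ^+ 2 -> k2.+1%:R * e <= b ^+ 2 ->
    1 <= S -> (0 < l)%N -> layers_WDC W1 e k1 -> layers_WDC W2 e k2 ->
    joint_WDC_left V1 V2 e alpha ->
  forall h h' m m', h != 0 -> m != 0 ->
  norm2 ((2 ^+ k1.+1 * 2 ^+ k2.+1 * l%:R) *: cross W1 W2 V1 V2 h h' m m'
     - alpha *: cross_mean k1 k2 h h' m m')
    <= (33 * (k1.+1%:R * S * b)) * (norm2 m * norm2 m' * norm2 h').
Proof.
move=> e0 a0 a1 b0 b1 hb1 hb2 S1 l0 H1 H2 J h h' m m' hn0 mn0.
apply: le_trans (cross_close _ _ e0 a0 a1 b0 b1 hb1 hb2 l0 H1 H2 J hn0 mn0) _.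
apply: ler_wpM2r; first by rewrite !mulr_ge0 ?norm2_ge0.
by rewrite ler_pM2l // mulrAC ler_peMr // mulr_ge0.
Qed.

(** When a target vanishes the mean gradient in h is that of |h|^2 |m|^2 / 2. *)
Lemma mean_grad_big_degenerate (h0 h : 'cV[R]_(N 0%N)) (m0 m : 'cV[R]_(P 0%N))
    (alpha E : R) : h != 0 -> m != 0 -> h0 = 0 \/ m0 = 0 -> 3 * E < alpha ->
    0 < alpha ->
  3 * (E * mean_scale h0 m0 h m) < norm2 (alpha *: mean_grad k1 k2 h0 m0 h m).
Proof.
move=> hn0 mn0 z Ea al0; have X0 := norm2_gt0 hn0; have Y0 := norm2_gt0 mn0.
have -> : mean_scale h0 m0 h m = norm2 m ^+ 2 * norm2 h.
  by rewrite /mean_scale; case: z => ->; rewrite norm2_0; ring.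
have -> : mean_grad k1 k2 h0 m0 h m = norm2 m ^+ 2 *: h.
  rewrite /mean_grad /cross_mean; case: z => ->.
    by rewrite backproj0 scaler0 subr0.
  by rewrite norm2_0 mulr0 mul0r scale0r subr0.
rewrite (norm2Z_ge0 _ (ltW al0)) norm2Z_ge0 ?sqr_ge0 // mulrA ltr_pM2r //.
by rewrite mulr_gt0 // exprn_gt0.
Qed.

End Descent.

Unset Implicit Arguments.

Theorem theorem3 (R : realType) :
  (exists K1 K2 : R, [/\ 0 < K1, 0 < K2 &
    forall (d s : nat) (eps alpha1 alpha2 : R)
      (N P : nat -> nat) (l : nat)
      (W1 : forall i : nat, 'M[R]_(N i.+1, N i)) (V1 : 'M[R]_(l, N d.-1))
      (W2 : forall i : nat, 'M[R]_(P i.+1, P i)) (V2 : 'M[R]_(l, P s.-1))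
      (h0 : 'cV[R]_(N 0%N)) (m0 : 'cV[R]_(P 0%N)),
      let alpha := alpha1 * alpha2 in
      let eps4 := eps `^ (1 / 4) in
      let f := objective (network W1 V1) (network W2 V2) h0 m0 in
      let A :=
        hyper_nbhd (K2 * (d ^ 3 * s ^ 3)%N%:R * eps4 / alpha) h0 m0
        `|` hyper_nbhd (K2 * (d ^ 8 * s ^ 3)%N%:R * eps4 / alpha)
              (- rho d *: h0) m0
        `|` hyper_nbhd (K2 * (d ^ 3 * s ^ 8)%N%:R * eps4 / alpha)
              (rho s *: h0) (- m0)
        `|` hyper_nbhd (K2 * (d ^ 8 * s ^ 8)%N%:R * eps4 / alpha)
              (- (rho d * rho s) *: h0) (- m0) in
      (2 <= d)%N -> (2 <= s)%N ->
      0 < eps ->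
      0 < alpha1 -> alpha1 <= 1 -> 0 < alpha2 -> alpha2 <= 1 ->
      K1 * (d ^ 7 * s ^ 2 + d ^ 2 * s ^ 7)%N%:R * eps4 / (alpha1 * alpha2) < 1 ->
      (forall i : nat, (i.+1 < d)%N -> (N i < N i.+1)%N) -> (N d.-1 < l)%N ->
      (forall i : nat, (i.+1 < s)%N -> (P i < P i.+1)%N) -> (P s.-1 < l)%N ->
      (forall i : nat, (i.+1 < d)%N -> WDC (W1 i) eps 1) ->
      (forall i : nat, (i.+1 < s)%N -> WDC (W2 i) eps 1) ->
      WDC V1 eps alpha1 ->
      WDC V2 eps alpha2 ->
      joint_WDC V1 V2 eps alpha ->
      (h0, m0) <> (0, 0) ->
      (forall u : 'cV[R]_(N 0%N) * 'cV[R]_(P 0%N), ~ (A `|` axes) u ->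
         forall w : 'cV[R]_(N 0%N) * 'cV[R]_(P 0%N), admissible_shift f u w ->
           [/\ cvg (grad_h f (u + delta *: w) @[delta --> 0^'+]),
               cvg (grad_m f (u + delta *: w) @[delta --> 0^'+]) &
               (dir_derivable f u (- g1_dir f u w) /\
                dir_derive f u (- g1_dir f u w) < 0)
               \/ (dir_derivable f u (- g2_dir f u w) /\
                   dir_derive f u (- g2_dir f u w) < 0)])
      /\
      (forall u : 'cV[R]_(N 0%N) * 'cV[R]_(P 0%N), axes u ->
         forall v : 'cV[R]_(N 0%N) * 'cV[R]_(P 0%N),
           dir_derivable f u v /\ dir_derive f u v <= 0)])
  /\ (forall a : nat, (2 <= a)%N -> 0 < rho a :> R)
  /\ (rho a : R) @[a --> \oo] --> (1 : R).
Proof.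
split; last by split; [exact: rho_gt0 | exact: rho_cvg].
(* 100 * 100 exceeds 97 times the constant 100 in the distance w below. *)
exists 1, (100 * 100); split=> //.
move=> [//|k1] [//|k2] eps alpha1 alpha2 N P l W1 V1 W2 V2 h0 m0.
rewrite [k1.+1.-1]/= [k2.+1.-1]/= in V1 V2 *.
move=> alpha e f A k1_0 k2_0 eps0 al10 al11 al20 al21 _ _ Nl _ _ HW1 HW2 _ _ J nz.
rewrite !ltnS in k1_0 k2_0.
pose f' := objective (network W2 V2) (network W1 V1) m0 h0.
have ff v : f v = f' (swap v) by exact: objective_swap.
split; last first.
  move=> u [[h _ <-]|[m _ <-]] v; first exact: axis_derivative_le0.
  rewrite /dir_derivable /dir_derive (dir_quotient_swap _ _ ff).
  exact: axis_derivative_le0.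
have al0 : 0 < alpha by rewrite mulr_gt0.
have al1 : alpha <= 1 by rewrite -[X in _ <= X]mul1r; apply: ler_pM => //; exact: ltW.
have e0 : 0 < e by exact: powR_gt0.
have eE : e ^+ 4 = eps by exact: exprn_powR4.
move=> u nAK w adm; have uE := surjective_pairing u.
have hn0 : u.1 != 0.
  by apply/eqP => hE; apply: nAK; right; right; exists u.2; rewrite // {2}uE hE.
have mn0 : u.2 != 0.
  by apply/eqP => mE; apply: nAK; right; left; exists u.1; rewrite // {2}uE mE.
have adm' : admissible_shift f' (swap u) (swap w) by exact: (admissible_shift_swap ff adm).
have rho_n0 k : (0 < k)%N -> rho k.+1 != 0 :> R by move=> k0; rewrite gt_eqF // rho_gt0.
(* A neighborhood of relative radius above 1 is the whole space, so the point u
   being outside the largest one forces epsilon to be tiny. *)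
have nA4 : ~ hyper_nbhd (100 * 100 * (k1.+1 ^ 8 * k2.+1 ^ 8)%N%:R * e / alpha)
              (- (rho k1.+1 * rho k2.+1) *: h0) (- m0) u.
  by move=> hA; apply: nAK; left; right.
have small : 100 * 100 * (k1.+1%:R ^+ 8 * k2.+1%:R ^+ 8) * e <= alpha.
  rewrite leNgt; apply/negP => big; apply: nA4; apply: hyper_nbhd_full.
    by rewrite ltr_pdivlMr // mul1r natrM !natrX.
  have [hz|hnz] := eqVneq h0 0; last first.
    by left; rewrite scaler_eq0 oppr_eq0 mulf_eq0 !negb_or !rho_n0.
  right; rewrite oppr_eq0; apply/eqP => mz; apply: nz; by rewrite hz mz.
have D2 : 2 <= k1.+1%:R :> R by rewrite ler_nat.
have S2 : 2 <= k2.+1%:R :> R by rewrite ler_nat.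
have := slack_constants D2 S2 e0 al0 al1 small (erefl _) (erefl _) (erefl _).
set D := k1.+1%:R; set S := k2.+1%:R; rewrite eE.
set b := D * S * e ^+ 2; set a := 99 * _ / alpha; set r := 100 * _ * e / alpha.
set E := 33 * (D * S * b).
move=> -[b1 hb1 hb2 Eal [a1 a2 r1 Ea]].
have b0 : 0 <= b by apply: mulr_ge0; [exact: mulr_ge0 | exact: sqr_ge0].
have l0 : (0 < l)%N by apply: leq_ltn_trans Nl.
have HL1 : layers_WDC W1 eps k1 by move=> i ik; apply: HW1; rewrite ltnS.
have HL2 : layers_WDC W2 eps k2 by move=> i ik; apply: HW2; rewrite ltnS.
have c0 (i j : nat) : 0 < 2 ^+ i * 2 ^+ j * l%:R :> R.
  by rewrite !mulr_gt0 ?exprn_gt0 // ltr0n.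
have X1 := @cross_mean_slack R N P W1 W2 k1 k2 l V1 V2 eps alpha b S (ltW eps0)
  (ltW al0) al1 b0 b1 hb1 hb2 (le_trans (ler1n _ 2) S2) l0 HL1 HL2 (joint_WDC_leftl J).
have X2 := @cross_mean_slack R P N W2 W1 k2 k1 l V2 V1 eps alpha b D (ltW eps0)
  (ltW al0) al1 b0 b1 hb2 hb1 (le_trans (ler1n _ 2) D2) l0 HL2 HL1 (joint_WDC_leftr J).
rewrite -/D -/S -/E in X1; rewrite -/D -/S [S * D]mulrC -/E in X2.
have [big|small1] := ltP (3 * (E * mean_scale h0 m0 u.1 u.2))
    (norm2 (alpha *: mean_grad k1 k2 h0 m0 u.1 u.2)).
  split; first exact: (grad_h_cvg adm).
    by rewrite (grad_m_ray_swap ff); exact: (grad_h_cvg adm').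
  by left; exact: (descent_h X1 (c0 _ _) hn0 mn0 adm big).
have [big|small2] := ltP (3 * (E * mean_scale m0 h0 u.2 u.1))
    (norm2 (alpha *: mean_grad k2 k1 m0 h0 u.2 u.1)).
  split; first exact: (grad_h_cvg adm).
    by rewrite (grad_m_ray_swap ff); exact: (grad_h_cvg adm').
  right; apply: (descent_swap ff).
  exact: (descent_h (u := swap u) X2 (c0 _ _) mn0 hn0 adm' big).
have [hz|h0n0] := eqVneq h0 0.
  have big := mean_grad_big_degenerate k1 k2 hn0 mn0 (or_introl hz : h0 = 0 \/ m0 = 0) Eal al0.
  by have := lt_le_trans big small1; rewrite ltxx.
have [mz|m0n0] := eqVneq m0 0.
  have big := mean_grad_big_degenerate k1 k2 hn0 mn0 (or_intror mz : h0 = 0 \/ m0 = 0) Eal al0.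
  by have := lt_le_trans big small1; rewrite ltxx.
have a0 : 0 <= a.
  apply: divr_ge0; last exact: ltW.
  apply: mulr_ge0 => //; apply: mulr_ge0; last exact: sqr_ge0.
  by apply: mulr_ge0; exact: sqr_ge0.
have r0 : 0 <= r.
  apply: divr_ge0; last exact: ltW.
  apply: mulr_ge0; last exact: ltW.
  by apply: mulr_ge0 => //; apply: mulr_ge0; exact: exprn_ge0.
have D1 : 1 <= D by exact: le_trans (ler1n _ 2) D2.
have S1 : 1 <= S by exact: le_trans (ler1n _ 2) S2.
exfalso; apply: nAK; left.
pose eta0 : R := 100 * 100 * (k1.+1 ^ 3 * k2.+1 ^ 3)%N%:R * e / alpha.
have reta : 97 * r <= eta0.
  have -> : eta0 = 100 * r by rewrite /eta0 /r natrM !natrX; ring.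
  by apply: ler_wpM2r => //; rewrite ler_nat.
have etaE (i j : nat) : (3 <= i)%N -> (3 <= j)%N ->
    eta0 <= 100 * 100 * (k1.+1 ^ i * k2.+1 ^ j)%N%:R * e / alpha.
  move=> i3 j3; apply: ler_wpM2r; first by rewrite invr_ge0 ltW.
  apply: ler_wpM2r; first exact: ltW.
  by apply: ler_wpM2l => //; rewrite ler_nat leq_mul // leq_pexp2l.
case: (critical_in_nbhds hn0 h0n0 mn0 m0n0 k1_0 k2_0 al0 a0 Ea a1 a2 r0 r1 reta
  small1 small2); rewrite -uE => H.
- by left; left; left; apply: hyper_nbhd_mono H; exact: etaE.
- by left; left; right; apply: hyper_nbhd_mono H; exact: etaE.
- by left; right; apply: hyper_nbhd_mono H; exact: etaE.
- by right; apply: hyper_nbhd_mono H; exact: etaE.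
Qed.
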